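(* Let $(M,F)$ be a Finsler surface and let $\hat\gamma^\perp$ be the normal lift to $\Sigma$ of a smooth curve $\gamma$ on $M$. Consider the Euler-Lagrange equation $$(I_3\circ\hat\gamma^\perp+1)\,k_T^{(N)}=(I_1\circ\hat\gamma^\perp)\,\sigma^2 ,$$ which characterizes the $N$-extremals. (1) If $I_1\circ\hat\gamma^\perp=0$, then the Euler-Lagrange equation implies $k_T^{(N)}=0$, provided $I_3\circ\hat\gamma^\perp+1\neq0$; i.e. in this case the $N$-extremals are the $N$-parallels. Conversely, if the $N$-parallels are $N$-extremals, then $I_1\circ\hat\gamma^\perp=0$ (along the normal lifts $\hat\gamma^\perp$ of the $N$-parallels). (2) If $I_1\circ\hat\gamma^\perp\neq0$, then the Euler-Lagrange equation implies $$k_T^{(N)}=\frac{I_1\circ\hat\gamma^\perp}{I_3\circ\hat\gamma^\perp+1}\,\sigma^2,$$ provided $I_3\circ\hat\gamma^\perp+1\neq0$; i.e. in this case the $N$-extremals are those curves whose $N$-parallel curvature is given by this formula.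
   Context: Finsler surface: $M$ is a smooth (oriented) surface and $F:TM\to[0,\infty)$ is smooth on $TM\setminus\{0\}$ and restricts to a Minkowski norm on each $T_xM$; $g_{ij}(x,y)=\frac12\frac{\partial^2F^2}{\partial y^i\partial y^j}$, and for $0\neq N\in T_xM$, $g_N(U,V)=g_{ij}(x,N)U^iV^j$. $\Sigma=\{F=1\}\subset TM$ is the indicatrix bundle, a 3-manifold. It carries the coframe $\omega^1,\omega^2,\omega^3$, where $\omega^1=\frac{\sqrt{g}}{F}(y^2dx^1-y^1dx^2)$ (with $g=\det(g_{ij})$), $\omega^2=\frac{\partial F}{\partial y^1}dx^1+\frac{\partial F}{\partial y^2}dx^2$, and $\omega^3$ is determined by the structure equations $d\omega^1=-I\omega^1\wedge\omega^3+\omega^2\wedge\omega^3$, $d\omega^2=-\omega^1\wedge\omega^3$, $d\omega^3=K\omega^1\wedge\omega^2-J\omega^1\wedge\omega^3$, with $I$ (the Cartan scalar), $J$, $K$ smooth functions on $\Sigma$. For a function $f$ on $\Sigma$, $f_1,f_2,f_3$ are defined by $df=f_1\omega^1+f_2\omega^2+f_3\omega^3$. Normal lift: for a smooth curve $\gamma$ on $M$ with tangent $T=\dot\gamma$, parameterized so that $F(\gamma,\dot\gamma)=1$, let $N$ be the normal field along $\gamma$ with $g_N(N,N)=1$, $g_N(N,T)=0$. The normal lift is $\hat\gamma^\perp(t)=(\gamma(t),N(t))\in\Sigma$. Put $\sigma=\omega^1(\dot{\hat\gamma}^\perp)$, so $\sigma^2=g_N(T,T)\ne0$. With $(D_T^{(N)}U)^i=\frac{dU^i}{dt}+T^jU^k\Gamma^i_{jk}(\gamma,N)$,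 $\Gamma^i_{jk}$ the Chern connection coefficients, the $N$-parallel curvature $k_T^{(N)}$ is defined by $D_T^{(N)}N=-\frac{k_T^{(N)}}{\sigma^2}T$; equivalently $\omega^3(\dot{\hat\gamma}^\perp)=-\frac{k_T^{(N)}}{\sigma}$. The curve $\gamma$ is called an $N$-parallel if $D_T^{(N)}N=0$, i.e. $k_T^{(N)}=0$. $N$-extremals are the extremals, with respect to compactly supported variations through curves of the same kind, of the functional $\Phi(\hat\gamma^\perp)=\int_{\hat\gamma^\perp}\omega^1$ on the set of curves $\hat\gamma^\perp:(a,b)\to\Sigma$ with $\hat\gamma^{\perp*}\omega^2=0$ and $\hat\gamma^{\perp*}\omega^1\neq0$; equivalently, they are the solutions of the displayed Euler-Lagrange equation. *)

(* Defs.v *)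
From Stdlib Require Import Reals.
From Coquelicot Require Import Coquelicot.
Open Scope R_scope.

Set Implicit Arguments.

Definition R2 : NormedModule R_AbsRing :=
  prod_NormedModule R_AbsRing R_NormedModule R_NormedModule.

(* Points (x, y) of a tangent bundle in coordinates, or tangent vectors
   (dx, dy) at such points. *)
Definition R4 : NormedModule R_AbsRing := prod_NormedModule R_AbsRing R2 R2.

Definition dirD {V : NormedModule R_AbsRing} (f : V -> R) (x v : V) : R :=
  Derive (fun h : R => f (plus x (scal h v))) 0.

Fixpoint Ck {V : NormedModule R_AbsRing} (k : nat) (U : V -> Prop)
    (f : V -> R) : Prop :=
  match k with
  | O => forall x, U x -> continuous f x
  | S k' => (forall x, U x -> ex_filterdiff f (locally x)) /\
            (forall v, Ck k' U (fun x => dirD f x v))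
  end.

(* Meant for open U. *)
Definition smooth {V : NormedModule R_AbsRing} (U : V -> Prop) (f : V -> R) :=
  forall k, Ck k U f.

Definition dirD2 {V : NormedModule R_AbsRing} (f : V -> R2) (x v : V) : R2 :=
  (dirD (fun z => fst (f z)) x v, dirD (fun z => snd (f z)) x v).

Definition smooth2 {V : NormedModule R_AbsRing} (U : V -> Prop) (f : V -> R2) :=
  smooth U (fun z => fst (f z)) /\ smooth U (fun z => snd (f z)).

Inductive ix := i1 | i2.

Definition cmp (i : ix) (u : R2) : R :=
  match i with i1 => fst u | i2 => snd u end.

Definition basis (i : ix) : R2 :=
  match i with i1 => (1, 0) | i2 => (0, 1) end.

Definition sum2 (f : ix -> R) : R := f i1 + f i2.

Definition dx (i : ix) (f : R4 -> R) (z : R4) : R :=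
  dirD f z (basis i, zero : R2).
Definition dy (i : ix) (f : R4 -> R) (z : R4) : R :=
  dirD f z (zero : R2, basis i).

(* A set with an oriented smooth atlas whose induced topology is Hausdorff and
   second countable; [chart_at p] is a preferred chart around [p]. *)
Section Atlas.

Variables (point index : Type) (dom : index -> point -> Prop)
  (chart : index -> point -> R2) (chart_inv : index -> R2 -> point).

Definition chart_image (a : index) (A : point -> Prop) : R2 -> Prop :=
  fun x => exists p, dom a p /\ A p /\ chart a p = x.

Definition atlas_open (A : point -> Prop) : Prop :=
  forall a, open (chart_image a A).

Definition transition (a b : index) (x : R2) : R2 := chart b (chart_inv a x).

End Atlas.

Record oriented_surface := {
  point :> Type;
  index : Type;
  dom : index -> point -> Prop;
  chart : index -> point -> R2;
  chart_inv : index -> R2 -> point;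
  chart_at : point -> index;
  chart_at_dom : forall p, dom (chart_at p) p;
  chart_invK : forall a p, dom a p -> chart_inv a (chart a p) = p;
  dom_open : forall a, atlas_open dom chart (dom a);
  transition_smooth : forall a b,
    smooth2 (chart_image dom chart a (dom b)) (transition chart chart_inv a b);
  transition_oriented : forall a b x, chart_image dom chart a (dom b) x ->
    0 < cmp i1 (dirD2 (transition chart chart_inv a b) x (basis i1)) *
        cmp i2 (dirD2 (transition chart chart_inv a b) x (basis i2)) -
        cmp i2 (dirD2 (transition chart chart_inv a b) x (basis i1)) *
        cmp i1 (dirD2 (transition chart chart_inv a b) x (basis i2));
  surface_hausdorff : forall p q, p <> q ->
    exists A B, atlas_open dom chart A /\ atlas_open dom chart B /\
      A p /\ B q /\ forall r, ~ (A r /\ B r);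
  surface_second_countable : exists B : nat -> point -> Prop,
    (forall n, atlas_open dom chart (B n)) /\
    (forall A p, atlas_open dom chart A -> A p ->
       exists n, B n p /\ forall q, B n q -> A q)
}.

Arguments dom {o}.
Arguments chart {o}.
Arguments chart_inv {o}.
Arguments chart_at {o}.

Section Surface.

Variable M : oriented_surface.

(* A tangent vector at [p] is given by its components in the chart
   [chart_at p]. *)
Definition TM : Type := (point M * R2)%type.

Definition dtransition (a b : index M) (x y : R2) : R2 :=
  dirD2 (transition chart chart_inv a b) x y.

Definition coord (a : index M) (z : TM) : R4 :=
  (chart a (fst z),
   dtransition (chart_at (fst z)) a (chart (chart_at (fst z)) (fst z)) (snd z)).

Definition of_coord (a : index M) (z : R4) : TM :=
  (chart_inv a (fst z),
   dtransition a (chart_at (chart_inv a (fst z))) (fst z) (snd z)).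

Definition in_chart (a : index M) (f : TM -> R) : R4 -> R :=
  fun z => f (of_coord a z).

(* TM minus the zero section, over the chart [a]. *)
Definition slit (a : index M) : R4 -> Prop :=
  fun z => chart_image dom chart a (dom a) (fst z) /\ snd z <> (zero : R2).

Definition smooth_slit (f : TM -> R) : Prop :=
  forall a, smooth (slit a) (in_chart a f).

Definition smooth_into {W : NormedModule R_AbsRing} (U : W -> Prop)
    (c : W -> TM) : Prop :=
  forall a, let Ua := fun w => U w /\ dom a (fst (c w)) in
    open Ua /\ smooth2 Ua (fun w => fst (coord a (c w))) /\
    smooth2 Ua (fun w => snd (coord a (c w))).

Definition gij (F : TM -> R) (a : index M) (i j : ix) (z : R4) : R :=
  / 2 * dy i (dy j (fun w => in_chart a F w ^ 2)) z.

Definition gdot (F : TM -> R) (a : index M) (z : R4) (u v : R2) : R :=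
  sum2 (fun i => sum2 (fun j => gij F a i j z * cmp i u * cmp j v)).

Record finsler := {
  norm_of :> TM -> R;
  norm_ge0 : forall z, 0 <= norm_of z;
  norm_smooth : smooth_slit norm_of;
  norm_homogeneous : forall (p : M) (y : R2) (l : R), 0 < l ->
    norm_of (p, scal l y) = l * norm_of (p, y);
  norm_strongly_convex : forall a z, slit a z -> forall u : R2, u <> zero ->
    0 < gdot norm_of a z u u
}.

Variable F : finsler.

Definition sphere (z : TM) : Prop := snd z <> (zero : R2) /\ F z = 1.

Definition sphere_in (a : index M) (z : R4) : Prop :=
  slit a z /\ in_chart a F z = 1.

Definition tangent_sphere (a : index M) (z u : R4) : Prop :=
  dirD (in_chart a F) z u = 0.

(* Functions and forms on the indicatrix bundle are represented by smooth
   extensions to the slit tangent bundle, and only compared at points of the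
   indicatrix bundle, on vectors tangent to it: exterior differentiation
   commutes with this restriction. *)
Definition form := index M -> R4 -> R4 -> R.

(* The differential of the change of coordinates induced on TM. *)
Definition dTtransition (a b : index M) (z u : R4) : R4 :=
  (dtransition a b (fst z) (fst u),
   dirD2 (fun w : R4 => dtransition a b (fst w) (snd w)) z u).

Record is_form (w : form) : Prop := {
  form_smooth : forall a u, smooth (slit a) (fun z => w a z u);
  form_linear : forall a z, slit a z -> is_linear (w a z);
  form_compat : forall a b z u, sphere_in a z -> tangent_sphere a z u ->
    chart_image dom chart a (dom b) (fst z) ->
    w b (transition chart chart_inv a b (fst z),
         dtransition a b (fst z) (snd z)) (dTtransition a b z u) = w a z u
}.

Definition wedge (w w' : form) (a : index M) (z u v : R4) : R :=
  w a z u * w' a z v - w a z v * w' a z u.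

Definition ext_d (w : form) (a : index M) (z u v : R4) : R :=
  dirD (fun z' => w a z' v) z u - dirD (fun z' => w a z' u) z v.

Definition omega1 : form := fun a z u =>
  sqrt (gij F a i1 i1 z * gij F a i2 i2 z - gij F a i1 i2 z * gij F a i2 i1 z)
  / in_chart a F z
  * (cmp i2 (snd z) * cmp i1 (fst u) - cmp i1 (snd z) * cmp i2 (fst u)).

Definition omega2 : form := fun a z u =>
  dy i1 (in_chart a F) z * cmp i1 (fst u) +
  dy i2 (in_chart a F) z * cmp i2 (fst u).

Record structure_equations (omega3 : form) (I J K : TM -> R) : Prop := {
  omega3_form : is_form omega3;
  I_smooth : smooth_slit I;
  J_smooth : smooth_slit J;
  K_smooth : smooth_slit K;
  d_omega1 : forall a z u v, sphere_in a z ->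
    tangent_sphere a z u -> tangent_sphere a z v ->
    ext_d omega1 a z u v =
      - in_chart a I z * wedge omega1 omega3 a z u v
      + wedge omega2 omega3 a z u v;
  d_omega2 : forall a z u v, sphere_in a z ->
    tangent_sphere a z u -> tangent_sphere a z v ->
    ext_d omega2 a z u v = - wedge omega1 omega3 a z u v;
  d_omega3 : forall a z u v, sphere_in a z ->
    tangent_sphere a z u -> tangent_sphere a z v ->
    ext_d omega3 a z u v =
      in_chart a K z * wedge omega1 omega2 a z u v
      - in_chart a J z * wedge omega1 omega3 a z u v
}.

Definition frame_derivatives (omega3 : form) (f f1 f2 f3 : TM -> R) : Prop :=
  forall a z u, sphere_in a z -> tangent_sphere a z u ->
    dirD (in_chart a f) z u =
      in_chart a f1 z * omega1 a z u + in_chart a f2 z * omega2 a z u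
      + in_chart a f3 z * omega3 a z u.

Definition connection := index M -> ix -> ix -> ix -> R4 -> R.

Definition nonlinear (G : connection) (a : index M) (l k : ix) (z : R4) : R :=
  sum2 (fun m => G a l k m z * cmp m (snd z)).

(* [G a i j k] is the coefficient with upper index i and lower indices j, k.
   The Chern connection is the torsion-free, almost metric connection. *)
Record chern_connection (G : connection) : Prop := {
  chern_torsion_free : forall a i j k z, slit a z -> G a i j k z = G a i k j z;
  chern_almost_metric : forall a i j k z, slit a z ->
    dx k (gij F a i j) z - sum2 (fun l => nonlinear G a l k z * dy l (gij F a i j) z)
    = sum2 (fun l => gij F a l j z * G a l i k z + gij F a i l z * G a l j k z)
}.

Section Curve.

Variables lo hi : Rbar.

Definition itv (t : R) : Prop := Rbar_lt lo t /\ Rbar_lt t hi.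

Definition vel_base (a : index M) (gamma : R -> M) (t : R) : R2 :=
  (Derive (fun r => cmp i1 (chart a (gamma r))) t,
   Derive (fun r => cmp i2 (chart a (gamma r))) t).

Definition tangent (gamma : R -> M) (t : R) : R2 :=
  vel_base (chart_at (gamma t)) gamma t.

Definition vel_fibre (a : index M) (c : R -> TM) (t : R) : R2 :=
  (Derive (fun r => cmp i1 (snd (coord a (c r)))) t,
   Derive (fun r => cmp i2 (snd (coord a (c r)))) t).

Definition pull (w : form) (c : R -> TM) (t : R) : R :=
  let a := chart_at (fst (c t)) in
  w a (coord a (c t)) (vel_base a (fun r => fst (c r)) t, vel_fibre a c t).

Definition lift (gamma : R -> M) (N : R -> R2) : R -> TM :=
  fun t => (gamma t, N t).

Definition gN (gamma : R -> M) (N : R -> R2) (t : R) (u v : R2) : R :=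
  gdot F (chart_at (gamma t)) (coord (chart_at (gamma t)) (lift gamma N t)) u v.

Record normal_lift (gamma : R -> M) (N : R -> R2) : Prop := {
  lift_smooth : smooth_into itv (lift gamma N);
  unit_speed : forall t, itv t -> F (gamma t, tangent gamma t) = 1;
  normal_neq0 : forall t, itv t -> N t <> zero;
  normal_unit : forall t, itv t -> gN gamma N t (N t) (N t) = 1;
  normal_orthogonal : forall t, itv t ->
    gN gamma N t (N t) (tangent gamma t) = 0
}.

Definition sigma_of (gamma : R -> M) (N : R -> R2) : R -> R :=
  pull omega1 (lift gamma N).

(* Components, in the chart [chart_at (gamma t)], of the covariant derivative
   along gamma, with reference vector N, of a vector field U along gamma. *)
Definition covD (G : connection) (gamma : R -> M) (N U : R -> R2) (t : R) : R2 :=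
  let a := chart_at (gamma t) in
  let D := fun i =>
    cmp i (vel_fibre a (lift gamma U) t) +
    sum2 (fun j => sum2 (fun k =>
      cmp j (tangent gamma t) * cmp k (U t) *
      G a i j k (coord a (lift gamma N t)))) in
  (D i1, D i2).

Definition parallel_curvature (G : connection) (gamma : R -> M) (N : R -> R2)
    (k : R -> R) : Prop :=
  forall t, itv t ->
    covD G gamma N N t = scal (- (k t / sigma_of gamma N t ^ 2)) (tangent gamma t).

Definition N_parallel (G : connection) (gamma : R -> M) (N : R -> R2) : Prop :=
  forall t, itv t -> covD G gamma N N t = zero.

Record admissible (c : R -> TM) : Prop := {
  adm_smooth : smooth_into itv c;
  adm_sphere : forall t, itv t -> sphere (c t);
  adm_omega2 : forall t, itv t -> pull omega2 c t = 0;
  adm_omega1 : forall t, itv t -> pull omega1 c t <> 0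
}.

(* Variations of [c] indexed by (-e, e), supported in [p, q]. *)
Record variation (c : R -> TM) (e p q : R) (V : R -> R -> TM) : Prop := {
  var_pos : 0 < e;
  var_support : itv p /\ p < q /\ itv q;
  var_smooth : smooth_into (W := R2)
    (fun w => - e < fst w < e /\ itv (snd w)) (fun w => V (fst w) (snd w));
  var_admissible : forall s, - e < s < e -> admissible (V s);
  var_0 : forall t, itv t -> V 0 t = c t;
  var_outside : forall s t, - e < s < e -> itv t -> ~ (p < t < q) ->
    V s t = c t
}.

(* Outside [p, q] the variation does not change the integrand, so that only the
   integral over [p, q] is differentiated. *)
Definition N_extremal (c : R -> TM) : Prop :=
  admissible c /\
  forall e p q V, variation c e p q V ->
    is_derive (fun s => RInt (pull omega1 (V s)) p q) 0 0.

End Curve.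

End Surface.

(* Main.v *)
(* Write T and S for the velocities of a variation in the time and in the
   variation parameter, and u = omega2(S). Since omega2(T) = 0, the structure
   equations give
     d/ds omega1(T) = d/dt (omega1(S) - I u) + (I_1 omega1(T) + (I_3 + 1) omega3(T)) u,
   and the exact term integrates to 0, so that every solution of
   I_1 omega1(T) + (I_3 + 1) omega3(T) = 0 is extremal. This is the displayed
   equation because omega3(T) = - k / sigma: evaluated on T and on the
   horizontal lift of y, the structure equations identify omega3(T) with the
   omega1-component of the Chern derivative of N along the curve.
   Conversely, the base curve can be bent by a bump function in the direction
   of N and lifted again by a local inverse of the Legendre transform, so that u
   may be any small bump and the factor of u vanishes for an extremal. *)

Require Import Defs.
From Stdlib Require Import Reals Lra Lia Ranalysis5 ClassicalEpsilon.
From Coquelicot Require Import Coquelicot.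
Open Scope R_scope.

Set Implicit Arguments.
Unset Strict Implicit.
Set Bullet Behavior "Strict Subproofs".

(** A point of [TM] is read in its preferred chart, which may jump from one point to the next, so a
    pullback must be moved to a fixed chart before it can be differentiated. For [omega1] and
    [omega2] this is possible because they see only the base part of a vector and because the
    oriented atlas makes the Jacobian positive, as the square root in [omega1] requires. Variations
    must stay in the kernel of [omega2], so a curve of unit vectors cannot be moved freely: the lift
    has to follow the base velocity. Normality depends only on the direction of the normal, so that
    direction is found by solving one scalar equation along a line transverse to it, and [F = 1]
    then fixes the length. Local uniqueness of the solution makes the bent family start at the given
    curve. The bump argument needs the factor of u to be continuous. The functions I_1 and I_3 enter
    it through I_1 omega1(T) + I_3 omega3(T), which is the derivative of the smooth function I along
    the lift, because omega2(T) = 0. *)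

Notation RN := R_NormedModule.

(** * Differentiable and [Ck] functions *)

Section Calculus.
Context {V : NormedModule R_AbsRing}.
Implicit Types (f g : V -> R) (x v : V) (U : V -> Prop).

Lemma scal0 v : scal (0 : R) v = zero.
Proof. exact (scal_zero_l v). Qed.

Lemma plus_scal0 x v : plus x (scal (0 : R) v) = x.
Proof. rewrite scal0. apply plus_zero_r. Qed.

Definition diff f x := ex_filterdiff f (locally x).

Lemma filterdiff_line f x v (l : V -> R) :
  filterdiff f (locally x) l ->
  is_derive (fun h : R => f (plus x (scal h v))) 0 (l v).
Proof.
  intro H.
  unfold is_derive.
  apply (filterdiff_ext_lin (U:=RN) _ (fun h : R => l (scal h v))).
  - apply (filterdiff_comp' (fun h : R => plus x (scal h v)) f 0 (fun h => scal h v) l).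
    + apply (filterdiff_ext_lin (U:=RN) _ (fun h : R => plus zero (scal h v))).
      * apply (filterdiff_plus_fct (U:=RN) (fun _ : R => x) (fun h : R => scal h v) (fun _ => zero) (fun h : R => scal h v)).
        -- apply filterdiff_const.
        -- apply (filterdiff_scal_l v).
      * intro y. apply plus_zero_l.
    + rewrite plus_scal0. exact H.
  - intro y. apply (linear_scal l). apply H.
Qed.

(** [dirD] is a limit along a single line, which by itself says nothing about linearity in the
    direction. Identifying it with the differential is what makes it linear in [v]. *)
Lemma filterdiff_dirD f x v (l : V -> R) :
  filterdiff f (locally x) l -> dirD f x v = l v.
Proof. intro H. apply is_derive_unique. now apply filterdiff_line. Qed.

End Calculus.

Lemma dirD_R (h : R -> R) (x v : R) : ex_derive h x ->
  dirD (V := RN) h x v = v * Derive h x.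
Proof.
  intro H. apply Derive_correct in H.
  exact (@filterdiff_dirD RN h x v _ H).
Qed.

Section CkFunctions.
Context {V : NormedModule R_AbsRing}.
Implicit Types (f g : V -> R) (x v : V) (U : V -> Prop).

Lemma diff_dirD f x : diff f x -> filterdiff f (locally x) (dirD f x).
Proof.
  intros [l H]. apply filterdiff_ext_lin with l; [exact H|].
  intro y. symmetry. now apply filterdiff_dirD.
Qed.

Lemma diff_line f x v : diff f x ->
  is_derive (fun h : R => f (plus x (scal h v))) 0 (dirD f x v).
Proof. intro H. apply filterdiff_line. now apply diff_dirD. Qed.

Lemma diff_linear f x : diff f x -> is_linear (dirD f x).
Proof. intro H. exact (proj1 (diff_dirD H)). Qed.

Lemma dirD_plus_r f x u v : diff f x -> dirD f x (plus u v) = dirD f x u + dirD f x v.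
Proof. intro H. exact (linear_plus _ (diff_linear H) u v). Qed.

Lemma dirD_scal_r f x (k : R) v : diff f x -> dirD f x (scal k v) = k * dirD f x v.
Proof. intro H. exact (linear_scal _ (diff_linear H) k v). Qed.

Lemma dirD_zero_r f x : diff f x -> dirD f x zero = 0.
Proof. intro H. exact (linear_zero _ (diff_linear H)). Qed.

Lemma diff_continuous f x : diff f x -> continuous f x.
Proof. intro H. exact (filterdiff_continuous f x H). Qed.

Lemma diff_ext_loc f g x : locally x (fun y => f y = g y) -> diff f x -> diff g x.
Proof. intros H [l Hl]. exists l. exact (filterdiff_ext_locally f g x l H Hl). Qed.

Lemma dirD_ext_loc f g x v : locally x (fun y => f y = g y) -> dirD f x v = dirD g x v.
Proof.
  intro H. apply Derive_ext_loc.
  assert (Hc : continuous (fun h : R => plus x (scal h v)) 0).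
  { apply (continuous_plus (fun _ : R => x) (fun h : R => scal h v)).
    - apply continuous_const.
    - apply (continuous_scal_l (fun h : R => h) v). apply continuous_id. }
  unfold continuous in Hc. rewrite plus_scal0 in Hc.
  exact (Hc _ H).
Qed.

Lemma diff_const (c : R) x : diff (fun _ => c) x.
Proof. exists (fun _ => zero). apply filterdiff_const. Qed.

Lemma dirD_const (c : R) x v : dirD (fun _ => c) x v = 0.
Proof. apply (Derive_const c). Qed.

Lemma diff_lin (l : V -> R) x : is_linear l -> diff l x.
Proof. intro H. exists l. now apply filterdiff_linear. Qed.

Lemma dirD_lin (l : V -> R) x v : is_linear l -> dirD l x v = l v.
Proof. intro H. apply filterdiff_dirD. now apply filterdiff_linear. Qed.

Lemma diff_plus f g x : diff f x -> diff g x -> diff (fun z => f z + g z) x.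
Proof.
  intros Hf Hg. exists (fun v => plus (dirD f x v) (dirD g x v)).
  apply (filterdiff_plus_fct f g); now apply diff_dirD.
Qed.

Lemma dirD_plus f g x v : diff f x -> diff g x ->
  dirD (fun z => f z + g z) x v = dirD f x v + dirD g x v.
Proof.
  intros Hf Hg.
  apply (@filterdiff_dirD V _ x v (fun v => plus (dirD f x v) (dirD g x v))).
  apply (filterdiff_plus_fct f g); now apply diff_dirD.
Qed.

Lemma filterdiff_mul f g x : diff f x -> diff g x ->
  filterdiff (fun z => f z * g z : R) (locally x)
    (fun v => dirD f x v * g x + f x * dirD g x v).
Proof.
  intros Hf Hg.
  apply (filterdiff_mult_fct f g x (dirD f x) (dirD g x) Rmult_comm);
  now apply diff_dirD.
Qed.

Lemma diff_mult f g x : diff f x -> diff g x -> diff (fun z => f z * g z) x.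
Proof. intros Hf Hg. eexists. now apply filterdiff_mul. Qed.

Lemma dirD_mult f g x v : diff f x -> diff g x ->
  dirD (fun z => f z * g z) x v = dirD f x v * g x + f x * dirD g x v.
Proof. intros Hf Hg. now rewrite (filterdiff_dirD v (filterdiff_mul Hf Hg)). Qed.

Lemma filterdiff_comp1 (h : R -> R) (h' : R) f x : diff f x ->
  is_derive h (f x) h' ->
  filterdiff (fun z => h (f z)) (locally x) (fun v => dirD f x v * h').
Proof.
  intros Hf Hh.
  apply (filterdiff_comp' f h x (dirD f x) (fun y => scal y h')).
  - now apply diff_dirD.
  - exact Hh.
Qed.

Lemma diff_comp1 (h : R -> R) f x : diff f x -> ex_derive h (f x) ->
  diff (fun z => h (f z)) x.
Proof. intros Hf [h' Hh]. eexists. eapply filterdiff_comp1; eassumption. Qed.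

Lemma dirD_comp1 (h : R -> R) f x v : diff f x -> ex_derive h (f x) ->
  dirD (fun z => h (f z)) x v = dirD f x v * Derive h (f x).
Proof.
  intros Hf Hh.
  rewrite (filterdiff_dirD v (filterdiff_comp1 Hf (Derive_correct _ _ Hh))). reflexivity.
Qed.

Lemma open_ext_locally U (P : V -> Prop) x : open U -> U x -> (forall y, U y -> P y) ->
  locally x P.
Proof. intros HU Hx H. apply filter_imp with U; [exact H|]. now apply HU. Qed.

(** Openness of [U] lets the agreement pass to derivatives: two functions have the same derivative
    at a point when they agree around it. *)
Lemma Ck_ext k U f g : open U -> (forall x, U x -> f x = g x) -> Ck k U f -> Ck k U g.
Proof.
  intro HU. revert f g. induction k as [|k IH]; simpl; intros f g E H.
  - intros x Hx. apply continuous_ext_loc with f; [|now apply H].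
    apply open_ext_locally with U; auto.
  - destruct H as [H1 H2]. split.
    + intros x Hx. apply (@diff_ext_loc f g); [|now apply H1].
      apply open_ext_locally with U; auto.
    + intro v. apply IH with (fun x => dirD f x v); [|apply H2].
      intros x Hx. apply dirD_ext_loc. apply open_ext_locally with U; auto.
Qed.

Lemma Ck_diff k U f x : Ck (S k) U f -> U x -> diff f x.
Proof. intros [H _] Hx. now apply H. Qed.

Lemma Ck_dirD k U f v : Ck (S k) U f -> Ck k U (fun x => dirD f x v).
Proof. intros [_ H]. apply H. Qed.

Lemma Ck_continuous k U f x : Ck k U f -> U x -> continuous f x.
Proof.
  destruct k; intros H Hx.
  - now apply H.
  - apply diff_continuous. now apply (Ck_diff H).
Qed.

Lemma Ck_S k U f : Ck (S k) U f -> Ck k U f.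
Proof.
  revert f. induction k as [|k IH]; intros f H.
  - intros x Hx. now apply (Ck_continuous H).
  - split.
    + intros x Hx. now apply (Ck_diff H).
    + intro v. apply IH. now apply Ck_dirD.
Qed.

Lemma Ck_sub k U U' f : (forall x, U x -> U' x) -> Ck k U' f -> Ck k U f.
Proof.
  intro E. revert f. induction k as [|k IH]; simpl; intros f H; [auto|].
  destruct H as [H1 H2]. split; auto.
Qed.

Lemma Ck_local k U f :
  (forall x, U x -> exists O, open O /\ O x /\ Ck k O f) -> Ck k U f.
Proof.
  revert f. induction k as [|k IH]; intros f H.
  - intros x Hx. destruct (H x Hx) as (O & _ & Ox & HO). now apply HO.
  - split.
    + intros x Hx. destruct (H x Hx) as (O & _ & Ox & HO). now apply HO.
    + intro v. apply IH. intros x Hx. destruct (H x Hx) as (O & OO & Ox & HO).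
      exists O. repeat split; auto. apply HO.
Qed.

Lemma Ck_const k U (c : R) : open U -> Ck k U (fun _ => c).
Proof.
  intro HU. revert c. induction k as [|k IH]; intro c.
  - intros x _. apply continuous_const.
  - split.
    + intros x _. apply diff_const.
    + intro v. apply Ck_ext with (fun _ => 0); auto.
      intros x _. now rewrite dirD_const.
Qed.

Lemma Ck_lin k U (l : V -> R) : open U -> is_linear l -> Ck k U l.
Proof.
  intros HU Hl. destruct k as [|k].
  - intros x _. apply diff_continuous. now apply diff_lin.
  - split.
    + intros x _. now apply diff_lin.
    + intro v. apply Ck_ext with (fun _ => l v); [auto| |now apply Ck_const].
      intros x _. now rewrite dirD_lin.
Qed.

Lemma Ck_plus k U f g : open U -> Ck k U f -> Ck k U g -> Ck k U (fun z => f z + g z).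
Proof.
  intro HU. revert f g. induction k as [|k IH]; intros f g Hf Hg.
  - intros x Hx. apply (continuous_plus f g); auto.
  - split.
    + intros x Hx. apply diff_plus; [now apply (Ck_diff Hf)|now apply (Ck_diff Hg)].
    + intro v. apply Ck_ext with (fun z => dirD f z v + dirD g z v); auto.
      * intros x Hx. rewrite dirD_plus; auto; [now apply (Ck_diff Hf)|now apply (Ck_diff Hg)].
      * apply IH; now apply Ck_dirD.
Qed.

Lemma Ck_mult k U f g : open U -> Ck k U f -> Ck k U g -> Ck k U (fun z => f z * g z).
Proof.
  intro HU. revert f g. induction k as [|k IH]; intros f g Hf Hg.
  - intros x Hx. apply (continuous_mult f g); auto.
  - split.
    + intros x Hx. apply diff_mult; [now apply (Ck_diff Hf)|now apply (Ck_diff Hg)].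
    + intro v. apply Ck_ext with (fun z => dirD f z v * g z + f z * dirD g z v); auto.
      * intros x Hx. rewrite dirD_mult; auto; [now apply (Ck_diff Hf)|now apply (Ck_diff Hg)].
      * apply Ck_plus; auto; apply IH; try (now apply Ck_dirD); now apply Ck_S.
Qed.

End CkFunctions.

Section CkOperations.
Context {V : NormedModule R_AbsRing}.
Implicit Types (f g : V -> R) (x v : V) (U : V -> Prop).

(** The induction keeps [h] general, because the chain rule yields the derivative of [h] composed
    with the same [f]. *)
Lemma Ck_comp1 k U (P : R -> Prop) (h : R -> R) f : open U ->
  Ck (V := RN) k P h -> Ck k U f -> (forall x, U x -> P (f x)) ->
  Ck k U (fun z => h (f z)).
Proof.
  intro HU. revert h. induction k as [|k IH]; intros h Hh Hf E.
  - intros x Hx. apply (continuous_comp f h); auto.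
  - assert (Hd : forall x, U x -> ex_derive h (f x)).
    { intros x Hx. apply ex_derive_filterdiff. apply Hh; auto. }
    split.
    + intros x Hx. apply diff_comp1; auto. now apply (Ck_diff Hf).
    + intro v. apply Ck_ext with (fun z => dirD f z v * dirD (V:=RN) h (f z) 1); auto.
      * intros x Hx. rewrite (dirD_comp1 (h:=h) (f:=f)); [|apply (Ck_diff Hf Hx)|now apply Hd].
        rewrite dirD_R; [|now apply Hd]. ring.
      * apply Ck_mult; auto; [now apply Ck_dirD|].
        apply (IH (fun y => dirD (V:=RN) h y 1)).
        -- exact (@Ck_dirD RN k P h 1 Hh).
        -- now apply Ck_S.
        -- exact E.
Qed.

Lemma Ck_opp k U f : open U -> Ck k U f -> Ck k U (fun z => - f z).
Proof.
  intros HU Hf. apply Ck_ext with (fun z => (-1) * f z); auto.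
  - intros; ring.
  - apply Ck_mult; auto. now apply Ck_const.
Qed.

Lemma Ck_minus k U f g : open U -> Ck k U f -> Ck k U g -> Ck k U (fun z => f z - g z).
Proof. intros HU Hf Hg. apply Ck_plus; auto. now apply Ck_opp. Qed.

End CkOperations.

(** * The chain rule for maps given by finitely many real components *)

Section Composition.
Context {W V : NormedModule R_AbsRing}.
Implicit Types (l : list ((W -> R) * V)).

(* A map into [V] given by coordinate functions along fixed vectors: the chain
   rule for [Ck] then only involves partial derivatives along these vectors. *)
Fixpoint lincomb l (w : W) : V :=
  match l with
  | nil => zero
  | cons (g, e) l' => plus (scal (g w) e) (lincomb l' w)
  end.

Definition all_fst (P : (W -> R) -> Prop) l := List.Forall (fun ge => P (fst ge)) l.

Lemma lincomb_filterdiff l (w : W) : all_fst (fun g => diff g w) l ->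
  filterdiff (lincomb l) (locally w)
    (lincomb (List.map (fun ge => (dirD (fst ge) w, snd ge)) l)).
Proof.
  induction l as [|[g e] l IH]; intro H; simpl.
  - apply filterdiff_const.
  - inversion H as [|? ? H1 H2]; subst.
    apply (filterdiff_plus_fct (fun w => scal (g w) e) (lincomb l)).
    + apply (filterdiff_scal_l_fct e g). now apply diff_dirD.
    + now apply IH.
Qed.

Lemma comp_filterdiff (f : V -> R) l (w : W) : all_fst (fun g => diff g w) l ->
  diff f (lincomb l w) ->
  filterdiff (fun w => f (lincomb l w)) (locally w)
    (fun v => dirD f (lincomb l w) (lincomb (List.map (fun ge => (dirD (fst ge) w, snd ge)) l) v)).
Proof.
  intros Hl Hf.
  apply (filterdiff_comp' (lincomb l) f w _ (dirD f (lincomb l w))).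
  - now apply lincomb_filterdiff.
  - now apply diff_dirD.
Qed.

(** The chain rule as a sum of partial derivatives. The list [l] fixes the base point while [l'] is
    the list summed over; keeping them apart allows induction on [l'] alone. *)
Fixpoint chain_sum (f : V -> R) l l' (w v : W) : R :=
  match l' with
  | nil => 0
  | cons (g, e) l'' => dirD g w v * dirD f (lincomb l w) e + chain_sum f l l'' w v
  end.

Lemma chain_sumE (f : V -> R) l l' (w v : W) : diff f (lincomb l w) ->
  dirD f (lincomb l w) (lincomb (List.map (fun ge => (dirD (fst ge) w, snd ge)) l') v)
  = chain_sum f l l' w v.
Proof.
  intro Hf. induction l' as [|[g e] l' IH]; simpl.
  - now apply dirD_zero_r.
  - rewrite (dirD_plus_r (f := f)); auto. rewrite (dirD_scal_r (f:=f)); auto. now rewrite IH.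
Qed.

Lemma diff_lincomb (f : V -> R) l (w : W) : all_fst (fun g => diff g w) l ->
  diff f (lincomb l w) -> diff (fun w => f (lincomb l w)) w.
Proof. intros Hl Hf. eexists. now apply comp_filterdiff. Qed.

Lemma dirD_lincomb (f : V -> R) l (w v : W) : all_fst (fun g => diff g w) l ->
  diff f (lincomb l w) -> dirD (fun w => f (lincomb l w)) w v = chain_sum f l l w v.
Proof.
  intros Hl Hf. rewrite (filterdiff_dirD v (comp_filterdiff Hl Hf)).
  now apply chain_sumE.
Qed.

Lemma lincomb_continuous l (w : W) : all_fst (fun g => continuous g w) l ->
  continuous (lincomb l) w.
Proof.
  induction l as [|[g e] l IH]; intro H; simpl.
  - apply continuous_const.
  - inversion H; subst. apply (continuous_plus (fun w => scal (g w) e) (lincomb l)); auto.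
    apply (continuous_scal_l g e). assumption.
Qed.

Lemma all_fst_imp (P Q : (W -> R) -> Prop) l : (forall g, P g -> Q g) ->
  all_fst P l -> all_fst Q l.
Proof. intros H. apply List.Forall_impl. intros ge. apply H. Qed.

(** Each term of the derivative is a component derivative times a partial derivative of [f] composed
    with the same map, so the induction hypothesis for order [k] applies to it. *)
Lemma Ck_lincomb k (U : W -> Prop) (U' : V -> Prop) (f : V -> R) l : open U ->
  Ck k U' f -> all_fst (Ck k U) l -> (forall w, U w -> U' (lincomb l w)) ->
  Ck k U (fun w => f (lincomb l w)).
Proof.
  intros HU. revert f. induction k as [|k IH]; intros f Hf Hl E.
  - intros w Hw. apply (continuous_comp (lincomb l) f); [|now apply Hf, E].
    apply lincomb_continuous. apply (all_fst_imp (P := Ck 0 U)); auto.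
  - split.
    + intros w Hw. apply diff_lincomb; [|now apply Hf, E].
      apply (all_fst_imp (P := Ck (S k) U)); auto. intros g Hg. apply (Ck_diff Hg Hw).
    + intro v. apply Ck_ext with (fun w => chain_sum f l l w v); auto.
      * intros w Hw. rewrite dirD_lincomb; auto; [|now apply Hf, E].
        apply (all_fst_imp (P := Ck (S k) U)); auto. intros g Hg. apply (Ck_diff Hg Hw).
      * assert (Hl' : all_fst (Ck k U) l).
        { revert Hl. apply all_fst_imp. intro g. apply Ck_S. }
        (* The summation list is generalised while the base point keeps the full list [l]. *)
        assert (G : forall l', all_fst (Ck (S k) U) l' ->
          Ck k U (fun w => chain_sum f l l' w v)).
        { induction l' as [|[g e] l' IHl]; intro H; simpl.
          - now apply Ck_const.
          - inversion H as [|? ? H1 H2]; subst. simpl in H1.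
            apply Ck_plus; auto. apply Ck_mult; auto.
            + exact (Ck_dirD v H1).
            + apply (IH (fun y => dirD f y e)); auto. now apply Ck_dirD. }
        now apply G.
Qed.

End Composition.

(** Bootstrap: the derivative is again a polynomial in the inverse itself. *)
Lemma Ck_inv_R k : Ck (V := RN) k (fun x => x <> 0) Rinv.
Proof.
  induction k as [|k IH].
  - intros x Hx. apply continuous_Rinv. exact Hx.
  - assert (D : forall x : R, x <> 0 -> is_derive Rinv x (- / (x * x))).
    { intros x Hx. auto_derive; [exact Hx|field; exact Hx]. }
    split.
    + intros x Hx. apply ex_derive_filterdiff. eexists. now apply D.
    + intro v.
      apply (@Ck_ext RN) with (fun x => (- v) * (/ x * / x)).
      * apply open_neq.
      * intros x Hx. rewrite dirD_R; [|eexists; now apply D].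
        rewrite (is_derive_unique _ _ _ (D x Hx)). field. exact Hx.
      * apply (@Ck_mult RN); [apply open_neq| |].
        -- apply Ck_const. apply open_neq.
        -- apply (@Ck_mult RN); auto. apply open_neq.
Qed.

Section Quotients.
Context {V : NormedModule R_AbsRing}.
Implicit Types (f g : V -> R) (x v : V) (U : V -> Prop).

Lemma Ck_inv k U f : open U -> Ck k U f -> (forall x, U x -> f x <> 0) ->
  Ck k U (fun z => / f z).
Proof.
  intros HU Hf H. apply (Ck_comp1 (P := fun y : R => y <> 0) (h := Rinv)); auto.
  apply Ck_inv_R.
Qed.

Lemma Ck_div k U f g : open U -> Ck k U f -> Ck k U g -> (forall x, U x -> g x <> 0) ->
  Ck k U (fun z => f z / g z).
Proof. intros HU Hf Hg H. apply Ck_mult; auto. now apply Ck_inv. Qed.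

End Quotients.

(** Bootstrap as for the inverse: the derivative is a quotient by the square root itself. *)
Lemma Ck_sqrt_R k : Ck (V := RN) k (fun x => 0 < x) sqrt.
Proof.
  induction k as [|k IH].
  - intros x Hx. apply continuous_sqrt.
  - assert (D : forall x : R, 0 < x -> is_derive sqrt x (/ (2 * sqrt x))).
    { intros x Hx. auto_derive; [exact Hx|]. field. apply Rgt_not_eq. now apply sqrt_lt_R0. }
    assert (HU : open (fun x : R => 0 < x)) by apply open_gt.
    split.
    + intros x Hx. apply ex_derive_filterdiff. eexists. now apply D.
    + intro v.
      apply (@Ck_ext RN) with (fun x => v / (2 * sqrt x)); auto.
      * intros x Hx. rewrite dirD_R; [|eexists; now apply D].
        rewrite (is_derive_unique _ _ _ (D x Hx)). reflexivity.
      * apply (@Ck_div RN); auto.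
        -- now apply (@Ck_const RN).
        -- apply (@Ck_mult RN); auto. now apply (@Ck_const RN).
        -- intros x Hx. apply sqrt_lt_R0 in Hx. lra.
Qed.

Lemma Ck_sqrt {V : NormedModule R_AbsRing} k (U : V -> Prop) f : open U ->
  Ck k U f -> (forall x, U x -> 0 < f x) -> Ck k U (fun z => sqrt (f z)).
Proof.
  intros HU Hf H. apply (Ck_comp1 (P := fun y : R => 0 < y) (h := sqrt)); auto.
  apply Ck_sqrt_R.
Qed.

Lemma lin_fst {V W : NormedModule R_AbsRing} :
  is_linear (fst : prod_NormedModule R_AbsRing V W -> V).
Proof. apply is_linear_fst. Qed.

Lemma lin_snd {V W : NormedModule R_AbsRing} :
  is_linear (snd : prod_NormedModule R_AbsRing V W -> W).
Proof. apply is_linear_snd. Qed.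

Lemma lin_cmp i : is_linear (cmp i : R2 -> R).
Proof. destruct i; [apply is_linear_fst|apply is_linear_snd]. Qed.

Lemma lin_comp {U V W : NormedModule R_AbsRing} (f : U -> V) (g : V -> W) :
  is_linear f -> is_linear g -> is_linear (fun u => g (f u)).
Proof. intros. now apply is_linear_comp. Qed.

Lemma lin_base i : is_linear (fun z : R4 => cmp i (fst z)).
Proof. exact (lin_comp lin_fst (lin_cmp i)). Qed.

Lemma lin_fibre i : is_linear (fun z : R4 => cmp i (snd z)).
Proof. exact (lin_comp lin_snd (lin_cmp i)). Qed.

Section Maps.
Context {W : NormedModule R_AbsRing}.
Implicit Types (g : W -> R2) (G : W -> R4).

Definition coords2 g : list ((W -> R) * R2) :=
  (fun w => cmp i1 (g w), basis i1) :: (fun w => cmp i2 (g w), basis i2) :: nil.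

Definition coords4 G : list ((W -> R) * R4) :=
  (fun w => cmp i1 (fst (G w)), (basis i1, zero : R2)) ::
  (fun w => cmp i2 (fst (G w)), (basis i2, zero : R2)) ::
  (fun w => cmp i1 (snd (G w)), (zero : R2, basis i1)) ::
  (fun w => cmp i2 (snd (G w)), (zero : R2, basis i2)) :: nil.

Lemma coords2E g w : lincomb (coords2 g) w = g w.
Proof.
  destruct (g w) as [a b] eqn:E. unfold coords2, lincomb, cmp. simpl. rewrite E.
  unfold plus, scal, zero; simpl. unfold plus, scal, zero, mult; simpl.
  unfold prod_plus, prod_scal, prod_zero, scal, zero, plus, mult; simpl.
  unfold mult, zero; simpl. f_equal; ring.
Qed.

Lemma coords4E G w : lincomb (coords4 G) w = G w.
Proof.
  destruct (G w) as [[a b] [c d]] eqn:E. unfold coords4, lincomb, cmp. simpl. rewrite E.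
  unfold plus, scal, zero; simpl. unfold plus, scal, zero, mult; simpl.
  unfold prod_plus, prod_scal, prod_zero, scal, zero, plus, mult; simpl.
  unfold prod_plus, prod_scal, prod_zero, scal, zero, plus, mult; simpl.
  unfold mult, zero; simpl. f_equal; f_equal; ring.
Qed.
End Maps.

Section MapsToPlane.
Context {W : NormedModule R_AbsRing}.
Implicit Types (g : W -> R2) (G : W -> R4) (w v : W).

Definition diff2 g w := diff (fun z => fst (g z)) w /\ diff (fun z => snd (g z)) w.
Definition diff4 G w := diff2 (fun z => fst (G z)) w /\ diff2 (fun z => snd (G z)) w.
Definition Ck2 k (U : W -> Prop) g :=
  Ck k U (fun z => fst (g z)) /\ Ck k U (fun z => snd (g z)).
Definition Ck4 k (U : W -> Prop) G :=
  Ck2 k U (fun z => fst (G z)) /\ Ck2 k U (fun z => snd (G z)).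
Definition dirD4 G w v : R4 :=
  (dirD2 (fun z => fst (G z)) w v, dirD2 (fun z => snd (G z)) w v).

Lemma diff_via_lincomb (V : NormedModule R_AbsRing) (f : V -> R) (h : W -> V) l w :
  (forall w, lincomb l w = h w) -> all_fst (fun h0 : W -> R => diff h0 w) l -> diff f (h w) ->
  diff (fun w => f (h w)) w /\ (forall v, dirD (fun w => f (h w)) w v =
   dirD f (h w) (lincomb (List.map (fun ge => (dirD (fst ge) w, snd ge)) l) v)).
Proof.
  intros E Hl Hf.
  assert (H : filterdiff (fun w => f (h w)) (locally w)
    (fun v => dirD f (h w) (lincomb (List.map (fun ge => (dirD (fst ge) w, snd ge)) l) v))).
  { apply filterdiff_ext with (fun w => f (lincomb l w)).
    - intro y. now rewrite E.
    - rewrite <- E. apply comp_filterdiff; auto. now rewrite E. }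
  split.
  - eexists; exact H.
  - intro v. exact (filterdiff_dirD v H).
Qed.

Lemma all_coords2 (P : (W -> R) -> Prop) g :
  P (fun z => fst (g z)) -> P (fun z => snd (g z)) -> all_fst P (coords2 g).
Proof. intros; repeat constructor; assumption. Qed.

Lemma all_coords4 (P : (W -> R) -> Prop) G :
  P (fun z => fst (fst (G z))) -> P (fun z => snd (fst (G z))) ->
  P (fun z => fst (snd (G z))) -> P (fun z => snd (snd (G z))) -> all_fst P (coords4 G).
Proof. intros; repeat constructor; assumption. Qed.

Lemma diff_comp2 (f : R2 -> R) g w : diff2 g w -> diff f (g w) -> diff (fun w => f (g w)) w.
Proof.
  intros [H1 H2] Hf. apply (diff_via_lincomb (l := coords2 g)); auto using coords2E, all_coords2.
Qed.

Lemma dirD_comp2 (f : R2 -> R) g w v : diff2 g w -> diff f (g w) ->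
  dirD (fun w => f (g w)) w v = dirD f (g w) (dirD2 g w v).
Proof.
  intros [H1 H2] Hf.
  rewrite (proj2 (diff_via_lincomb (coords2E g) (all_coords2 H1 H2) Hf)).
  f_equal. exact (coords2E (dirD2 g w) v).
Qed.

Lemma diff_comp4 (f : R4 -> R) G w : diff4 G w -> diff f (G w) -> diff (fun w => f (G w)) w.
Proof.
  intros [[H1 H2] [H3 H4]] Hf.
  apply (diff_via_lincomb (l := coords4 G)); auto using coords4E, all_coords4.
Qed.

Lemma dirD_comp4 (f : R4 -> R) G w v : diff4 G w -> diff f (G w) ->
  dirD (fun w => f (G w)) w v = dirD f (G w) (dirD4 G w v).
Proof.
  intros [[H1 H2] [H3 H4]] Hf.
  rewrite (proj2 (diff_via_lincomb (coords4E G) (all_coords4 H1 H2 H3 H4) Hf)).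
  f_equal. exact (coords4E (dirD4 G w) v).
Qed.

Lemma Ck_comp2 k (U : W -> Prop) (U' : R2 -> Prop) (f : R2 -> R) g : open U ->
  Ck k U' f -> Ck2 k U g -> (forall w, U w -> U' (g w)) -> Ck k U (fun w => f (g w)).
Proof.
  intros HU Hf [H1 H2] E.
  apply Ck_ext with (fun w => f (lincomb (coords2 g) w)); auto.
  - intros x _. now rewrite coords2E.
  - apply Ck_lincomb with U'; auto using all_coords2.
    intros w Hw. rewrite coords2E. auto.
Qed.

Lemma Ck_comp4 k (U : W -> Prop) (U' : R4 -> Prop) (f : R4 -> R) G : open U ->
  Ck k U' f -> Ck4 k U G -> (forall w, U w -> U' (G w)) -> Ck k U (fun w => f (G w)).
Proof.
  intros HU Hf [[H1 H2] [H3 H4]] E.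
  apply Ck_ext with (fun w => f (lincomb (coords4 G) w)); auto.
  - intros x _. now rewrite coords4E.
  - apply Ck_lincomb with U'; auto using all_coords4.
    intros w Hw. rewrite coords4E. auto.
Qed.

Lemma Ck2_diff2 k (U : W -> Prop) g w : Ck2 (S k) U g -> U w -> diff2 g w.
Proof. intros [H1 H2] Hw. split; [apply (Ck_diff H1 Hw)|apply (Ck_diff H2 Hw)]. Qed.

Lemma Ck4_diff4 k (U : W -> Prop) G w : Ck4 (S k) U G -> U w -> diff4 G w.
Proof. intros [H1 H2] Hw. split; [apply (Ck2_diff2 H1 Hw)|apply (Ck2_diff2 H2 Hw)]. Qed.

Lemma continuous_pairs (V V' : NormedModule R_AbsRing) (f : W -> V) (h : W -> V') w :
  continuous f w -> continuous h w ->
  continuous (fun w => (f w, h w) : prod_NormedModule R_AbsRing V V') w.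
Proof.
  intros Hf Hh.
  intros P [e He].
  assert (A1 : locally w (fun y => ball (f w) e (f y))).
  { apply Hf. now exists e. }
  assert (A2 : locally w (fun y => ball (h w) e (h y))).
  { apply Hh. now exists e. }
  refine (filter_imp _ _ _ (filter_and _ _ A1 A2)).
  intros y [B1 B2]. apply He. now split.
Qed.

Lemma continuous2 g w : continuous (fun z => fst (g z)) w ->
  continuous (fun z => snd (g z)) w -> continuous g w.
Proof.
  intros H1 H2. apply continuous_ext with (fun z => (fst (g z), snd (g z)) : R2).
  - intro z. now destruct (g z).
  - now apply (continuous_pairs (V := RN) (V' := RN)).
Qed.

Lemma continuous4 G w : continuous (fun z => fst (G z)) w ->
  continuous (fun z => snd (G z)) w -> continuous G w.
Proof.
  intros H1 H2. apply continuous_ext with (fun z => (fst (G z), snd (G z)) : R4).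
  - intro z. now destruct (G z).
  - now apply (continuous_pairs (V := R2) (V' := R2)).
Qed.

Lemma diff2_continuous g w : diff2 g w -> continuous g w.
Proof. intros [H1 H2]. apply continuous2; now apply diff_continuous. Qed.

Lemma diff4_continuous G w : diff4 G w -> continuous G w.
Proof. intros [H1 H2]. apply continuous4; now apply diff2_continuous. Qed.

Lemma dirD2_ext_loc g g' w v : locally w (fun z => g z = g' z) -> dirD2 g w v = dirD2 g' w v.
Proof.
  intro H. unfold dirD2. f_equal; apply dirD_ext_loc; apply filter_imp with (2 := H);
  intros z E; now rewrite E.
Qed.

Lemma dirD2_scal_r g w (k : R) v : diff2 g w ->
  dirD2 g w (scal k v) = scal k (dirD2 g w v).
Proof.
  intros [H1 H2]. unfold dirD2.
  rewrite (dirD_scal_r k v H1), (dirD_scal_r k v H2). reflexivity.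
Qed.

Lemma dirD2_zero_r g w : diff2 g w -> dirD2 g w zero = zero.
Proof.
  intros [H1 H2]. unfold dirD2. rewrite (dirD_zero_r H1), (dirD_zero_r H2). reflexivity.
Qed.
End MapsToPlane.

Lemma dirD2_comp2 {W : NormedModule R_AbsRing} (f : R2 -> R2) (g : W -> R2) w v :
  diff2 g w -> diff2 f (g w) ->
  dirD2 (fun w => f (g w)) w v = dirD2 f (g w) (dirD2 g w v).
Proof.
  intros Hg [H1 H2]. unfold dirD2 at 1 2.
  now rewrite (dirD_comp2 v Hg H1), (dirD_comp2 v Hg H2).
Qed.

Lemma open_preimage {W V : NormedModule R_AbsRing} (U : W -> Prop) (U' : V -> Prop)
  (g : W -> V) : open U -> open U' -> (forall w, U w -> continuous g w) ->
  open (fun w => U w /\ U' (g w)).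
Proof.
  intros HU HU' Hg w [Hw Hw'].
  apply filter_and.
  - now apply HU.
  - apply (Hg w Hw). now apply HU'.
Qed.

Lemma R2_eq (a b c d : R) : a = c -> b = d -> ((a, b) : R2) = (c, d).
Proof. now intros -> ->. Qed.

Lemma R4_eq (a b c d a' b' c' d' : R) : a = a' -> b = b' -> c = c' -> d = d' ->
  (((a, b), (c, d)) : R4) = ((a', b'), (c', d')).
Proof. now intros -> -> -> ->. Qed.

Lemma R2_decomp (u : R2) : u = plus (scal (fst u) (basis i1)) (scal (snd u) (basis i2)).
Proof.
  destruct u as [a b]. revert a b. change (forall a b : R, ((a, b) : R2) = plus (scal a (basis i1)) (scal b (basis i2))). intros a b.
  change ((a, b) = (a * 1 + b * 0, a * 0 + b * 1)). apply R2_eq; ring.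
Qed.

Lemma dirD_R2 (f : R2 -> R) x u : diff f x ->
  dirD f x u = fst u * dirD f x (basis i1) + snd u * dirD f x (basis i2).
Proof.
  intro H. rewrite (R2_decomp u) at 1.
  rewrite (dirD_plus_r _ _ H), (dirD_scal_r _ _ H), (dirD_scal_r _ _ H). reflexivity.
Qed.

Lemma R4_decomp (u : R4) : u =
  plus (plus (scal (fst (fst u)) ((basis i1, zero : R2) : R4)) (scal (snd (fst u)) ((basis i2, zero : R2) : R4)))
   (plus (scal (fst (snd u)) ((zero : R2, basis i1) : R4)) (scal (snd (snd u)) ((zero : R2, basis i2) : R4))).
Proof.
  destruct u as [[a b] [c d]]. revert a b c d. change (forall a b c d : R, (((a, b), (c, d)) : R4) =
  plus (plus (scal a ((basis i1, zero : R2) : R4)) (scal b ((basis i2, zero : R2) : R4)))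
   (plus (scal c ((zero : R2, basis i1) : R4)) (scal d ((zero : R2, basis i2) : R4)))). intros a b c d.
  change (((a, b), (c, d)) = (((a * 1 + b * 0) + (c * 0 + d * 0), (a * 0 + b * 1) + (c * 0 + d * 0)),
    ((a * 0 + b * 0) + (c * 1 + d * 0), (a * 0 + b * 0) + (c * 0 + d * 1)))).
  apply R4_eq; ring.
Qed.

Lemma dirD_R4 (f : R4 -> R) x u : diff f x ->
  dirD f x u = fst (fst u) * dx i1 f x + snd (fst u) * dx i2 f x
   + fst (snd u) * dy i1 f x + snd (snd u) * dy i2 f x.
Proof.
  intro H. rewrite (R4_decomp u) at 1.
  rewrite !(dirD_plus_r _ _ H), !(dirD_scal_r _ _ H). unfold dx, dy. ring.
Qed.

Lemma diff_R (f : R -> R) (t : R) : diff (V := RN) f t <-> ex_derive f t.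
Proof. split; intro H; apply ex_derive_filterdiff; exact H. Qed.

Lemma Derive_dirD (f : R -> R) (t : R) : ex_derive f t ->
  Derive f t = dirD (V := RN) f t 1.
Proof. intro H. rewrite dirD_R; auto. ring. Qed.

Lemma diff2_line2 (s t : R) : diff2 (W := RN) (fun r : R => (s, r) : R2) t /\
  diff2 (W := RN) (fun r : R => (r, t) : R2) s.
Proof.
  split; split; simpl; apply diff_R; try apply ex_derive_const; apply ex_derive_id.
Qed.

Lemma is_derive_along (f : R2 -> R) (g : R -> R2) (t : R) : diff2 (W := RN) g t ->
  diff f (g t) -> is_derive (fun r => f (g r)) t (dirD f (g t) (dirD2 (V := RN) g t 1)).
Proof.
  intros Hg Hf.
  assert (E : ex_derive (fun r => f (g r)) t).
  { apply diff_R. exact (diff_comp2 (W := RN) Hg Hf). }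
  pose proof (Derive_correct _ _ E) as D. rewrite (Derive_dirD E) in D.
  replace (dirD f (g t) (dirD2 (V := RN) g t 1)) with (dirD (V := RN) (fun r => f (g r)) t 1);
    [exact D|exact (dirD_comp2 (W := RN) 1 Hg Hf)].
Qed.

Lemma dirD_R_id (t : R) : dirD (V := RN) (fun r => r) t 1 = 1.
Proof. exact (dirD_lin (V := RN) t 1 (@is_linear_id R_AbsRing RN)). Qed.

Lemma is_derive_snd (f : R2 -> R) (s t : R) : diff f (s, t) ->
  is_derive (fun r => f (s, r)) t (dirD f (s, t) (0, 1)).
Proof.
  intro H. replace ((0, 1) : R2) with (dirD2 (V := RN) (fun r => (s, r) : R2) t 1).
  - exact (is_derive_along (proj1 (diff2_line2 s t)) H).
  - exact (f_equal2 pair (dirD_const (V := RN) s t 1) (dirD_R_id t)).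
Qed.

Lemma is_derive_fst (f : R2 -> R) (s t : R) : diff f (s, t) ->
  is_derive (fun r => f (r, t)) s (dirD f (s, t) (1, 0)).
Proof.
  intro H. replace ((1, 0) : R2) with (dirD2 (V := RN) (fun r => (r, t) : R2) s 1).
  - exact (is_derive_along (proj2 (diff2_line2 s t)) H).
  - exact (f_equal2 pair (dirD_R_id s) (dirD_const (V := RN) t s 1)).
Qed.

(** * Charts of the surface and of its tangent bundle *)

Lemma open_neq_zero : open (fun y : R2 => y <> zero).
Proof.
  intros y Hy.
  destruct (Req_dec (fst y) 0) as [E|E].
  - assert (E2 : snd y <> 0).
    { intro E2. apply Hy. destruct y. simpl in *. now rewrite E, E2. }
    apply (filter_imp (fun w : R2 => snd w <> 0)).
    + intros w Hw ->. now apply Hw.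
    + exact (diff_continuous (diff_lin y (lin_cmp i2)) (open_neq 0 _ E2)).
  - apply (filter_imp (fun w : R2 => fst w <> 0)).
    + intros w Hw ->. now apply Hw.
    + exact (diff_continuous (diff_lin y (lin_cmp i1)) (open_neq 0 _ E)).
Qed.

Arguments dtransition {M}.
Arguments of_coord {M}.
Arguments slit {M}.
Arguments vel_base {M}.
Arguments dTtransition {M}.
Arguments chart_at_dom {o}.
Arguments chart_invK {o} [a p].
Arguments transition_smooth {o}.

Section Charts.
Variable M : oriented_surface.
Implicit Types (a b c : index M) (p : M) (x y u : R2) (z : R4).

Definition overlap a b : R2 -> Prop := chart_image dom chart a (dom b).

Lemma overlap_open a b : open (overlap a b).
Proof. apply dom_open. Qed.

Lemma overlap_chart a b p : dom a p -> dom b p -> overlap a b (chart a p).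
Proof. intros Ha Hb. exists p. auto. Qed.

Lemma overlap_inv a b x : overlap a b x ->
  dom a (chart_inv a x) /\ dom b (chart_inv a x) /\ chart a (chart_inv a x) = x.
Proof.
  intros (p & Ha & Hb & <-). rewrite chart_invK; auto.
Qed.

Lemma overlap_self a b x : overlap a b x -> overlap a a x.
Proof. intros (p & Ha & Hb & E). exists p; auto. Qed.

Lemma overlap_transition a b x : overlap a b x ->
  overlap b a (transition chart chart_inv a b x).
Proof.
  intros H. destruct (overlap_inv H) as (Ha & Hb & _). now apply overlap_chart.
Qed.

Lemma overlap_transition3 a b c x : overlap a b x -> overlap a c x ->
  overlap b c (transition chart chart_inv a b x).
Proof.
  intros H H'. destruct (overlap_inv H) as (Ha & Hb & _).
  destruct (overlap_inv H') as (_ & Hc & _). now apply overlap_chart.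
Qed.

Lemma transition_chart a b p : dom a p ->
  transition chart chart_inv a b (chart a p) = chart b p.
Proof. intro Ha. unfold transition. now rewrite chart_invK. Qed.

Lemma transition_trans a b c x : overlap a b x ->
  transition chart chart_inv b c (transition chart chart_inv a b x)
  = transition chart chart_inv a c x.
Proof.
  intro H. destruct (overlap_inv H) as (Ha & Hb & _).
  unfold transition. now rewrite (chart_invK Hb).
Qed.

Lemma transition_Ck2 a b k : Ck2 k (overlap a b) (transition chart chart_inv a b).
Proof. destruct (transition_smooth a b) as [H1 H2]. split; [apply H1|apply H2]. Qed.

Lemma transition_diff2 a b x : overlap a b x -> diff2 (transition chart chart_inv a b) x.
Proof. intro H. exact (Ck2_diff2 (transition_Ck2 a b 1) H). Qed.

Lemma dtransition_scal a b x (k : R) u : overlap a b x ->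
  dtransition a b x (scal k u) = scal k (dtransition a b x u).
Proof. intro H. apply dirD2_scal_r. now apply transition_diff2. Qed.

Lemma dtransition_zero a b x : overlap a b x -> dtransition a b x zero = zero.
Proof. intro H. apply dirD2_zero_r. now apply transition_diff2. Qed.

Lemma dirD2_id x u : dirD2 (fun y : R2 => y) x u = u.
Proof.
  etransitivity; [|symmetry; apply surjective_pairing].
  exact (f_equal2 pair (dirD_lin x u (lin_cmp i1)) (dirD_lin x u (lin_cmp i2))).
Qed.

(** The transition from a chart to itself is the identity only on the image of the chart. Openness
    of that image is enough to identify the derivative. *)
Lemma dtransition_id a x u : overlap a a x -> dtransition a a x u = u.
Proof.
  intro H. unfold dtransition. rewrite <- (dirD2_id x u) at 2. apply dirD2_ext_loc.
  apply open_ext_locally with (overlap a a); auto using overlap_open.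
  intros y Hy. now destruct (overlap_inv Hy) as (_ & _ & E).
Qed.

Lemma dtransition_trans a b c x u : overlap a b x -> overlap a c x ->
  dtransition b c (transition chart chart_inv a b x) (dtransition a b x u)
  = dtransition a c x u.
Proof.
  intros H H'. unfold dtransition.
  rewrite <- dirD2_comp2.
  - apply dirD2_ext_loc. apply open_ext_locally with (overlap a b); auto using overlap_open.
    intros y Hy. now apply transition_trans.
  - now apply transition_diff2.
  - apply transition_diff2. now apply overlap_transition3.
Qed.

Lemma dtransition_invK a b x u : overlap a b x ->
  dtransition b a (transition chart chart_inv a b x) (dtransition a b x u) = u.
Proof.
  intro H. rewrite dtransition_trans; auto.
  - apply dtransition_id. now apply overlap_self with b.
  - now apply overlap_self with b.
Qed.

Lemma dtransition_neq0 a b x u : overlap a b x -> u <> zero -> dtransition a b x u <> zero.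
Proof.
  intros H Hu E. apply Hu. rewrite <- (dtransition_invK u H), E.
  apply dtransition_zero. now apply overlap_transition.
Qed.

Definition trans4 a b z : R4 :=
  (transition chart chart_inv a b (fst z), dtransition a b (fst z) (snd z)).

Lemma of_coord_trans a b z : overlap a b (fst z) ->
  of_coord b (trans4 a b z) = of_coord a z.
Proof.
  destruct z as [x y]. simpl. intro H. destruct (overlap_inv H) as (Ha & Hb & E).
  unfold of_coord, trans4; simpl.
  assert (E' : chart_inv b (transition chart chart_inv a b x) = chart_inv a x).
  { unfold transition. now apply chart_invK. }
  rewrite E'. f_equal. apply dtransition_trans; auto.
  rewrite <- E at 2. apply overlap_chart; auto. apply chart_at_dom.
Qed.

Lemma overlap_at a p : dom a p -> overlap a (chart_at p) (chart a p).
Proof. intro H. apply overlap_chart; auto using chart_at_dom. Qed.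

Lemma overlap_at' a p : dom a p -> overlap (chart_at p) a (chart (chart_at p) p).
Proof. intro H. apply overlap_chart; auto using chart_at_dom. Qed.

Lemma of_coordK a (q : TM M) : dom a (fst q) -> of_coord a (coord a q) = q.
Proof.
  intro H. destruct q as [p y]; unfold of_coord, coord; simpl in *.
  rewrite (chart_invK H). f_equal.
  rewrite <- (transition_chart a (chart_at_dom p)).
  apply dtransition_invK. now apply overlap_at'.
Qed.

Lemma coordK a z : overlap a a (fst z) -> coord a (of_coord a z) = z.
Proof.
  intro H. destruct (overlap_inv H) as (Ha & _ & E).
  destruct z as [x y]; unfold of_coord, coord; simpl in *. f_equal; auto.
  pose proof (dtransition_invK (a := a) (b := chart_at (chart_inv a x)) (x := x) y) as K.
  unfold transition in K. apply K. rewrite <- E at 2. now apply overlap_at.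
Qed.

Lemma coord_trans a b (q : TM M) : dom a (fst q) -> dom b (fst q) ->
  coord b q = trans4 a b (coord a q).
Proof.
  destruct q as [p y]. simpl. intros Ha Hb. unfold coord, trans4; simpl.
  rewrite (transition_chart b Ha). f_equal.
  rewrite <- (transition_chart a (chart_at_dom p)).
  symmetry. apply dtransition_trans; now apply overlap_at'.
Qed.

Lemma coord_at (q : TM M) : coord (chart_at (fst q)) q = (chart (chart_at (fst q)) (fst q), snd q).
Proof.
  unfold coord. f_equal. exact (dtransition_id (snd q) (overlap_at (chart_at_dom (fst q)))).
Qed.

Lemma slit_open a : open (slit a).
Proof.
  apply (open_and (fun z : R4 => overlap a a (fst z)) (fun z : R4 => snd z <> (zero : R2))).
  - apply (open_comp (fst : R4 -> R2) (overlap a a)).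
    + intros z _. apply continuous_fst.
    + apply overlap_open.
  - apply (open_comp (snd : R4 -> R2) (fun y => y <> zero)).
    + intros z _. apply continuous_snd.
    + exact open_neq_zero.
Qed.

Lemma slit_coord a (q : TM M) : dom a (fst q) -> snd q <> (zero : R2) -> slit a (coord a q).
Proof.
  intros Ha H. split.
  - now apply overlap_chart.
  - apply dtransition_neq0; auto. now apply overlap_at'.
Qed.

Lemma slit_trans a b z : slit a z -> overlap a b (fst z) -> slit b (trans4 a b z).
Proof.
  intros [H1 H2] H. split.
  - apply overlap_self with a. now apply overlap_transition.
  - now apply dtransition_neq0.
Qed.

Lemma in_chart_trans (f : TM M -> R) a b z : overlap a b (fst z) ->
  in_chart b f (trans4 a b z) = in_chart a f z.
Proof. intro H. unfold in_chart. now rewrite of_coord_trans. Qed.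

Lemma in_chart_coord (f : TM M -> R) a (q : TM M) : dom a (fst q) ->
  in_chart a f (coord a q) = f q.
Proof. intro H. unfold in_chart. now rewrite of_coordK. Qed.
End Charts.

(** * The fundamental tensor in a chart *)

Lemma diff4_fibre_scal (l : R) (z : R4) :
  diff4 (fun w : R4 => (fst w, scal l (snd w)) : R4) z /\
  (forall v, dirD4 (fun w : R4 => (fst w, scal l (snd w)) : R4) z v = (fst v, scal l (snd v))).
Proof.
  assert (H : forall i, is_linear (fun w : R4 => l * cmp i (snd w))).
  { intro i. apply (lin_comp (g := fun r : RN => scal l r) (lin_fibre i)).
    exact (@is_linear_scal_r R_AbsRing RN l Rmult_comm). }
  split.
  - split; split.
    + exact (diff_lin z (lin_base i1)).
    + exact (diff_lin z (lin_base i2)).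
    + exact (diff_lin z (H i1)).
    + exact (diff_lin z (H i2)).
  - intros [[v1 v2] [v3 v4]]. apply (f_equal2 pair); apply (f_equal2 pair).
    + exact (dirD_lin z _ (lin_base i1)).
    + exact (dirD_lin z _ (lin_base i2)).
    + exact (dirD_lin z _ (H i1)).
    + exact (dirD_lin z _ (H i2)).
Qed.

(** Euler's identity in degree 1: along the radial direction in the fibre, [h] equals (1 + t) times
    its value, and the derivative at 0 is expanded in partial derivatives. *)
Lemma euler_homogeneous (h : R4 -> R) (z : R4) : diff h z ->
  (forall l : R, 0 < l -> h (fst z, scal l (snd z)) = l * h z) ->
  fst (snd z) * dy i1 h z + snd (snd z) * dy i2 h z = h z.
Proof.
  intros Hd H.
  assert (E : dirD h z ((zero : R2), snd z) = h z).
  { unfold dirD. apply is_derive_unique.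
    apply is_derive_ext_loc with (fun t : R => (1 + t) * h z).
    (* Radius 1 keeps the scaling factor 1 + t positive, the only range where homogeneity is
       assumed. *)
    - exists (mkposreal 1 Rlt_0_1). intros t Ht.
      assert (Ht' : 0 < 1 + t).
      { change (Rabs (t - 0) < 1) in Ht. apply Rabs_def2 in Ht. lra. }
      rewrite <- (H _ Ht'). f_equal.
      destruct z as [[x1 x2] [y1 y2]]. clear. revert x1 x2 y1 y2.
      change (forall x1 x2 y1 y2 : R, (((x1, x2), ((1 + t) * y1, (1 + t) * y2)) : R4) =
        ((x1 + t * 0, x2 + t * 0), (y1 + t * y1, y2 + t * y2))).
      intros. apply R4_eq; ring.
    - auto_derive; auto. ring. }
  rewrite (dirD_R4 _ Hd) in E.
  change (0 * dx i1 h z + 0 * dx i2 h z + fst (snd z) * dy i1 h z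
    + snd (snd z) * dy i2 h z = h z) in E. lra.
Qed.

Lemma scal_eq0 (l : R) (y : R2) : 0 < l -> scal l y = zero -> y = zero.
Proof.
  intros Hl E.
  assert (E2 : scal (/ l) (scal l y) = zero).
  { rewrite E. apply scal_zero_r. }
  rewrite scal_assoc in E2. transitivity (scal (mult (/ l) l : R) y); [|exact E2]. symmetry.
  replace (mult (/ l) l) with (one : R_AbsRing).
  - apply (scal_one (V := R2)).
  - unfold mult, one; simpl. field. lra.
Qed.

Section Metric.
Variables (M : oriented_surface) (F : finsler M) (a : index M).
Implicit Types (z u v : R4).

Notation f := (in_chart a F).
Notation g := (gij F a).
Definition lower (j : ix) (z : R4) := dy j (in_chart a F) z.

Lemma norm_Ck k : Ck k (slit a) f.
Proof. apply (norm_smooth F). Qed.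

Lemma norm_diff z : slit a z -> diff f z.
Proof. intro H. exact (Ck_diff (norm_Ck 1) H). Qed.

Lemma lower_Ck k j : Ck k (slit a) (lower j).
Proof. exact (Ck_dirD _ (norm_Ck (S k))). Qed.

Lemma lower_diff j z : slit a z -> diff (lower j) z.
Proof. intro H. exact (Ck_diff (lower_Ck 1 j) H). Qed.

Lemma norm2_Ck k : Ck k (slit a) (fun w => f w ^ 2).
Proof.
  apply Ck_ext with (fun w => f w * f w).
  - apply slit_open.
  - intros; ring.
  - apply Ck_mult; auto using slit_open, norm_Ck.
Qed.

Lemma dy_norm2_Ck k j : Ck k (slit a) (dy j (fun w => f w ^ 2)).
Proof. exact (Ck_dirD _ (norm2_Ck (S k))). Qed.

Lemma gij_Ck k i j : Ck k (slit a) (g i j).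
Proof.
  apply Ck_mult; [apply slit_open|apply Ck_const; apply slit_open|].
  exact (Ck_dirD _ (dy_norm2_Ck (S k) j)).
Qed.

Lemma gij_diff i j z : slit a z -> diff (g i j) z.
Proof. intro H. exact (Ck_diff (gij_Ck 1 i j) H). Qed.

Lemma slit_scal z (l : R) : 0 < l -> slit a z -> slit a (fst z, scal l (snd z)).
Proof.
  intros Hl [H1 H2]. split; auto. simpl. intro E. apply H2. now apply scal_eq0 with l.
Qed.

Lemma norm_scal z (l : R) : 0 < l -> overlap a a (fst z) ->
  f (fst z, scal l (snd z)) = l * f z.
Proof.
  destruct z as [x y]. simpl. intros Hl H. unfold in_chart, of_coord. simpl.
  rewrite dtransition_scal.
  - now apply (norm_homogeneous F).
  - destruct (overlap_inv H) as (Ha & _ & E). rewrite <- E at 2. now apply overlap_at.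
Qed.

Lemma norm_euler z : slit a z ->
  fst (snd z) * lower i1 z + snd (snd z) * lower i2 z = f z.
Proof.
  intro H. apply euler_homogeneous; [now apply norm_diff|].
  intros l Hl. apply norm_scal; auto. apply H.
Qed.

(** F^2 is homogeneous of degree 2, so its fibre derivatives have degree 1: the relation F^2(x, l y)
    = l^2 F^2(x, y) is differentiated in y and one factor [l] is cancelled. *)
Lemma dy_norm2_scal j z (l : R) : 0 < l -> slit a z ->
  dy j (fun w => f w ^ 2) (fst z, scal l (snd z)) = l * dy j (fun w => f w ^ 2) z.
Proof.
  intros Hl H.
  destruct (diff4_fibre_scal l z) as [D1 D2].
  pose proof (slit_scal Hl H) as Hs.
  assert (Hd : diff (fun w => f w ^ 2) (fst z, scal l (snd z))).
  { exact (Ck_diff (norm2_Ck 1) Hs). }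
  pose proof (dirD_comp4 ((zero : R2), basis j) D1 Hd) as E.
  rewrite D2 in E.
  assert (E' : dirD (fun w : R4 => f (fst w, scal l (snd w)) ^ 2) z ((zero : R2), basis j)
    = l * l * dy j (fun w => f w ^ 2) z).
  { transitivity (dirD (fun w : R4 => (l * l) * f w ^ 2) z ((zero : R2), basis j)).
    - apply dirD_ext_loc. apply open_ext_locally with (slit a); auto using slit_open.
      intros w Hw. rewrite norm_scal; auto; [ring|apply Hw].
    - rewrite dirD_mult.
      + rewrite dirD_const. unfold dy. ring.
      + apply diff_const.
      + exact (Ck_diff (norm2_Ck 1) H). }
  simpl fst in E. simpl snd in E.
  assert (E3 : ((zero : R2), scal l (basis j)) = scal l ((zero : R2), basis j) :> R4).
  { change (((zero : R2), scal l (basis j)) = (scal l (zero : R2), scal l (basis j))).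
    f_equal. symmetry. exact (scal_zero_r (V := R2) l). }
  rewrite E3, (dirD_scal_r l _ Hd) in E.
  assert (l * dy j (fun w => f w ^ 2) (fst z, scal l (snd z)) = l * (l * dy j (fun w => f w ^ 2) z)).
  { unfold dy at 1. rewrite <- E. transitivity (l * l * dy j (fun w => f w ^ 2) z); [exact E'|ring]. }
  apply Rmult_eq_reg_l with l; lra.
Qed.

Lemma dy_norm2E j z : slit a z -> dy j (fun w => f w ^ 2) z = 2 * f z * lower j z.
Proof.
  intro H. unfold dy. rewrite (dirD_ext_loc (g := fun w => f w * f w)).
  - rewrite dirD_mult; try now apply norm_diff. unfold lower, dy. ring.
  - apply filter_forall. intro. ring.
Qed.

(** Euler's identity applied to the fibre derivative of F^2. It ties the fundamental tensor to
    [omega2]: g_y(y, v) = F dF(v), with dF taken along the fibre. *)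
Lemma gij_y j z : slit a z ->
  fst (snd z) * g i1 j z + snd (snd z) * g i2 j z = f z * lower j z.
Proof.
  intro H. unfold gij.
  pose proof (euler_homogeneous (h := dy j (fun w => f w ^ 2)) (z := z)) as E.
  rewrite dy_norm2E in E; auto.
  assert (E' : 2 * f z * lower j z =
    fst (snd z) * dy i1 (dy j (fun w => f w ^ 2)) z + snd (snd z) * dy i2 (dy j (fun w => f w ^ 2)) z).
  { symmetry. apply E.
    - exact (Ck_diff (dy_norm2_Ck 1 j) H).
    - intros l Hl. rewrite dy_norm2_scal; auto. now rewrite dy_norm2E. }
  lra.
Qed.

Lemma gdot_y z (v : R2) : slit a z -> gdot F a z (snd z) v = f z * (lower i1 z * fst v + lower i2 z * snd v).
Proof.
  intro H.
  transitivity ((fst (snd z) * g i1 i1 z + snd (snd z) * g i2 i1 z) * fst v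
    + (fst (snd z) * g i1 i2 z + snd (snd z) * g i2 i2 z) * snd v).
  - unfold gdot, sum2, cmp. ring.
  - rewrite (gij_y i1 H), (gij_y i2 H). ring.
Qed.

Lemma gdot_yy z : slit a z -> gdot F a z (snd z) (snd z) = f z ^ 2.
Proof.
  intro H. rewrite gdot_y; auto.
  transitivity (f z * (fst (snd z) * lower i1 z + snd (snd z) * lower i2 z)); [ring|].
  rewrite (norm_euler H). ring.
Qed.

(** [norm_ge0] gives only nonnegativity; strictness comes from F^2 = g_y(y, y) and strong
    convexity. *)
Lemma norm_pos z : slit a z -> 0 < f z.
Proof.
  intro H. assert (H2 : 0 < f z ^ 2).
  { rewrite <- gdot_yy; auto. apply (norm_strongly_convex F); auto. apply H. }
  assert (0 <= f z) by apply (norm_ge0 F). nra.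
Qed.

Definition det_g z := g i1 i1 z * g i2 i2 z - g i1 i2 z * g i2 i1 z.

(* The antisymmetric part only increases the determinant:
   [det g = det (sym g) + ((g12 - g21) / 2)^2]. *)
Lemma det_pos z : slit a z -> 0 < det_g z.
Proof.
  intro H. unfold det_g.
  pose proof (@norm_strongly_convex M F a z H) as P.
  assert (P1 : 0 < g i1 i1 z).
  { specialize (P (basis i1)). unfold gdot, sum2, basis, cmp in P. simpl in P.
    assert (0 < gij F a i1 i1 z * 1 * 1 + gij F a i1 i2 z * 1 * 0
      + (gij F a i2 i1 z * 0 * 1 + gij F a i2 i2 z * 0 * 0)).
    { apply P. intro E. apply (f_equal fst) in E. simpl in E. change (1 = 0) in E. lra. }
    lra. }
  set (p := g i1 i1 z) in *. set (q := g i1 i2 z + g i2 i1 z).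
  (* This vector completes the square: the form takes on it the value p (4 p g22 - q^2), and 4 p g22
     - q^2 is four times the determinant of the symmetric part. *)
  specialize (P ((- q, 2 * p) : R2)). unfold gdot, sum2, cmp in P. simpl in P.
  assert (P2 : 0 < gij F a i1 i1 z * - q * - q + gij F a i1 i2 z * - q * (2 * p)
      + (gij F a i2 i1 z * (2 * p) * - q + gij F a i2 i2 z * (2 * p) * (2 * p))).
  { apply P. intro E. apply (f_equal snd) in E. simpl in E. change (2 * p = 0) in E. lra. }
  fold p in P2. unfold q in *. set (r := g i1 i2 z) in *. set (s := g i2 i1 z) in *.
  assert (P3 : 0 < p * (4 * p * g i2 i2 z - (r + s) * (r + s))) by nra.
  assert (P4 : 0 < 4 * p * g i2 i2 z - (r + s) * (r + s)).
  { apply Rmult_lt_reg_l with p; lra. }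
  pose proof (Rle_0_sqr (r - s)) as P5. unfold Rsqr in P5. lra.
Qed.

Definition area z := sqrt (det_g z) / f z.

Lemma area_pos z : slit a z -> 0 < area z.
Proof.
  intro H. apply Rdiv_lt_0_compat.
  - apply sqrt_lt_R0. now apply det_pos.
  - now apply norm_pos.
Qed.

Lemma det_Ck k : Ck k (slit a) det_g.
Proof.
  apply Ck_minus; auto using slit_open; apply Ck_mult; auto using slit_open, gij_Ck.
Qed.

Lemma area_Ck k : Ck k (slit a) area.
Proof.
  apply Ck_div; auto using slit_open, norm_Ck.
  - apply Ck_sqrt; auto using slit_open, det_Ck, det_pos.
  - intros x Hx. apply Rgt_not_eq. now apply norm_pos.
Qed.

Lemma area_diff z : slit a z -> diff area z.
Proof. intro H. exact (Ck_diff (area_Ck 1) H). Qed.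

Lemma omega1E z u : omega1 F a z u =
  area z * (snd (snd z) * fst (fst u) - fst (snd z) * snd (fst u)).
Proof. reflexivity. Qed.

Lemma omega2E z u : omega2 F a z u = lower i1 z * fst (fst u) + lower i2 z * snd (fst u).
Proof. reflexivity. Qed.

End Metric.

(** * The Chern connection and [omega3] *)

Lemma dirD_fibre_sum (h1 h2 : R4 -> R) (z X : R4) : diff h1 z -> diff h2 z ->
  dirD (fun w : R4 => fst (snd w) * h1 w + snd (snd w) * h2 w) z X =
  fst (snd X) * h1 z + fst (snd z) * dirD h1 z X
  + (snd (snd X) * h2 z + snd (snd z) * dirD h2 z X).
Proof.
  intros H1 H2.
  pose proof (diff_lin z (lin_fibre i1)) as D1.
  pose proof (diff_lin z (lin_fibre i2)) as D2.
  etransitivity; [apply (dirD_plus (f := fun w : R4 => cmp i1 (snd w) * h1 w)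
    (g := fun w : R4 => cmp i2 (snd w) * h2 w)); now apply diff_mult|].
  rewrite !dirD_mult; auto.
  now rewrite (dirD_lin z X (lin_fibre i1)), (dirD_lin z X (lin_fibre i2)).
Qed.

Section Chern.
Variables (M : oriented_surface) (F : finsler M) (G : connection M).
Hypothesis HG : chern_connection F G.
Variables (a : index M) (z : R4).
Hypothesis Hz : slit a z.

Notation g := (gij F a).
Notation N := (nonlinear G a).

(* The horizontal vector usually written delta/delta x^k. *)
Definition hor (k : ix) : R4 := (basis k, (- N i1 k z, - N i2 k z)).

Lemma dirD_hor (h : R4 -> R) k : diff h z ->
  dirD h z (hor k) = dx k h z - (N i1 k z * dy i1 h z + N i2 k z * dy i2 h z).
Proof.
  intro H. rewrite (dirD_R4 _ H). destruct k; simpl; ring.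
Qed.

Lemma hor_metric i j k : dirD (g i j) z (hor k) =
  g i1 j z * G a i1 i k z + g i i1 z * G a i1 j k z
  + (g i2 j z * G a i2 i k z + g i i2 z * G a i2 j k z).
Proof.
  rewrite dirD_hor; [|now apply gij_diff].
  exact (chern_almost_metric HG i j k Hz).
Qed.

(** Both facts come from differentiating F l_j = y^i g_ij horizontally. Almost metric compatibility
    produces N-terms that cancel those from the fibre part of [hor k], which leaves F l_i G^i_jk =
    dF l_j + F dl_j. Contraction with y^j then gives dF = 0. *)
Lemma hor_norm_lower k : dirD (in_chart a F) z (hor k) = 0 /\ forall j,
  dirD (lower F a j) z (hor k) = lower F a i1 z * G a i1 j k z + lower F a i2 z * G a i2 j k z.
Proof.
  pose proof (norm_diff F Hz) as Df.
  assert (Dl : forall j, diff (lower F a j) z) by (intro; now apply lower_diff).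
  assert (Dg : forall i j, diff (g i j) z) by (intros; now apply gij_diff).
  assert (A : forall j,
    dirD (fun w : R4 => fst (snd w) * g i1 j w + snd (snd w) * g i2 j w) z (hor k) =
    dirD (fun w : R4 => in_chart a F w * lower F a j w) z (hor k)).
  { intro j. apply dirD_ext_loc. apply open_ext_locally with (slit a); auto using slit_open.
    intros w Hw. now apply gij_y. }
  assert (B : dirD (fun w : R4 => fst (snd w) * lower F a i1 w + snd (snd w) * lower F a i2 w) z (hor k)
    = dirD (in_chart a F) z (hor k)).
  { apply dirD_ext_loc. apply open_ext_locally with (slit a); auto using slit_open.
    intros w Hw. now apply norm_euler. }
  rewrite dirD_fibre_sum in B; auto. simpl in B.
  assert (A' : forall j, - N i1 k z * g i1 j z + fst (snd z) * dirD (g i1 j) z (hor k)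
    + (- N i2 k z * g i2 j z + snd (snd z) * dirD (g i2 j) z (hor k))
    = dirD (in_chart a F) z (hor k) * lower F a j z
      + in_chart a F z * dirD (lower F a j) z (hor k)).
  { intro j. specialize (A j). rewrite dirD_fibre_sum, dirD_mult in A; auto. }
  assert (T : forall l j, G a l j k z = G a l k j z).
  { intros. now apply (chern_torsion_free HG). }
  assert (EN : forall l, N l k z = G a l i1 k z * fst (snd z) + G a l i2 k z * snd (snd z)).
  { intro l. unfold nonlinear, sum2, cmp. now rewrite (T l i1), (T l i2). }
  pose proof (gij_y F i1 Hz) as Y1. pose proof (gij_y F i2 Hz) as Y2.
  pose proof (norm_euler F Hz) as Y. pose proof (norm_pos F Hz) as P.
  set (f := in_chart a F z) in *. set (df := dirD (in_chart a F) z (hor k)) in *.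
  set (y1 := fst (snd z)) in *. set (y2 := snd (snd z)) in *.
  set (l1 := lower F a i1 z) in *. set (l2 := lower F a i2 z) in *.
  assert (C : forall j, f * (l1 * G a i1 j k z + l2 * G a i2 j k z) =
     df * lower F a j z + f * dirD (lower F a j) z (hor k)).
  { intro j. rewrite <- A', !hor_metric, !EN, (Rmult_plus_distr_l f).
    replace (f * (l1 * G a i1 j k z)) with ((f * l1) * G a i1 j k z) by ring.
    replace (f * (l2 * G a i2 j k z)) with ((f * l2) * G a i2 j k z) by ring.
    rewrite <- Y1, <- Y2. ring. }
  pose proof (C i1) as C1. pose proof (C i2) as C2. fold l1 in C1. fold l2 in C2.
  set (dl1 := dirD (lower F a i1) z (hor k)) in *. set (dl2 := dirD (lower F a i2) z (hor k)) in *.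
  assert (E0 : df = 0).
  { assert (S : f * (l1 * N i1 k z + l2 * N i2 k z) = df * f + f * (df + l1 * N i1 k z + l2 * N i2 k z)).
    { assert (B' : df + l1 * N i1 k z + l2 * N i2 k z = y1 * dl1 + y2 * dl2). { change (- N i1 k z * l1 + y1 * dl1 + (- N i2 k z * l2 + y2 * dl2) = df) in B. rewrite <- B. ring. }
      rewrite B'.
      transitivity (y1 * (f * (l1 * G a i1 i1 k z + l2 * G a i2 i1 k z)) + y2 * (f * (l1 * G a i1 i2 k z + l2 * G a i2 i2 k z))).
      - rewrite !EN. ring.
      - rewrite C1, C2. replace (df * f) with (df * (y1 * l1 + y2 * l2)) by (rewrite Y; ring). ring. }
    assert (2 * f * df = 0) by lra.
    apply Rmult_integral in H. destruct H; lra. }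
  split; [exact E0|].
  intro j. specialize (C j). rewrite E0 in C.
  apply Rmult_eq_reg_l with f; lra.
Qed.

(** Metric compatibility makes the derivative of det g twice the trace of the connection times det
    g. The square root halves it, and F in the denominator is constant along horizontal vectors. *)
Lemma hor_area k : dirD (area F a) z (hor k) = (G a i1 i1 k z + G a i2 i2 k z) * area F a z.
Proof.
  assert (Dg : forall i j, diff (g i j) z) by (intros; now apply gij_diff).
  assert (D : dirD (det_g F a) z (hor k) = 2 * (G a i1 i1 k z + G a i2 i2 k z) * det_g F a z).
  { unfold det_g at 1.
    transitivity (dirD (fun w => g i1 i1 w * g i2 i2 w + (-1) * (g i1 i2 w * g i2 i1 w)) z (hor k)).
    - apply dirD_ext_loc. apply filter_forall. intro. ring.
    - rewrite dirD_plus; auto using diff_mult, diff_const.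
      rewrite (dirD_mult (f := fun _ => -1)); auto using diff_mult, diff_const.
      rewrite dirD_const, !dirD_mult; auto. rewrite !hor_metric. unfold det_g. ring. }
  pose proof (norm_pos F Hz) as P. pose proof (det_pos F Hz) as Q.
  pose proof (norm_diff F Hz) as Df.
  assert (Dd : diff (det_g F a) z) by exact (Ck_diff (det_Ck F a 1) Hz).
  pose proof (sqrt_lt_R0 _ Q) as Q'.
  assert (Ds : is_derive sqrt (det_g F a z) (/ (2 * sqrt (det_g F a z)))).
  { auto_derive; auto. field. lra. }
  assert (Di : is_derive Rinv (in_chart a F z) (- / (in_chart a F z) ^ 2)).
  { auto_derive; [lra|field; lra]. }
  unfold area at 1, Rdiv.
  rewrite (dirD_mult (f := fun w => sqrt (det_g F a w)) (g := fun w => / in_chart a F w)).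
  - rewrite (dirD_comp1 (h := sqrt)); auto; [|eexists; exact Ds].
    rewrite (dirD_comp1 (h := Rinv)); auto; [|eexists; exact Di].
    rewrite (is_derive_unique _ _ _ Ds), (proj1 (hor_norm_lower k)), D. unfold area.
    pose proof (sqrt_sqrt (det_g F a z) (Rlt_le _ _ Q)) as S.
    generalize dependent (sqrt (det_g F a z)). intros s Hs _ S. rewrite <- S. field. lra.
  - apply (diff_comp1 (h := sqrt)); auto. eexists; exact Ds.
  - apply (diff_comp1 (h := Rinv)); auto. eexists; exact Di.
Qed.

(* The value of the 1-form usually written delta y^i. *)
Definition vert (X : R4) (i : ix) : R :=
  cmp i (snd X) + N i i1 z * fst (fst X) + N i i2 z * snd (fst X).

(** The formula of [omega1] with the vertical part of [X] in place of its base part; this is the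
    explicit candidate for [omega3]. *)
Definition theta (X : R4) : R :=
  area F a z * (snd (snd z) * vert X i1 - fst (snd z) * vert X i2).

(* The horizontal lift of y itself: it is tangent to the indicatrix bundle and
   dual to omega2, so that it isolates omega3 in the structure equations. *)
Definition hor_y : R4 := plus (scal (fst (snd z)) (hor i1)) (scal (snd (snd z)) (hor i2)).

Lemma dirD_hor_y (h : R4 -> R) : diff h z ->
  dirD h z hor_y = fst (snd z) * dirD h z (hor i1) + snd (snd z) * dirD h z (hor i2).
Proof. intro H. unfold hor_y. now rewrite (dirD_plus_r _ _ H), !(dirD_scal_r _ _ H). Qed.

Lemma fst_hor_y : fst (fst hor_y) = fst (snd z) /\ snd (fst hor_y) = snd (snd z).
Proof.
  split.
  - change (fst (snd z) * 1 + snd (snd z) * 0 = fst (snd z)). ring.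
  - change (fst (snd z) * 0 + snd (snd z) * 1 = snd (snd z)). ring.
Qed.

Lemma dirD_base_form (w1 w2 : R4 -> R) (u X : R4) : diff w1 z -> diff w2 z ->
  dirD (fun w => w1 w * fst (fst u) + w2 w * snd (fst u)) z X
  = dirD w1 z X * fst (fst u) + dirD w2 z X * snd (fst u).
Proof.
  intros H1 H2. rewrite dirD_plus; auto using diff_mult, diff_const.
  rewrite !dirD_mult; auto using diff_const. rewrite !dirD_const. ring.
Qed.
(** Since X(F) = 0 and y^j l_j = F, both terms combine into - l_i [vert X] i. This is - X(F),
    because F is constant along horizontal vectors, and so it vanishes. *)
Lemma ext_d_omega2_hor_y (X : R4) : tangent_sphere F a z X ->
  ext_d (omega2 F) a z X hor_y = 0.
Proof.
  intro HX.
  assert (Dl : forall j, diff (lower F a j) z) by (intro; now apply lower_diff).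
  unfold ext_d.
  assert (E1 : dirD (fun z' => omega2 F a z' hor_y) z X
    = fst (snd z) * dirD (lower F a i1) z X + snd (snd z) * dirD (lower F a i2) z X).
  { etransitivity; [exact (dirD_base_form hor_y X (Dl i1) (Dl i2))|].
    destruct fst_hor_y as [-> ->]. ring. }
  assert (E2 : dirD (fun z' => omega2 F a z' X) z hor_y
    = dirD (lower F a i1) z hor_y * fst (fst X) + dirD (lower F a i2) z hor_y * snd (fst X)).
  { exact (dirD_base_form X hor_y (Dl i1) (Dl i2)). }
  rewrite E1, E2, !dirD_hor_y, !(proj2 (hor_norm_lower _)); auto.
  assert (E3 : fst (snd X) * lower F a i1 z + fst (snd z) * dirD (lower F a i1) z X
    + (snd (snd X) * lower F a i2 z + snd (snd z) * dirD (lower F a i2) z X) = 0).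
  { rewrite <- dirD_fibre_sum; auto. rewrite <- HX. apply dirD_ext_loc.
    apply open_ext_locally with (slit a); auto using slit_open.
    intros w Hw. now apply norm_euler. }
  pose proof HX as HX'. unfold tangent_sphere in HX'.
  rewrite (dirD_R4 _ (norm_diff F Hz)) in HX'.
  pose proof (proj1 (hor_norm_lower i1)) as K1. pose proof (proj1 (hor_norm_lower i2)) as K2.
  rewrite dirD_hor in K1, K2; try now apply norm_diff.
  change (dy i1 (in_chart a F) z) with (lower F a i1 z) in *.
  change (dy i2 (in_chart a F) z) with (lower F a i2 z) in *.
  unfold nonlinear, sum2, cmp in K1, K2.
  set (l1 := lower F a i1 z) in *. set (l2 := lower F a i2 z) in *.
  assert (T : forall l j k, G a l j k z = G a l k j z).
  { intros. now apply (chern_torsion_free HG). }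
  rewrite (T i1 i2 i1), (T i2 i2 i1) in *.
  transitivity (- (fst (snd X) * l1 + snd (snd X) * l2)
    - (fst (fst X) * dx i1 (in_chart a F) z + snd (fst X) * dx i2 (in_chart a F) z)); [|lra].
  replace (dx i1 (in_chart a F) z) with ((G a i1 i1 i1 z * fst (snd z) + G a i1 i1 i2 z * snd (snd z)) * l1 +
     (G a i2 i1 i1 z * fst (snd z) + G a i2 i1 i2 z * snd (snd z)) * l2) by lra.
  replace (dx i2 (in_chart a F) z) with ((G a i1 i1 i2 z * fst (snd z) + G a i1 i2 i2 z * snd (snd z)) * l1 +
     (G a i2 i1 i2 z * fst (snd z) + G a i2 i2 i2 z * snd (snd z)) * l2) by lra.
  replace (fst (snd z) * dirD (lower F a i1) z X) with (- (fst (snd X) * l1 + (snd (snd X) * l2 + snd (snd z) * dirD (lower F a i2) z X))) by lra.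
  ring.
Qed.

(** The derivative of [area] along [X] drops out because y is in the kernel of the form y^2 dx^1 -
    y^1 dx^2. Along [hor_y] it contributes the trace N^1_1 + N^2_2, which with torsion-freeness
    turns the other connection terms into those of [vert X]. *)
Lemma ext_d_omega1_hor_y (X : R4) : ext_d (omega1 F) a z X hor_y = - theta X.
Proof.
  pose proof (area_diff F Hz) as Da.
  set (w1 := fun w : R4 => snd (snd w) * area F a w).
  set (w2 := fun w : R4 => (- 1) * (fst (snd w) * area F a w)).
  assert (D1 : diff w1 z).
  { apply diff_mult; auto. exact (diff_lin z (lin_fibre i2)). }
  assert (D2' : diff (fun w : R4 => fst (snd w) * area F a w) z).
  { apply diff_mult; auto. exact (diff_lin z (lin_fibre i1)). }
  assert (D2 : diff w2 z) by (apply diff_mult; auto using diff_const).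
  assert (E1 : forall Y, dirD w1 z Y = snd (snd Y) * area F a z + snd (snd z) * dirD (area F a) z Y).
  { intro Y. unfold w1. etransitivity; [exact (dirD_mult Y (diff_lin z (lin_fibre i2)) Da)|].
    now rewrite (dirD_lin z Y (lin_fibre i2)). }
  assert (E2 : forall Y, dirD w2 z Y = - (fst (snd Y) * area F a z + fst (snd z) * dirD (area F a) z Y)).
  { intro Y. unfold w2. rewrite (dirD_mult (f := fun _ => -1)); auto using diff_const.
    rewrite dirD_const.
    replace (dirD (fun w : R4 => fst (snd w) * area F a w) z Y) with
      (fst (snd Y) * area F a z + fst (snd z) * dirD (area F a) z Y); [ring|].
    symmetry. etransitivity; [exact (dirD_mult Y (diff_lin z (lin_fibre i1)) Da)|].
    now rewrite (dirD_lin z Y (lin_fibre i1)). }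
  assert (E : forall Y Y', dirD (fun z' => omega1 F a z' Y) z Y'
    = dirD w1 z Y' * fst (fst Y) + dirD w2 z Y' * snd (fst Y)).
  { intros Y Y'. rewrite <- dirD_base_form; auto. apply dirD_ext_loc. apply filter_forall.
    intro w. rewrite omega1E. unfold w1, w2. ring. }
  unfold ext_d. rewrite !E, !E1, !E2. destruct fst_hor_y as [-> ->].
  rewrite dirD_hor_y, !hor_area; auto.
  assert (H1 : fst (snd hor_y) = - (fst (snd z) * N i1 i1 z + snd (snd z) * N i1 i2 z)).
  { change (fst (snd z) * (- N i1 i1 z) + snd (snd z) * (- N i1 i2 z)
      = - (fst (snd z) * N i1 i1 z + snd (snd z) * N i1 i2 z)). ring. }
  assert (H2 : snd (snd hor_y) = - (fst (snd z) * N i2 i1 z + snd (snd z) * N i2 i2 z)).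
  { change (fst (snd z) * (- N i2 i1 z) + snd (snd z) * (- N i2 i2 z)
      = - (fst (snd z) * N i2 i1 z + snd (snd z) * N i2 i2 z)). ring. }
  rewrite H1, H2. unfold theta, vert, nonlinear, sum2, cmp.
  assert (T : forall l j k, G a l j k z = G a l k j z).
  { intros. now apply (chern_torsion_free HG). }
  rewrite (T i1 i2 i1), (T i2 i2 i1). ring.
Qed.

(** On the pair ([X], [hor_y]) one has omega1(hor_y) = 0 and omega2(hor_y) = 1. The equation for d
    omega2 gives omega1(X) omega3(hor_y) = 0, hence omega3(hor_y) = 0, and the equation for d omega1
    then reduces to - theta(X) = - omega3(X). *)
Lemma omega3_theta (omega3 : form M) (I J K : TM M -> R) (X : R4) :
  structure_equations F omega3 I J K -> sphere_in F a z ->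
  tangent_sphere F a z X -> omega2 F a z X = 0 -> omega1 F a z X <> 0 ->
  omega3 a z X = theta X.
Proof.
  intros HS Hs HX X2 X1.
  assert (HY : tangent_sphere F a z hor_y).
  { unfold tangent_sphere. rewrite dirD_hor_y; [|now apply norm_diff].
    rewrite !(proj1 (hor_norm_lower _)). ring. }
  pose proof (d_omega1 HS Hs HX HY) as S1. pose proof (d_omega2 HS Hs HX HY) as S2.
  rewrite ext_d_omega1_hor_y in S1. rewrite (ext_d_omega2_hor_y HX) in S2.
  assert (Y1 : omega1 F a z hor_y = 0).
  { rewrite omega1E. destruct fst_hor_y as [-> ->]. ring. }
  assert (Y2 : omega2 F a z hor_y = 1).
  { rewrite omega2E. destruct fst_hor_y as [-> ->]. destruct Hs as [_ Hs]. rewrite <- Hs.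
    rewrite <- (norm_euler F Hz). ring. }
  unfold wedge in S1, S2. rewrite X2, Y1, Y2 in *.
  assert (H : omega1 F a z X * omega3 a z hor_y = 0) by lra.
  apply Rmult_integral in H. destruct H as [H|H]; [contradiction|].
  rewrite H in *. lra.
Qed.
End Chern.

(** * Changes of chart *)

Lemma Ck_fst4 k (U : R4 -> Prop) (U' : R2 -> Prop) (h : R2 -> R) : open U -> Ck k U' h ->
  (forall z, U z -> U' (fst z)) -> Ck k U (fun z : R4 => h (fst z)).
Proof.
  intros HU Hh E. apply (Ck_comp2 (g := fun z : R4 => fst z) HU Hh); auto.
  split; apply Ck_lin; auto; [exact (lin_base i1)|exact (lin_base i2)].
Qed.

Lemma dirD_fibre (h : R4 -> R) (z : R4) (v : R2) : diff h z ->
  dirD h z ((zero : R2), v) = fst v * dy i1 h z + snd v * dy i2 h z.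
Proof.
  intro H. rewrite (dirD_R4 _ H).
  transitivity (0 * dx i1 h z + 0 * dx i2 h z + fst v * dy i1 h z + snd v * dy i2 h z);
    [reflexivity|ring].
Qed.

Section Transition.
Variables (M : oriented_surface) (F : finsler M) (a b : index M).
Implicit Types (z u v : R4).

Definition over z := overlap a b (fst z).

Lemma over_open : open over.
Proof.
  apply (open_comp (fst : R4 -> R2) (overlap a b)).
  - intros z _. apply continuous_fst.
  - apply overlap_open.
Qed.

Lemma dtransition_Ck k (i : ix) :
  Ck k over (fun z => cmp i (dtransition a b (fst z) (snd z))).
Proof.
  destruct (transition_Ck2 a b (S k)) as [T1 T2].
  assert (K : forall h : R2 -> R, Ck (S k) (overlap a b) h ->
    Ck k over (fun z : R4 => dirD h (fst z) (snd z))).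
  { intros h Hh.
    apply Ck_ext with (fun z : R4 => fst (snd z) * dirD h (fst z) (basis i1)
      + snd (snd z) * dirD h (fst z) (basis i2)).
    - apply over_open.
    - intros z Hz. symmetry. apply dirD_R2. exact (Ck_diff Hh Hz).
    - apply Ck_plus; [apply over_open| |]; apply Ck_mult; try apply over_open.
      + apply Ck_lin; [apply over_open|exact (lin_fibre i1)].
      + apply (Ck_fst4 over_open (Ck_dirD (basis i1) Hh)). auto.
      + apply Ck_lin; [apply over_open|exact (lin_fibre i2)].
      + apply (Ck_fst4 over_open (Ck_dirD (basis i2) Hh)). auto. }
  destruct i; [exact (K _ T1)|exact (K _ T2)].
Qed.

Lemma trans4_Ck4 k : Ck4 k over (trans4 a b).
Proof.
  destruct (transition_Ck2 a b k) as [T1 T2].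
  split; split.
  - apply (Ck_fst4 over_open T1); auto.
  - apply (Ck_fst4 over_open T2); auto.
  - exact (dtransition_Ck k i1).
  - exact (dtransition_Ck k i2).
Qed.

Lemma dirD_base_fibre (h : R2 -> R) z (v : R2) : diff h (fst z) ->
  dirD (fun w : R4 => h (fst w)) z ((zero : R2), v) = 0.
Proof.
  intro H.
  assert (D : diff2 (fun w : R4 => fst w) z).
  { split; [exact (diff_lin z (lin_base i1))|exact (diff_lin z (lin_base i2))]. }
  rewrite (dirD_comp2 (g := fun w : R4 => fst w) _ D H).
  replace (dirD2 (fun w : R4 => fst w) z ((zero : R2), v)) with (zero : R2).
  - now apply dirD_zero_r.
  - unfold dirD2. symmetry. apply (f_equal2 pair).
    + exact (dirD_lin z _ (lin_base i1)).
    + exact (dirD_lin z _ (lin_base i2)).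
Qed.

(** The coordinate change is linear on each fibre, so its derivative in a fibre direction is the
    fibre map itself. *)
Lemma dirD4_trans4_fibre z (v : R2) : over z ->
  dirD4 (trans4 a b) z ((zero : R2), v) = ((zero : R2), dtransition a b (fst z) v).
Proof.
  intro Hz. destruct (transition_diff2 Hz) as [T1 T2].
  destruct (transition_Ck2 a b 2) as [C1 C2].
  assert (K : forall h : R2 -> R, Ck 2 (overlap a b) h ->
    dirD (fun w : R4 => dirD h (fst w) (snd w)) z ((zero : R2), v) = dirD h (fst z) v).
  { intros h Hh.
    transitivity (dirD (fun w : R4 => fst (snd w) * dirD h (fst w) (basis i1)
      + snd (snd w) * dirD h (fst w) (basis i2)) z ((zero : R2), v)).
    - apply dirD_ext_loc. apply open_ext_locally with over; auto using over_open.
      intros w Hw. apply dirD_R2. exact (Ck_diff Hh Hw).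
    - rewrite dirD_fibre_sum.
      + rewrite (dirD_base_fibre (h := fun x => dirD h x (basis i1))), (dirD_base_fibre (h := fun x => dirD h x (basis i2))).
        * etransitivity; [|symmetry; exact (dirD_R2 v (Ck_diff Hh Hz))]. simpl fst. simpl snd. ring.
        * exact (Ck_diff (Ck_dirD (basis i2) Hh) Hz).
        * exact (Ck_diff (Ck_dirD (basis i1) Hh) Hz).
      + exact (Ck_diff (Ck_fst4 over_open (Ck_dirD (basis i1) Hh) (fun z Hz => Hz)) Hz).
      + exact (Ck_diff (Ck_fst4 over_open (Ck_dirD (basis i2) Hh) (fun z Hz => Hz)) Hz). }
  apply (f_equal2 pair); apply (f_equal2 pair).
  - exact (dirD_base_fibre v T1).
  - exact (dirD_base_fibre v T2).
  - exact (K _ C1).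
  - exact (K _ C2).
Qed.

Lemma trans4_diff4 z : over z -> diff4 (trans4 a b) z.
Proof. intro H. exact (Ck4_diff4 (trans4_Ck4 1) H). Qed.

(** Writing [omega2] as the fibre derivative of F along the base part of [u] makes its invariance a
    plain chain rule. *)
Lemma omega2_fibre (c : index M) z u : slit c z ->
  omega2 F c z u = dirD (in_chart c F) z ((zero : R2), fst u).
Proof.
  intro H. rewrite omega2E, (dirD_fibre _ (norm_diff F H)). unfold lower. ring.
Qed.

Lemma omega2_trans z u u' : slit a z -> over z -> fst u' = dtransition a b (fst z) (fst u) ->
  omega2 F b (trans4 a b z) u' = omega2 F a z u.
Proof.
  intros Hs Hz E. pose proof (slit_trans Hs Hz) as Hs'.
  rewrite !omega2_fibre, E, <- dirD4_trans4_fibre; auto.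
  rewrite <- dirD_comp4.
  - apply dirD_ext_loc. apply open_ext_locally with over; auto using over_open.
    intros w Hw. now apply in_chart_trans.
  - now apply trans4_diff4.
  - now apply norm_diff.
Qed.

Definition jac (l j : ix) z := cmp l (dtransition a b (fst z) (basis j)).

Lemma gij_trans i j z : slit a z -> over z ->
  gij F a i j z = sum2 (fun k => sum2 (fun l =>
    jac k i z * jac l j z * gij F b k l (trans4 a b z))).
Proof.
  intros Hs Hz. pose proof (slit_trans Hs Hz) as Hs'.
  set (U := fun w => slit a w /\ over w).
  assert (HU : open U) by (apply open_and; [apply slit_open|apply over_open]).
  set (L := fun w => in_chart b F w ^ 2).
  set (P := fun l w => dy l L (trans4 a b w)).
  assert (DP : forall l, diff (fun w => dy l L w) (trans4 a b z)).
  { intro l. exact (Ck_diff (dy_norm2_Ck F b 1 l) Hs'). }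
  assert (E1 : forall w, U w -> dy j (fun w => in_chart a F w ^ 2) w =
    jac i1 j w * P i1 w + jac i2 j w * P i2 w).
  { intros w [Hw Hw']. pose proof (slit_trans Hw Hw') as Hsw.
    unfold dy at 1.
    transitivity (dirD (fun w => L (trans4 a b w)) w ((zero : R2), basis j)).
    - apply dirD_ext_loc. apply open_ext_locally with over; auto using over_open.
      intros y Hy. unfold L. now rewrite in_chart_trans.
    - pose proof (Ck_diff (norm2_Ck F b 1) Hsw) as DL.
      rewrite dirD_comp4; auto using trans4_diff4.
      rewrite dirD4_trans4_fibre; auto.
      exact (dirD_fibre _ DL). }
  assert (DJ : forall l, diff (fun x => cmp l (dtransition a b x (basis j))) (fst z)).
  { destruct (transition_Ck2 a b 2) as [C1 C2]. intro l. destruct l.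
    - exact (Ck_diff (Ck_dirD (basis j) C1) Hz).
    - exact (Ck_diff (Ck_dirD (basis j) C2) Hz). }
  assert (DJ' : forall l, diff (jac l j) z).
  { destruct (transition_Ck2 a b 2) as [C1 C2]. intro l. destruct l.
    - exact (Ck_diff (Ck_fst4 over_open (Ck_dirD (basis j) C1) (fun z Hz => Hz)) Hz).
    - exact (Ck_diff (Ck_fst4 over_open (Ck_dirD (basis j) C2) (fun z Hz => Hz)) Hz). }
  assert (DP' : forall l, diff (P l) z).
  { intro l. apply (diff_comp4 (f := dy l L) (trans4_diff4 Hz) (DP l)). }
  assert (E2 : forall l, dy i (P l) z =
    jac i1 i z * dy i1 (dy l L) (trans4 a b z) + jac i2 i z * dy i2 (dy l L) (trans4 a b z)).
  { intro l. unfold dy at 1, P. rewrite (dirD_comp4 (f := dy l L)); auto using trans4_diff4.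
    rewrite dirD4_trans4_fibre; auto.
    exact (dirD_fibre _ (DP l)). }
  unfold gij at 1.
  assert (E3 : dy i (dy j (fun w => in_chart a F w ^ 2)) z =
     jac i1 j z * dy i (P i1) z + jac i2 j z * dy i (P i2) z).
  { unfold dy at 1.
    rewrite (dirD_ext_loc (g := fun w => jac i1 j w * P i1 w + jac i2 j w * P i2 w)).
    - rewrite dirD_plus, !dirD_mult; auto using diff_mult.
      (* The Jacobian depends on the base point only, so differentiating twice along the fibre
         produces no second derivatives of the transition map. *)
      assert (J0 : forall l, dirD (jac l j) z ((zero : R2), basis i) = 0).
      { intro l. exact (dirD_base_fibre (basis i) (DJ l)). }
      rewrite !J0.
      unfold dy. ring.
    - apply open_ext_locally with U; auto. now split. }
  rewrite E3, !E2. unfold gij, sum2. fold L. ring.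
Qed.

(** [area] in chart [a] is [J] times [area] in chart [b], whereas the determinant of y and u in
    chart [b] is [J] times the one in chart [a]. Taking the root of [J * J] requires [0 < J], which
    is the orientation of the atlas. *)
Lemma omega1_trans z u u' : slit a z -> over z -> fst u' = dtransition a b (fst z) (fst u) ->
  omega1 F b (trans4 a b z) u' = omega1 F a z u.
Proof.
  intros Hs Hz E. pose proof (slit_trans Hs Hz) as Hs'.
  rewrite !omega1E, E.
  set (J := jac i1 i1 z * jac i2 i2 z - jac i2 i1 z * jac i1 i2 z).
  assert (HJ : 0 < J) by exact (@transition_oriented M a b (fst z) Hz).
  assert (Ed : det_g F a z = J * J * det_g F b (trans4 a b z)).
  { unfold det_g. rewrite !gij_trans; auto. unfold sum2, J. ring. }
  assert (Ea : area F a z = J * area F b (trans4 a b z)).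
  { unfold area. rewrite Ed, in_chart_trans; auto.
    rewrite sqrt_mult, sqrt_square; [unfold Rdiv; ring| | |]; try nra.
    apply Rlt_le. now apply det_pos. }
  assert (D : forall y : R2, fst (dtransition a b (fst z) y) = fst y * jac i1 i1 z + snd y * jac i1 i2 z
    /\ snd (dtransition a b (fst z) y) = fst y * jac i2 i1 z + snd y * jac i2 i2 z).
  { intro y. destruct (transition_diff2 Hz) as [D1 D2]. split; [exact (dirD_R2 y D1)|exact (dirD_R2 y D2)]. }
  rewrite Ea. change (snd (trans4 a b z)) with (dtransition a b (fst z) (snd z)).
  destruct (D (snd z)) as [Y1 Y2]. destruct (D (fst u)) as [U1 U2].
  rewrite Y1, Y2, U1, U2. unfold J. ring.
Qed.

End Transition.

(** * First variation *)

Section IntoTM.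
Variable M : oriented_surface.
Context {W : NormedModule R_AbsRing}.
Variables (U : W -> Prop) (C : W -> TM M).
Hypothesis HC : smooth_into U C.

Definition inside (a : index M) (w : W) := U w /\ dom a (fst (C w)).

Lemma inside_open a : open (inside a).
Proof. apply HC. Qed.

Lemma coord_Ck4 a k : Ck4 k (inside a) (fun w => coord a (C w)).
Proof. destruct (HC a) as (_ & [H1 H2] & [H3 H4]). repeat split; auto. Qed.

Lemma coord_diff4 a w : inside a w -> diff4 (fun w => coord a (C w)) w.
Proof. intro H. exact (Ck4_diff4 (coord_Ck4 a 1) H). Qed.

Lemma inside_at w : U w -> inside (chart_at (fst (C w))) w.
Proof. intro H. split; auto. apply chart_at_dom. Qed.

Definition vel4 a (v w : W) : R4 := dirD4 (fun w => coord a (C w)) w v.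

Lemma vel4_base a b v w : inside a w -> inside b w ->
  fst (vel4 b v w) = dtransition a b (fst (coord a (C w))) (fst (vel4 a v w)).
Proof.
  intros [Hw Ha] [_ Hb].
  transitivity (dirD2 (fun w => transition chart chart_inv a b (chart a (fst (C w)))) w v).
  - apply (dirD2_ext_loc (g := fun w => chart b (fst (C w)))).
    apply open_ext_locally with (inside a); [apply inside_open|now split|].
    intros y [_ Hy]. symmetry. exact (transition_chart b Hy).
  - apply (dirD2_comp2 (g := fun w => chart a (fst (C w)))).
    + exact (proj1 (coord_diff4 (conj Hw Ha))).
    + apply transition_diff2. now apply overlap_chart.
Qed.

(* Only the base components of the vectors matter, as for omega1 and omega2. *)
Definition chart_free (om : form M) := forall a b (z u u' : R4), slit a z -> over a b z ->
  fst u' = dtransition a b (fst z) (fst u) -> om b (trans4 a b z) u' = om a z u.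

Lemma chart_free_at (om : form M) a b (u u' : R4) (v w : W) : chart_free om ->
  snd (C w) <> (zero : R2) -> inside a w -> inside b w ->
  fst u = fst (vel4 a v w) -> fst u' = fst (vel4 b v w) ->
  om b (coord b (C w)) u' = om a (coord a (C w)) u.
Proof.
  intros Hom Hn Ha Hb E E'. rewrite (coord_trans (proj2 Ha) (proj2 Hb)).
  apply Hom.
  - apply slit_coord; auto. apply Ha.
  - apply overlap_chart; [apply Ha|apply Hb].
  - rewrite E, E'. now apply vel4_base.
Qed.

Lemma in_chart_C (f : TM M -> R) a w v : inside a w -> diff (in_chart a f) (coord a (C w)) ->
  dirD (fun w => f (C w)) w v = dirD (in_chart a f) (coord a (C w)) (vel4 a v w).
Proof.
  intros Hw Hf.
  etransitivity; [|exact (dirD_comp4 (f := in_chart a f) (G := fun w => coord a (C w)) v (coord_diff4 Hw) Hf)].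
  apply dirD_ext_loc. apply open_ext_locally with (inside a); auto using inside_open.
  intros y [_ Hy]. symmetry. now apply in_chart_coord.
Qed.

Lemma Ck_in_chart (f : TM M -> R) a k : smooth_slit f ->
  (forall w, U w -> snd (C w) <> (zero : R2)) -> Ck k (inside a) (fun w => f (C w)).
Proof.
  intros Hf Hn. apply Ck_ext with (fun w => in_chart a f (coord a (C w))).
  - apply inside_open.
  - intros w [_ Hw]. now apply in_chart_coord.
  - apply (Ck_comp4 (U' := slit a) (G := fun w => coord a (C w))); auto using inside_open.
    + apply Hf.
    + apply coord_Ck4.
    + intros w [Hw Ha]. apply slit_coord; auto.
Qed.

Lemma Ck_base_form (al1 al2 : R4 -> R) a k v : 
  (forall k, Ck k (slit a) al1) -> (forall k, Ck k (slit a) al2) ->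
  (forall w, U w -> snd (C w) <> (zero : R2)) ->
  Ck k (inside a) (fun w => al1 (coord a (C w)) * fst (fst (vel4 a v w))
    + al2 (coord a (C w)) * snd (fst (vel4 a v w))).
Proof.
  intros H1 H2 Hn. pose proof (@inside_open a) as HO.
  assert (Sl : forall w, inside a w -> slit a (coord a (C w))).
  { intros w [Hw Ha]. apply slit_coord; auto. }
  destruct (coord_Ck4 a (S k)) as [[K1 K2] _].
  apply Ck_plus; auto; apply Ck_mult; auto.
  - apply (Ck_comp4 (U' := slit a) (G := fun w => coord a (C w))); auto. apply coord_Ck4.
  - exact (Ck_dirD v K1).
  - apply (Ck_comp4 (U' := slit a) (G := fun w => coord a (C w))); auto. apply coord_Ck4.
  - exact (Ck_dirD v K2).
Qed.
End IntoTM.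
Arguments inside_open {M W U C} HC a.

Section Finsler.
Variables (M : oriented_surface) (F : finsler M).

Lemma omega1_free : chart_free (omega1 F).
Proof. intros a b z u u' H H' E. now apply omega1_trans. Qed.

Lemma omega2_free : chart_free (omega2 F).
Proof. intros a b z u u' H H' E. now apply omega2_trans. Qed.

Definition om1_1 a (z : R4) := snd (snd z) * area F a z.
Definition om1_2 a (z : R4) := - (fst (snd z) * area F a z).

Lemma om1E a z u : omega1 F a z u = om1_1 a z * fst (fst u) + om1_2 a z * snd (fst u).
Proof. rewrite omega1E. unfold om1_1, om1_2. ring. Qed.

Lemma om1_1_Ck a k : Ck k (slit a) (om1_1 a).
Proof.
  apply (Ck_mult (f := fun z : R4 => snd (snd z))); auto using slit_open, area_Ck.
  apply Ck_lin; [apply slit_open|exact (lin_fibre i2)].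
Qed.

Lemma om1_2_Ck a k : Ck k (slit a) (om1_2 a).
Proof.
  apply Ck_opp; [apply slit_open|].
  apply (Ck_mult (f := fun z : R4 => fst (snd z))); auto using slit_open, area_Ck.
  apply Ck_lin; [apply slit_open|exact (lin_fibre i1)].
Qed.
End Finsler.

(** * Symmetry of second derivatives and the pointwise first variation *)

Lemma continuity_2d_R2 (f : R2 -> R) (s t : R) : continuous f (s, t) ->
  continuity_2d_pt (fun x y => f (x, y)) s t.
Proof.
  intro H. apply continuity_2d_pt_filterlim. intros P HP.
  destruct (H P HP) as [e He]. exists e. intros [x y] Hb. exact (He (x, y) Hb).
Qed.

Lemma schwarz_R2 (U : R2 -> Prop) (f : R2 -> R) (w : R2) : open U -> Ck 2 U f -> U w ->
  dirD (fun y => dirD f y (0, 1)) w (1, 0) = dirD (fun y => dirD f y (1, 0)) w (0, 1).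
Proof.
  intros HU Hf Hw. destruct w as [s t].
  assert (D : forall s t : R, U (s, t) -> diff f (s, t)).
  { intros s' t' H. exact (Ck_diff Hf H). }
  pose proof (Ck_dirD (0, 1) Hf) as F2. pose proof (Ck_dirD (1, 0) Hf) as F1.
  assert (L : locally (s, t) U) by (apply HU; exact Hw).
  assert (L' : locally_2d (fun x y => U (x, y)) s t).
  { apply locally_2d_locally. destruct L as [e He]. exists e. intros [x y] H. now apply He. }
  assert (G1 : forall s t : R, U (s, t) -> Derive (fun r => f (r, t)) s = dirD f (s, t) (1, 0)).
  { intros s' t' H. apply is_derive_unique. now apply is_derive_fst, D. }
  assert (G2 : forall s t : R, U (s, t) -> Derive (fun r => f (s, r)) t = dirD f (s, t) (0, 1)).
  { intros s' t' H. apply is_derive_unique. now apply is_derive_snd, D. }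
  assert (V1 : forall s t : R, U (s, t) -> locally s (fun x => U (x, t))).
  { intros s' t' H. destruct (HU _ H) as [e He]. exists e. intros y Hy. apply He.
    split; [exact Hy|apply ball_center]. }
  assert (V2 : forall s t : R, U (s, t) -> locally t (fun x => U (s, x))).
  { intros s' t' H. destruct (HU _ H) as [e He]. exists e. intros y Hy. apply He.
    split; [apply ball_center|exact Hy]. }
  assert (K12 : forall s t : R, U (s, t) -> is_derive (fun z => Derive (fun r => f (z, r)) t) s
     (dirD (fun y => dirD f y (0, 1)) (s, t) (1, 0))).
  { intros s' t' H. apply is_derive_ext_loc with (fun z => dirD f (z, t') (0, 1)).
    - refine (filter_imp _ _ _ (V1 _ _ H)). intros x Hx. symmetry. now apply G2.
    - apply (is_derive_fst (f := fun y => dirD f y (0, 1))). exact (Ck_diff F2 H). }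
  assert (K21 : forall s t : R, U (s, t) -> is_derive (fun z => Derive (fun r => f (r, z)) s) t
     (dirD (fun y => dirD f y (1, 0)) (s, t) (0, 1))).
  { intros s' t' H. apply is_derive_ext_loc with (fun z => dirD f (s', z) (1, 0)).
    - refine (filter_imp _ _ _ (V2 _ _ H)). intros x Hx. symmetry. now apply G1.
    - apply (is_derive_snd (f := fun y => dirD f y (1, 0))). exact (Ck_diff F1 H). }
  etransitivity; [symmetry; exact (is_derive_unique _ _ _ (K12 _ _ Hw))|].
  etransitivity; [|exact (is_derive_unique _ _ _ (K21 _ _ Hw))].
  apply (Schwarz (fun x y => f (x, y))).
  - apply locally_2d_impl with (2 := L'). apply locally_2d_forall. intros x y H.
    repeat split.
    + eexists. now apply is_derive_fst, D.
    + eexists. now apply is_derive_snd, D.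
    + eexists. now apply K12.
    + eexists. now apply K21.
  - apply continuity_2d_pt_ext_loc with (fun x y => dirD (fun y => dirD f y (0, 1)) (x, y) (1, 0)).
    + apply locally_2d_impl with (2 := L'). apply locally_2d_forall. intros x y H.
      symmetry. exact (is_derive_unique _ _ _ (K12 _ _ H)).
    + exact (continuity_2d_R2 (Ck_continuous (Ck_dirD (1, 0) F2) Hw)).
  - apply continuity_2d_pt_ext_loc with (fun x y => dirD (fun y => dirD f y (1, 0)) (x, y) (0, 1)).
    + apply locally_2d_impl with (2 := L'). apply locally_2d_forall. intros x y H.
      symmetry. exact (is_derive_unique _ _ _ (K21 _ _ H)).
    + exact (continuity_2d_R2 (Ck_continuous (Ck_dirD (0, 1) F1) Hw)).
Qed.

Section FirstVariation.
Variables (M : oriented_surface) (U : R2 -> Prop) (C : R2 -> TM M).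
Hypothesis HC : smooth_into U C.
Hypothesis Hn : forall w, U w -> snd (C w) <> (zero : R2).

Notation ds := ((1, 0) : R2).
Notation dt := ((0, 1) : R2).

Definition pulled (om : form M) a (v w : R2) : R := om a (coord a (C w)) (vel4 C a v w).

(** Pullback commutes with exterior differentiation. The second derivatives of the base coordinates
    appear in both terms and cancel by Schwarz. *)
Lemma pulled_ext_d (om : form M) (al1 al2 : index M -> R4 -> R) a w :
  (forall a z u, om a z u = al1 a z * fst (fst u) + al2 a z * snd (fst u)) ->
  (forall k a, Ck k (slit a) (al1 a)) -> (forall k a, Ck k (slit a) (al2 a)) ->
  inside U C a w ->
  dirD (pulled om a dt) w ds - dirD (pulled om a ds) w dt
  = ext_d om a (coord a (C w)) (vel4 C a ds w) (vel4 C a dt w).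
Proof.
  intros Eom H1 H2 Hw. pose proof (inside_open HC a) as HO.
  set (z := fun w => coord a (C w)).
  assert (Hs : slit a (z w)) by (apply slit_coord; [apply Hw|apply Hn, Hw]).
  pose proof (coord_diff4 HC Hw) as Dz. fold z in Dz.
  pose proof (Ck_diff (H1 1%nat a) Hs) as D1. pose proof (Ck_diff (H2 1%nat a) Hs) as D2.
  destruct (coord_Ck4 HC a 2) as [[K1 K2] _]. fold z in K1, K2.
  assert (E : forall v v', dirD (pulled om a v) w v' =
    dirD (al1 a) (z w) (vel4 C a v' w) * fst (fst (vel4 C a v w))
    + al1 a (z w) * dirD (fun y => dirD (fun w => fst (fst (z w))) y v) w v'
    + (dirD (al2 a) (z w) (vel4 C a v' w) * snd (fst (vel4 C a v w))
    + al2 a (z w) * dirD (fun y => dirD (fun w => snd (fst (z w))) y v) w v')).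
  { intros v v'.
    transitivity (dirD (fun y => al1 a (z y) * dirD (fun w => fst (fst (z w))) y v
      + al2 a (z y) * dirD (fun w => snd (fst (z w))) y v) w v').
    - apply dirD_ext_loc. apply filter_forall. intro y. unfold pulled. rewrite Eom. reflexivity.
    - pose proof (Ck_diff (Ck_dirD v K1) Hw) as A1. pose proof (Ck_diff (Ck_dirD v K2) Hw) as A2.
      pose proof (diff_comp4 Dz D1) as B1. pose proof (diff_comp4 Dz D2) as B2.
      rewrite dirD_plus, !dirD_mult; auto using diff_mult.
      rewrite (dirD_comp4 v' Dz D1), (dirD_comp4 v' Dz D2). reflexivity. }
  rewrite !E.
  assert (S1 : dirD (fun y => dirD (fun w => fst (fst (z w))) y dt) w ds
    = dirD (fun y => dirD (fun w => fst (fst (z w))) y ds) w dt) by exact (schwarz_R2 HO K1 Hw).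
  assert (S2 : dirD (fun y => dirD (fun w => snd (fst (z w))) y dt) w ds
    = dirD (fun y => dirD (fun w => snd (fst (z w))) y ds) w dt) by exact (schwarz_R2 HO K2 Hw).
  rewrite S1, S2.
  assert (X : forall u v, dirD (fun z' => om a z' v) (z w) u =
     dirD (al1 a) (z w) u * fst (fst v) + dirD (al2 a) (z w) u * snd (fst v)).
  { intros u v. rewrite <- dirD_base_form; auto.
    apply dirD_ext_loc. apply filter_forall. intro y. apply Eom. }
  unfold ext_d. fold z. rewrite !X. ring.
Qed.

Variables (F : finsler M) (omega3 : form M) (I J K I1 I2 I3 : TM M -> R).
Hypothesis Hstr : structure_equations F omega3 I J K.
Hypothesis HdI : frame_derivatives F omega3 I I1 I2 I3.
Hypothesis HF : forall w, U w -> F (C w) = 1.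
Hypothesis H2 : forall a w, inside U C a w -> pulled (omega2 F) a dt w = 0.

Lemma C_sphere_in a w : inside U C a w -> sphere_in F a (coord a (C w)).
Proof.
  intros [Hw Ha]. split.
  - apply slit_coord; auto.
  - rewrite in_chart_coord; auto.
Qed.

Lemma C_tangent a v w : inside U C a w -> tangent_sphere F a (coord a (C w)) (vel4 C a v w).
Proof.
  intros Hw. unfold tangent_sphere.
  rewrite <- (in_chart_C HC v Hw).
  - transitivity (dirD (fun _ => 1) w v); [|apply dirD_const].
    apply dirD_ext_loc. apply open_ext_locally with (inside U C a); auto.
    + exact (inside_open HC a).
    + intros y [Hy _]. now apply HF.
  - apply norm_diff. exact (proj1 (C_sphere_in Hw)).
Qed.

Definition el_density a w := I1 (C w) * pulled (omega1 F) a dt w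
  + (I3 (C w) + 1) * pulled omega3 a dt w.

Definition boundary a w := pulled (omega1 F) a ds w - I (C w) * pulled (omega2 F) a ds w.

Lemma pulled1_Ck a v k : Ck k (inside U C a) (pulled (omega1 F) a v).
Proof.
  apply Ck_ext with (2 := fun w _ => eq_sym (om1E F a (coord a (C w)) (vel4 C a v w))).
  - exact (inside_open HC a).
  - apply Ck_base_form; auto; intro; [apply om1_1_Ck|apply om1_2_Ck].
Qed.

Lemma pulled2_Ck a v k : Ck k (inside U C a) (pulled (omega2 F) a v).
Proof.
  apply Ck_ext with (2 := fun w _ => eq_sym (omega2E F a (coord a (C w)) (vel4 C a v w))).
  - exact (inside_open HC a).
  - apply Ck_base_form; auto; intro; apply lower_Ck.
Qed.

Lemma boundary_Ck a k : Ck k (inside U C a) (boundary a).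
Proof.
  pose proof (inside_open HC a). apply Ck_minus; auto using pulled1_Ck.
  apply Ck_mult; auto using pulled2_Ck.
  apply Ck_in_chart; auto. apply (I_smooth Hstr).
Qed.

Lemma first_variation_pointwise a w : inside U C a w ->
  dirD (pulled (omega1 F) a dt) w ds =
  dirD (boundary a) w dt + el_density a w * pulled (omega2 F) a ds w.
Proof.
  intro Hw. pose proof (C_sphere_in Hw) as Hs. pose proof (inside_open HC a) as HO.
  pose proof (C_tangent ds Hw) as Ts. pose proof (C_tangent dt Hw) as Tt.
  pose proof (pulled_ext_d (om1E F) (fun k a => om1_1_Ck F a k) (fun k a => om1_2_Ck F a k) Hw) as P1.
  pose proof (pulled_ext_d (omega2E F) (fun k a => lower_Ck F a k i1) (fun k a => lower_Ck F a k i2) Hw) as P2.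
  rewrite (d_omega1 Hstr Hs Ts Tt) in P1. rewrite (d_omega2 Hstr Hs Ts Tt) in P2.
  (* All nearby curves of the family annihilate [omega2], so omega2(T) may also be differentiated in
     the variation parameter; d omega2 then yields the time derivative of omega2(S). *)
  assert (Z : dirD (pulled (omega2 F) a dt) w ds = 0).
  { transitivity (dirD (fun _ : R2 => 0) w ds); [|apply dirD_const].
    apply dirD_ext_loc. apply open_ext_locally with (inside U C a); auto. }
  rewrite Z in P2.
  (* The [I2] term of dI is multiplied by omega2(T) = 0. *)
  assert (DI : dirD (fun w => I (C w)) w dt =
    I1 (C w) * pulled (omega1 F) a dt w + I3 (C w) * pulled omega3 a dt w).
  { rewrite (in_chart_C HC dt Hw).
    - rewrite (HdI Hs Tt), !in_chart_coord; try apply Hw.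
      change (omega2 F a (coord a (C w)) (vel4 C a (0, 1) w)) with (pulled (omega2 F) a dt w).
      rewrite (H2 Hw). unfold pulled. ring.
    - exact (Ck_diff (I_smooth Hstr a 1%nat) (proj1 Hs)). }
  assert (DB : dirD (boundary a) w dt = dirD (pulled (omega1 F) a ds) w dt
    - (dirD (fun w => I (C w)) w dt * pulled (omega2 F) a ds w
       + I (C w) * dirD (pulled (omega2 F) a ds) w dt)).
  { pose proof (Ck_diff (pulled1_Ck a ds 1) Hw) as D1.
    pose proof (Ck_diff (pulled2_Ck a ds 1) Hw) as D2.
    pose proof (Ck_diff (Ck_in_chart HC a 1 (I_smooth Hstr) Hn) Hw) as D3.
    transitivity (dirD (fun w => pulled (omega1 F) a ds w + (-1) * (I (C w) * pulled (omega2 F) a ds w)) w dt).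
    - apply dirD_ext_loc. apply filter_forall. intro y. unfold boundary. ring.
    - rewrite dirD_plus; auto using diff_mult, diff_const.
      rewrite (dirD_mult (f := fun _ => -1)); auto using diff_mult, diff_const.
      rewrite dirD_const, (dirD_mult (f := fun w => I (C w))); auto. ring. }
  rewrite DB, DI. clear DB DI Z.
  rewrite in_chart_coord in P1; [|apply Hw].
  pose proof (H2 Hw) as Z.
  assert (Wd : forall om om' : form M,
    wedge om om' a (coord a (C w)) (vel4 C a ds w) (vel4 C a dt w) =
    pulled om a ds w * pulled om' a dt w - pulled om a dt w * pulled om' a ds w) by reflexivity.
  rewrite !Wd in P1. rewrite Wd in P2.
  rewrite Z in P1. unfold el_density.
  replace (dirD (pulled (omega2 F) a ds) w dt) with
    (pulled (omega1 F) a ds w * pulled omega3 a dt w - pulled (omega1 F) a dt w * pulled omega3 a ds w) by lra.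
  replace (dirD (pulled (omega1 F) a dt) w ds) with
   (dirD (pulled (omega1 F) a ds) w dt + (- I (C w) *
     (pulled (omega1 F) a ds w * pulled omega3 a dt w - pulled (omega1 F) a dt w * pulled omega3 a ds w) +
     (pulled (omega2 F) a ds w * pulled omega3 a dt w - 0 * pulled omega3 a ds w))) by lra.
  ring.
Qed.
End FirstVariation.

(** * Differentiation under the integral sign *)

Lemma itv_convex lo hi p q t : itv lo hi p -> itv lo hi q -> p <= t <= q -> itv lo hi t.
Proof.
  intros [H1 _] [_ H2] [H3 H4]. split.
  - apply Rbar_lt_le_trans with p; auto.
  - apply Rbar_le_lt_trans with q; auto.
Qed.

Lemma itv_open lo hi : open (itv lo hi).
Proof. apply open_and; [apply open_Rbar_gt|apply open_Rbar_lt]. Qed.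

Arguments itv_open : clear implicits.

Lemma smooth_into_open {M : oriented_surface} {W : NormedModule R_AbsRing} (U : W -> Prop)
  (C : W -> TM M) : smooth_into U C -> open U.
Proof.
  intros HC w Hw.
  refine (filter_imp _ _ _ (inside_open HC _ w (inside_at C Hw))). now intros y [Hy _].
Qed.

Lemma is_RInt_derive0 (f df : R -> R) (p q : R) : p < q ->
  (forall t, p <= t <= q -> is_derive f t (df t)) ->
  (forall t, p <= t <= q -> continuous df t) -> f p = 0 -> f q = 0 ->
  is_RInt df p q 0.
Proof.
  intros Hpq H1 H2 Ep Eq.
  replace 0 with (minus (f q) (f p)).
  - apply (is_RInt_derive (V := R_CompleteNormedModule)); intros t Ht;
      rewrite Rmin_left, Rmax_right in Ht by lra; auto.
  - rewrite Ep, Eq. unfold minus, plus, opp; simpl. ring.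
Qed.

(** Subtracting the time derivative of a function that vanishes at both ends leaves the integral
    unchanged. Continuity of the new integrand is recorded because the converse infers its sign from
    its integral. *)
Lemma leibniz_boundary (D : R2 -> Prop) (A Bd : R2 -> R) (e p q : R) :
  open D -> Ck 1 D A -> Ck 1 D Bd -> 0 < e -> p < q ->
  (forall s t, - e < s < e -> p <= t <= q -> D (s, t)) ->
  Bd (0, p) = 0 -> Bd (0, q) = 0 ->
  let h t := dirD A (0, t) (1, 0) - dirD Bd (0, t) (0, 1) in
  (forall t, p <= t <= q -> continuous h t) /\
  is_derive (fun s => RInt (fun t => A (s, t)) p q) 0 (RInt h p q).
Proof.
  intros HO A1 B1 He Hpq HD Ep Eq h.
  assert (H0 : forall t, p <= t <= q -> D (0, t)).
  { intros t Ht. apply HD; lra. }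
  pose proof (Ck_dirD (1, 0) A1) as A'. pose proof (Ck_dirD (0, 1) B1) as B'.
  assert (line : forall (f : R2 -> R) s t, continuous f (s, t) -> continuous (fun r => f (s, r)) t).
  { intros f s t Hf. apply (continuous_comp (fun r : R => (s, r) : R2) f); auto.
    exact (diff2_continuous (W := RN) (proj1 (diff2_line2 s t))). }
  assert (CA : forall t, p <= t <= q -> continuous (fun r => dirD A (0, r) (1, 0)) t).
  { intros t Ht. apply (line (fun w => dirD A w (1, 0))). exact (Ck_continuous A' (H0 t Ht)). }
  assert (CB : forall t, p <= t <= q -> continuous (fun r => dirD Bd (0, r) (0, 1)) t).
  { intros t Ht. apply (line (fun w => dirD Bd w (0, 1))). exact (Ck_continuous B' (H0 t Ht)). }
  split.
  { intros t Ht. apply (continuous_minus (V := RN)); auto. }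
  assert (X1 : ex_RInt (fun r => dirD A (0, r) (1, 0)) p q).
  { apply (ex_RInt_continuous (V := R_CompleteNormedModule)). intros t Ht.
    rewrite Rmin_left, Rmax_right in Ht by lra. auto. }
  assert (X2 : is_RInt (fun r => dirD Bd (0, r) (0, 1)) p q 0).
  { apply (is_RInt_derive0 (f := fun r => Bd (0, r)) Hpq); auto.
    intros t Ht. apply (is_derive_snd (f := Bd)). exact (Ck_diff B1 (H0 t Ht)). }
  assert (X3 : forall s t, - e < s < e -> p <= t <= q ->
    is_derive (fun r => A (r, t)) s (dirD A (s, t) (1, 0))).
  { intros s t Hs Ht. apply (is_derive_fst (f := A)). exact (Ck_diff A1 (HD s t Hs Ht)). }
  assert (L0 : locally 0 (fun s => - e < s < e)).
  { exists (mkposreal e He). intros s Hs. change (Rabs (s - 0) < e) in Hs.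
    apply Rabs_def2 in Hs. lra. }
  replace (RInt h p q) with (RInt (fun t => Derive (fun r => A (r, t)) 0) p q).
  - apply (is_derive_RInt_param (fun s t => A (s, t))).
    + refine (filter_imp _ _ _ L0). intros s Hs t Ht.
      rewrite Rmin_left, Rmax_right in Ht by lra. eexists. now apply X3.
    + intros t Ht. rewrite Rmin_left, Rmax_right in Ht by lra.
      apply continuity_2d_pt_ext_loc with (fun u v => dirD A (u, v) (1, 0)).
      * destruct (HO _ (H0 t Ht)) as [d Hd]. exists d. intros u v Hu Hv.
        assert (Huv : D (u, v)) by (apply Hd; split; assumption).
        symmetry. apply is_derive_unique. apply (is_derive_fst (f := A)).
        exact (Ck_diff A1 Huv).
      * exact (continuity_2d_R2 (f := fun w => dirD A w (1, 0)) (Ck_continuous A' (H0 t Ht))).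
    + refine (filter_imp _ _ _ L0). intros s Hs.
      apply (ex_RInt_continuous (V := R_CompleteNormedModule)). intros t Ht.
      rewrite Rmin_left, Rmax_right in Ht by lra.
      apply (line A). exact (Ck_continuous A1 (HD s t Hs Ht)).
  - transitivity (RInt (fun r => dirD A (0, r) (1, 0)) p q).
    + apply RInt_ext. intros t Ht. rewrite Rmin_left, Rmax_right in Ht by lra.
      apply is_derive_unique. apply X3; lra.
    + symmetry. apply is_RInt_unique.
      replace (RInt (fun r => dirD A (0, r) (1, 0)) p q) with
        (minus (RInt (fun r => dirD A (0, r) (1, 0)) p q) 0) by (unfold minus, plus, opp; simpl; ring).
      apply (is_RInt_minus (V := RN)); auto. now apply (RInt_correct (V := R_CompleteNormedModule)).
Qed.

(** * Curves and their variations read in charts *)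

Section Curve.
Variables (M : oriented_surface) (U : R -> Prop) (c : R -> TM M).
Hypothesis Hc : smooth_into (W := RN) U c.

Definition vel1 a t : R4 := vel4 (W := RN) c a 1 t.

Lemma vel1E a t : inside (W := RN) U c a t ->
  (vel_base a (fun r => fst (c r)) t, vel_fibre a c t) = vel1 a t.
Proof.
  intro H. destruct (coord_diff4 Hc H) as [[D1 D2] [D3 D4]].
  apply diff_R in D1, D2, D3, D4.
  apply (f_equal2 pair); apply (f_equal2 pair).
  - exact (Derive_dirD D1).
  - exact (Derive_dirD D2).
  - exact (Derive_dirD D3).
  - exact (Derive_dirD D4).
Qed.

Lemma pullE (om : form M) t : U t ->
  pull om c t = om (chart_at (fst (c t))) (coord (chart_at (fst (c t))) (c t)) (vel1 (chart_at (fst (c t))) t).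
Proof.
  intro H. unfold pull. rewrite vel1E; auto. exact (inside_at (W := RN) c H).
Qed.

(** [pull] evaluates at each time in the preferred chart of the current point, which need not vary
    continuously. For chart-free forms one chart serves a whole stretch of the curve. *)
Lemma pull_chart (om : form M) a t : chart_free om -> snd (c t) <> (zero : R2) ->
  inside (W := RN) U c a t -> pull om c t = om a (coord a (c t)) (vel1 a t).
Proof.
  intros Hom Hn H. rewrite pullE; [|apply H].
  symmetry. refine (chart_free_at Hc (v := 1 : RN) Hom Hn _ H _ _); auto.
  exact (inside_at (W := RN) c (proj1 H)). 
Qed.
End Curve.

Section Variation.
Variables (M : oriented_surface) (F : finsler M) (omega3 : form M) (I J K I1 I2 I3 : TM M -> R).
Hypothesis Hstr : structure_equations F omega3 I J K.
Hypothesis HdI : frame_derivatives F omega3 I I1 I2 I3.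
Variables (lo hi : Rbar) (c : R -> TM M) (e p q : R) (V : R -> R -> TM M).
Hypothesis HV : variation F lo hi c e p q V.

Notation ds := ((1, 0) : R2).
Notation dt := ((0, 1) : R2).
Let C (w : R2) := V (fst w) (snd w).
Let Dom (w : R2) := - e < fst w < e /\ itv lo hi (snd w).

Lemma var_C : smooth_into Dom C.
Proof. exact (var_smooth HV). Qed.

Lemma Dom_open : open Dom.
Proof. exact (smooth_into_open var_C). Qed.

Lemma var_neq0 w : Dom w -> snd (C w) <> (zero : R2).
Proof. intros [H1 H2]. apply (adm_sphere (var_admissible HV H1) H2). Qed.

Lemma var_norm w : Dom w -> F (C w) = 1.
Proof. intros [H1 H2]. apply (adm_sphere (var_admissible HV H1) H2). Qed.

Lemma inside_slice a s t : inside Dom C a (s, t) ->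
  inside (W := RN) (itv lo hi) (V s) a t.
Proof. intros [[_ H] H']. split; auto. Qed.

Lemma vel_slice a s t : inside Dom C a (s, t) -> vel1 (V s) a t = vel4 C a dt (s, t).
Proof.
  intros H. destruct (coord_diff4 var_C H) as [[D1 D2] [D3 D4]].
  assert (E : forall f : R2 -> R, diff f (s, t) ->
    dirD (V := RN) (fun r => f (s, r)) t 1 = dirD f (s, t) dt).
  { intros f Hf. pose proof (is_derive_snd Hf) as D.
    rewrite <- Derive_dirD; [|eexists; exact D]. now apply is_derive_unique. }
  apply (f_equal2 pair); apply (f_equal2 pair).
  - exact (E _ D1).
  - exact (E _ D2).
  - exact (E _ D3).
  - exact (E _ D4).
Qed.

Lemma pull_C (om : form M) a w : chart_free om -> inside Dom C a w ->
  pull om (V (fst w)) (snd w) = pulled C om a dt w.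
Proof.
  destruct w as [s t]. intros Hom H. change (pull om (V s) t = pulled C om a dt (s, t)).
  pose proof (proj1 (proj1 H)) as Hs. simpl in Hs.
  etransitivity; [exact (pull_chart (adm_smooth (var_admissible HV Hs)) Hom (var_neq0 (proj1 H)) (inside_slice H))|].
  now rewrite vel_slice.
Qed.

Lemma C_legendrian a w : inside Dom C a w -> pulled C (omega2 F) a dt w = 0.
Proof.
  intro H. rewrite <- pull_C; auto using omega2_free.
  destruct H as [[H1 H2] _]. apply (adm_omega2 (var_admissible HV H1) H2).
Qed.

Lemma pulled_free (om : form M) a b v w : chart_free om -> inside Dom C a w -> inside Dom C b w ->
  pulled C om a v w = pulled C om b v w.
Proof.
  intros Hom Ha Hb. unfold pulled. symmetry.
  refine (chart_free_at var_C (v := v) Hom (var_neq0 (proj1 Ha)) Ha Hb _ _); reflexivity.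
Qed.

Let A w := pull (omega1 F) (V (fst w)) (snd w).
Let Bd w := boundary C F I (chart_at (fst (C w))) w.

(** Regularity is local, and near each point the chart preferred there can be used throughout. *)
Lemma A_Ck k : Ck k Dom A.
Proof.
  apply Ck_local. intros w Hw. pose proof (inside_at C Hw) as Hi.
  set (a := chart_at (fst (C w))) in *.
  exists (inside Dom C a). repeat split; auto; try apply Hi.
  - exact (inside_open var_C a).
  - apply Ck_ext with (pulled C (omega1 F) a dt).
    + exact (inside_open var_C a).
    + intros y Hy. symmetry. exact (pull_C (@omega1_free M F) Hy).
    + apply (pulled1_Ck var_C var_neq0).
Qed.

Lemma BdE a w : inside Dom C a w -> Bd w = boundary C F I a w.
Proof.
  intro H. pose proof (inside_at C (proj1 H)) as Hi.
  unfold Bd, boundary.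
  rewrite (pulled_free _ (@omega1_free M F) Hi H), (pulled_free _ (@omega2_free M F) Hi H). reflexivity.
Qed.

Lemma Bd_Ck k : Ck k Dom Bd.
Proof.
  apply Ck_local. intros w Hw. pose proof (inside_at C Hw) as Hi.
  set (a := chart_at (fst (C w))) in *.
  exists (inside Dom C a). repeat split; auto; try apply Hi.
  - exact (inside_open var_C a).
  - apply Ck_ext with (boundary C F I a).
    + exact (inside_open var_C a).
    + intros y Hy. now rewrite (BdE Hy).
    + apply (boundary_Ck var_C var_neq0 Hstr).
Qed.

(** At such times the variation does not depend on the variation parameter, so the base part of S
    vanishes. *)
Lemma Bd_end t : itv lo hi t -> ~ (p < t < q) -> Bd (0, t) = 0.
Proof.
  intros Ht Hpq. pose proof (var_pos HV) as He.
  assert (H : Dom (0, t)) by (split; simpl; [lra|exact Ht]).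
  pose proof (inside_at C H) as Hi. unfold Bd. set (a := chart_at (fst (C (0, t)))) in *.
  destruct (coord_diff4 var_C Hi) as [[D1 D2] _].
  assert (E : forall f : R4 -> R, diff (fun w => f (coord a (C w))) (0, t) ->
    dirD (fun w => f (coord a (C w))) (0, t) ds = 0).
  { intros f Hf. rewrite <- (is_derive_unique _ _ _ (is_derive_fst Hf)).
    transitivity (Derive (fun _ => f (coord a (c t))) 0); [|apply Derive_const].
    apply Derive_ext_loc. exists (mkposreal e He). intros s Hs.
    change (Rabs (s - 0) < e) in Hs. apply Rabs_def2 in Hs.
    unfold C. simpl. rewrite (var_outside HV); auto. lra. }
  assert (E1 : fst (fst (vel4 C a ds (0, t))) = 0) by exact (E (fun z => fst (fst z)) D1).
  assert (E2 : snd (fst (vel4 C a ds (0, t))) = 0) by exact (E (fun z => snd (fst z)) D2).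
  unfold boundary, pulled. rewrite omega1E, omega2E, E1, E2. ring.
Qed.

(** The integrand [h] is fixed before the chart [a], so that its value can be read in whatever chart
    is convenient at each time. *)
Lemma first_variation : exists h : R -> R,
  (forall t, p <= t <= q -> continuous h t) /\
  is_derive (fun s => RInt (pull (omega1 F) (V s)) p q) 0 (RInt h p q) /\
  (forall a t, p <= t <= q -> inside Dom C a (0, t) ->
    h t = el_density C F omega3 I1 I3 a (0, t) * pulled C (omega2 F) a ds (0, t)).
Proof.
  pose proof (var_pos HV) as He. destruct (var_support HV) as (Hp & Hpq & Hq).
  assert (HD : forall s t, - e < s < e -> p <= t <= q -> Dom (s, t)).
  { intros s t Hs Ht. split; auto. exact (itv_convex Hp Hq Ht). }
  destruct (leibniz_boundary Dom_open (A_Ck 1) (Bd_Ck 1) He Hpq HD) as [X1 X2].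
  { apply Bd_end; auto; lra. }
  { apply Bd_end; auto; lra. }
  exists (fun t => dirD A (0, t) ds - dirD Bd (0, t) dt).
  split; [exact X1|split; [exact X2|]].
  intros a t Ht Hi.
  assert (EA : dirD A (0, t) ds = dirD (pulled C (omega1 F) a dt) (0, t) ds).
  { apply dirD_ext_loc. apply open_ext_locally with (inside Dom C a); auto.
    - exact (inside_open var_C a).
    - intros y Hy. exact (pull_C (@omega1_free M F) Hy). }
  assert (EB : dirD Bd (0, t) dt = dirD (boundary C F I a) (0, t) dt).
  { apply dirD_ext_loc. apply open_ext_locally with (inside Dom C a); auto.
    - exact (inside_open var_C a).
    - intros y Hy. exact (BdE Hy). }
  refine (eq_trans (f_equal2 Rminus EA EB) _).
  refine (eq_trans (f_equal (fun x => x - _)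
    (first_variation_pointwise var_C var_neq0 Hstr HdI var_norm C_legendrian Hi)) _).
  ring.
Qed.

End Variation.

(** * Normal lifts *)

Lemma norm_zero (M : oriented_surface) (F : finsler M) (p : M) : F (p, zero : R2) = 0.
Proof.
  pose proof (norm_homogeneous F p zero (l := 2) ltac:(lra)) as H.
  assert (E : scal 2 (zero : R2) = zero) by exact (scal_zero_r (V := R2) 2).
  assert (H' : F (p, zero : R2) = 2 * F (p, zero : R2)).
  { transitivity (F (p, scal 2 (zero : R2))); [now rewrite E|exact H]. }
  lra.
Qed.

Lemma vel1_ext (M : oriented_surface) (c c' : R -> TM M) a (t : R) :
  locally t (fun r => c r = c' r) -> vel1 c a t = vel1 c' a t.
Proof.
  intro H. apply (f_equal2 pair).
  - apply (dirD2_ext_loc (W := RN) (g := fun r => fst (coord a (c r)))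
      (g' := fun r => fst (coord a (c' r)))).
    refine (filter_imp _ _ _ H). intros r E. now rewrite E.
  - apply (dirD2_ext_loc (W := RN) (g := fun r => snd (coord a (c r)))
      (g' := fun r => snd (coord a (c' r)))).
    refine (filter_imp _ _ _ H). intros r E. now rewrite E.
Qed.

(** omega1(u) = 0 makes the base part of [u] a multiple of y, and omega2 takes the nonzero value F
    on y. *)
Lemma omega12_zero (M : oriented_surface) (F : finsler M) a (z u : R4) : slit a z ->
  omega1 F a z u = 0 -> omega2 F a z u = 0 -> fst u = (zero : R2).
Proof.
  intros Hz H1 H2. rewrite omega1E in H1. rewrite omega2E in H2.
  pose proof (area_pos F Hz) as Pa. pose proof (norm_pos F Hz) as Pf.
  pose proof (norm_euler F Hz) as E.
  apply Rmult_integral in H1. destruct H1 as [H1|H1]; [lra|].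
  destruct u as [[u1 u2] u']. simpl in *.
  set (l1 := lower F a i1 z) in *. set (l2 := lower F a i2 z) in *.
  set (f := in_chart a F z) in *. 
  assert (forall y1 y2 u1 u2 : R, y1 * l1 + y2 * l2 = f -> y2 * u1 - y1 * u2 = 0 ->
    l1 * u1 + l2 * u2 = 0 -> u1 = 0 /\ u2 = 0) as K.
  { clear - Pf. intros y1 y2 u1 u2 E H1 H2.
    assert (A : f * u1 = 0).
    { rewrite <- E. transitivity (y1 * (l1 * u1 + l2 * u2) + l2 * (y2 * u1 - y1 * u2)); [ring|].
      rewrite H1, H2. ring. }
    assert (B : f * u2 = 0).
    { rewrite <- E. transitivity (y2 * (l1 * u1 + l2 * u2) - l1 * (y2 * u1 - y1 * u2)); [ring|].
      rewrite H1, H2. ring. }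
    split; [apply Rmult_integral in A; destruct A|apply Rmult_integral in B; destruct B]; lra. }
  destruct (K _ _ _ _ E H1 H2) as [-> ->]. reflexivity.
Qed.

Section NormalLift.
Variables (M : oriented_surface) (F : finsler M) (lo hi : Rbar) (gamma : R -> M) (N : R -> R2).
Hypothesis HN : normal_lift F lo hi gamma N.
Notation c := (lift M gamma N).
Notation at_ t := (chart_at (gamma t)).

Lemma lift_inside t : itv lo hi t -> inside (W := RN) (itv lo hi) c (at_ t) t.
Proof. intro H. split; auto. apply chart_at_dom. Qed.

Lemma lift_coord t : coord (at_ t) (c t) = (chart (at_ t) (gamma t), N t).
Proof. exact (coord_at (c t)). Qed.

Lemma lift_slit t : itv lo hi t -> slit (at_ t) (coord (at_ t) (c t)).
Proof.
  intro H. apply slit_coord.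
  - apply chart_at_dom.
  - exact (normal_neq0 HN H).
Qed.

Lemma lift_vel t : itv lo hi t -> fst (vel1 c (at_ t) t) = tangent M gamma t.
Proof. intro H. rewrite <- (vel1E (lift_smooth HN) (lift_inside H)). reflexivity. Qed.

Lemma lift_norm t : itv lo hi t -> F (c t) = 1.
Proof.
  intro H. pose proof (lift_slit H) as Hz. pose proof (gdot_yy F Hz) as E.
  pose proof (normal_unit HN H) as U. unfold gN in U.
  assert (E2 : snd (coord (at_ t) (c t)) = N t) by now rewrite lift_coord.
  rewrite E2, U in E. pose proof (norm_pos F Hz) as P.
  rewrite in_chart_coord in E, P; try apply chart_at_dom. nra.
Qed.

Lemma lift_omega2 t : itv lo hi t ->
  omega2 F (at_ t) (coord (at_ t) (c t)) (vel1 c (at_ t) t) = 0.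
Proof.
  intro H. pose proof (lift_slit H) as Hz.
  pose proof (normal_orthogonal HN H) as U. unfold gN in U.
  assert (E2 : snd (coord (at_ t) (c t)) = N t) by now rewrite lift_coord.
  rewrite <- E2, <- (lift_vel H), gdot_y in U; auto.
  rewrite in_chart_coord, (lift_norm H) in U; [|apply chart_at_dom].
  rewrite omega2E. lra.
Qed.

Lemma sigmaE t : itv lo hi t ->
  sigma_of F gamma N t = omega1 F (at_ t) (coord (at_ t) (c t)) (vel1 c (at_ t) t).
Proof. intro H. exact (pullE (lift_smooth HN) (omega1 F) H). Qed.

Lemma tangent_neq0 t : itv lo hi t -> tangent M gamma t <> zero.
Proof.
  intros H E. pose proof (unit_speed HN H) as U. rewrite E, norm_zero in U. lra.
Qed.

Lemma sigma_neq0 t : itv lo hi t -> sigma_of F gamma N t <> 0.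
Proof.
  intros H E. rewrite sigmaE in E; auto. apply (tangent_neq0 H).
  rewrite <- (lift_vel H). exact (omega12_zero (lift_slit H) E (lift_omega2 H)).
Qed.

Lemma lift_sphere t : itv lo hi t -> sphere F (c t).
Proof. intro H. split; [exact (normal_neq0 HN H)|now apply lift_norm]. Qed.

Lemma lift_admissible : admissible F lo hi c.
Proof.
  split.
  - exact (lift_smooth HN).
  - exact lift_sphere.
  - intros t H. rewrite (pullE (lift_smooth HN) (omega2 F) H). exact (lift_omega2 H).
  - exact sigma_neq0.
Qed.

Lemma lift_sphere_in a t : inside (W := RN) (itv lo hi) c a t ->
  sphere_in F a (coord a (c t)).
Proof.
  intros [H Ha]. split.
  - apply slit_coord; auto. exact (normal_neq0 HN H).
  - rewrite in_chart_coord; auto. now apply lift_norm.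
Qed.

Lemma lift_tangent a t : inside (W := RN) (itv lo hi) c a t ->
  tangent_sphere F a (coord a (c t)) (vel1 c a t).
Proof.
  intro Hi. unfold tangent_sphere, vel1.
  rewrite <- (in_chart_C (lift_smooth HN) (1 : RN) Hi).
  - transitivity (dirD (V := RN) (fun _ => 1) t 1); [|apply (dirD_const (V := RN))].
    apply (dirD_ext_loc (V := RN)).
    apply (open_ext_locally (V := RN) (U := itv lo hi)).
    + exact (itv_open lo hi).
    + apply Hi.
    + exact lift_norm.
  - apply norm_diff. exact (proj1 (lift_sphere_in Hi)).
Qed.

(** By [omega3_theta], omega3(T) is the [omega1] formula applied to the covariant derivative of N.
    That vector is - k / sigma^2 times the tangent, on which the formula takes the value sigma. *)
Lemma omega3_curvature (omega3 : form M) (I J K : TM M -> R) (G : connection M) (k : R) t :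
  structure_equations F omega3 I J K -> chern_connection F G -> itv lo hi t ->
  covD G gamma N N t = scal (- (k / sigma_of F gamma N t ^ 2)) (tangent M gamma t) ->
  omega3 (at_ t) (coord (at_ t) (c t)) (vel1 c (at_ t) t) = - (k / sigma_of F gamma N t).
Proof.
  intros HS HG H Hk. pose proof (lift_inside H) as Hi.
  pose proof (lift_slit H) as Hz. pose proof (sigma_neq0 H) as Hs. pose proof (sigmaE H) as Es.
  rewrite (omega3_theta HG Hz HS (lift_sphere_in Hi) (lift_tangent Hi) (lift_omega2 H)); [|congruence].
  set (z := coord (at_ t) (c t)) in *. set (X := vel1 c (at_ t) t) in *.
  assert (EX : (vel_base (at_ t) gamma t, vel_fibre (at_ t) c t) = X) by exact (vel1E (lift_smooth HN) Hi).
  assert (E2 : N t = snd z) by (unfold z; now rewrite lift_coord).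
  (* The fibre coordinate of the lift is N, so the vertical part of its velocity is exactly the
     covariant derivative of N. *)
  assert (V : forall i, vert G (at_ t) z X i = cmp i (covD G gamma N N t)).
  { intro i. rewrite <- EX. unfold vert, covD, nonlinear, sum2, tangent. fold z. rewrite E2.
    destruct i; simpl; ring. }
  unfold theta. rewrite !V, Hk.
  rewrite <- (lift_vel H). fold X.
  rewrite omega1E in Es. set (s := sigma_of F gamma N t) in *.
  transitivity (- (k / s ^ 2) * (area F (at_ t) z * (snd (snd z) * fst (fst X) - fst (snd z) * snd (fst X)))).
  - change (cmp i1 (scal (- (k / s ^ 2)) (fst X))) with (- (k / s ^ 2) * fst (fst X)).
    change (cmp i2 (scal (- (k / s ^ 2)) (fst X))) with (- (k / s ^ 2) * snd (fst X)). ring.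
  - rewrite <- Es. field. exact Hs.
Qed.

Lemma variation_density (omega3 : form M) (I1 I3 : TM M -> R) e p q V t : 
  variation F lo hi c e p q V -> itv lo hi t ->
  forall a, inside (W := RN) (itv lo hi) c a t ->
  inside (fun w : R2 => - e < fst w < e /\ itv lo hi (snd w)) (fun w => V (fst w) (snd w)) a (0, t) /\
  el_density (fun w : R2 => V (fst w) (snd w)) F omega3 I1 I3 a (0, t) =
  I1 (c t) * omega1 F a (coord a (c t)) (vel1 c a t)
  + (I3 (c t) + 1) * omega3 a (coord a (c t)) (vel1 c a t).
Proof.
  intros HV Ht a Ha. pose proof (var_pos HV) as He.
  assert (E0 : V 0 t = c t) by exact (var_0 HV Ht).
  assert (Hi : inside (fun w : R2 => - e < fst w < e /\ itv lo hi (snd w)) (fun w => V (fst w) (snd w)) a (0, t)).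
  { split; [split; simpl; [lra|exact Ht]|]. simpl. rewrite E0. apply Ha. }
  split; [exact Hi|].
  assert (EX : vel4 (fun w : R2 => V (fst w) (snd w)) a (0, 1) (0, t) = vel1 c a t).
  { etransitivity; [symmetry; exact (vel_slice HV Hi)|]. apply vel1_ext.
    refine (filter_imp _ _ _ (itv_open lo hi t Ht)). intros r Hr. exact (var_0 HV Hr). }
  unfold el_density, pulled. rewrite EX. simpl. now rewrite E0.
Qed.

Lemma euler_lagrange_extremal (omega3 : form M) (I J K I1 I2 I3 : TM M -> R) :
  structure_equations F omega3 I J K -> frame_derivatives F omega3 I I1 I2 I3 ->
  (forall t, itv lo hi t -> I1 (c t) * sigma_of F gamma N t
    + (I3 (c t) + 1) * omega3 (at_ t) (coord (at_ t) (c t)) (vel1 c (at_ t) t) = 0) ->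
  N_extremal F lo hi c.
Proof.
  intros HS HI H. split; [exact lift_admissible|].
  intros e p q V HV.
  destruct (first_variation HS HI HV) as (h & _ & Hd & Hh).
  destruct (var_support HV) as (Hp & Hpq & Hq).
  replace 0 with (RInt h p q) at 2; [exact Hd|].
  transitivity (RInt (fun _ => 0) p q).
  - apply RInt_ext. intros t Ht. rewrite Rmin_left, Rmax_right in Ht by lra.
    assert (Ht' : itv lo hi t) by (apply (itv_convex Hp Hq); lra).
    destruct (variation_density omega3 I1 I3 HV Ht' (lift_inside Ht')) as [Hi E].
    rewrite (Hh (at_ t) t); [|lra|exact Hi].
    rewrite E, <- sigmaE, H; auto. apply Rmult_0_l.
  - rewrite RInt_const. apply Rmult_0_r.
Qed.
End NormalLift.

(** * Bump functions *)

(** The powers of / t make the family closed under differentiation, up to linear combinations. *)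
Definition flat (n : nat) (t : R) : R :=
  if Rlt_dec 0 t then (/ t) ^ n * exp (- / t) else 0.

Lemma flat_pos n t : 0 < t -> 0 < flat n t.
Proof.
  intro H. unfold flat. destruct (Rlt_dec 0 t); [|lra].
  apply Rmult_lt_0_compat; [|apply exp_pos]. apply pow_lt. now apply Rinv_0_lt_compat.
Qed.

Lemma flat_neg n t : t <= 0 -> flat n t = 0.
Proof. intro H. unfold flat. destruct (Rlt_dec 0 t); lra. Qed.

(** A quadratic bound gives derivative 0 at the origin. With m = n + 2, comparing the exponential of
    / t with its m-th power leaves t^2 after the factor (/ t)^n. *)
Lemma flat_bound n t : 0 <= flat n t <= INR (S (S n)) ^ S (S n) * t ^ 2.
Proof.
  assert (Hm : 0 < INR (S (S n))) by (apply lt_0_INR; lia).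
  destruct (Rlt_le_dec 0 t) as [H|H].
  - split; [left; now apply flat_pos|].
    unfold flat. destruct (Rlt_dec 0 t); [|lra].
    set (m := S (S n)) in *. set (x := / t).
    assert (Hx : 0 < x) by now apply Rinv_0_lt_compat.
    (* [exp x = exp (x / m) ^ m >= (x / m) ^ m] *)
    assert (E : exp x = exp (x / INR m) ^ m).
    { rewrite <- Rpower_pow; [|apply exp_pos]. unfold Rpower. rewrite ln_exp.
      f_equal. field. lra. }
    assert (P : x ^ m <= INR m ^ m * exp x).
    { rewrite E, <- Rpow_mult_distr. apply pow_incr. split; [lra|].
      pose proof (exp_ineq1_le (x / INR m)) as Q.
      apply Rmult_le_reg_l with (/ INR m); [now apply Rinv_0_lt_compat|].
      rewrite <- Rmult_assoc, Rinv_l, Rmult_1_l by lra. unfold Rdiv in Q. lra. }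
    assert (Ht : t = / x) by (unfold x; now rewrite Rinv_inv).
    rewrite exp_Ropp, Ht.
    pose proof (exp_pos x) as Pe.
    apply Rmult_le_reg_r with (exp x * x ^ 2).
    + apply Rmult_lt_0_compat; auto. now apply pow_lt.
    + replace (x ^ n * / exp x * (exp x * x ^ 2)) with (x ^ m) by (unfold m; simpl; field; lra).
      replace (INR m ^ m * (/ x) ^ 2 * (exp x * x ^ 2)) with (INR m ^ m * exp x) by (field; lra).
      exact P.
  - rewrite flat_neg; auto. split; [lra|].
    apply Rmult_le_pos; [apply pow_le; lra|apply pow2_ge_0].
Qed.

Lemma is_derive_flat n t : is_derive (flat n) t (- INR n * flat (S n) t + flat (S (S n)) t).
Proof.
  destruct (Rtotal_order t 0) as [H|[H|H]].
  - rewrite !flat_neg; try lra. replace (- INR n * 0 + 0) with 0 by ring.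
    apply is_derive_ext_loc with (fun _ => 0); [|apply (is_derive_const (K := R_AbsRing) (V := RN))].
    assert (Hp : 0 < - t) by lra. exists (mkposreal _ Hp). intros y Hy.
    change (Rabs (y - t) < - t) in Hy. apply Rabs_def2 in Hy. symmetry. apply flat_neg. lra.
  - subst t. rewrite !(flat_neg _ (Rle_refl 0)). replace (- INR n * 0 + 0) with 0 by ring.
    apply is_derive_Reals. intros e He.
    set (K := INR (S (S n)) ^ S (S n)).
    assert (HK : 0 < K) by (apply pow_lt, lt_0_INR; lia).
    (* The difference quotient at 0 is at most K |h| by the quadratic bound. *)
    assert (Hd : 0 < e / K) by now apply Rdiv_lt_0_compat.
    exists (mkposreal _ Hd). intros h Hh Hh'. simpl in Hh'.
    rewrite Rplus_0_l, (flat_neg _ (Rle_refl 0)).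
    replace ((flat n h - 0) / h - 0) with (flat n h / h) by (field; auto).
    unfold Rdiv. rewrite Rabs_mult, Rabs_inv.
    pose proof (flat_bound n h) as [B1 B2]. fold K in B2.
    rewrite (Rabs_right (flat n h)) by lra.
    assert (Ha : 0 < Rabs h) by now apply Rabs_pos_lt.
    apply Rmult_lt_reg_r with (Rabs h); auto.
    rewrite Rmult_assoc, Rinv_l, Rmult_1_r by lra.
    apply Rle_lt_trans with (1 := B2).
    rewrite <- (pow2_abs h).
    assert (Q : K * Rabs h < e).
    { apply Rmult_lt_reg_r with (/ K); [now apply Rinv_0_lt_compat|].
      replace (K * Rabs h * / K) with (Rabs h) by (field; lra). exact Hh'. }
    nra.
  - apply is_derive_ext_loc with (fun x => (/ x) ^ n * exp (- / x)).
    + exists (mkposreal _ H). intros y Hy.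
      change (Rabs (y - t) < t) in Hy. apply Rabs_def2 in Hy. unfold flat.
      destruct (Rlt_dec 0 y); [reflexivity|lra].
    + unfold flat. destruct (Rlt_dec 0 t); [|lra].
      auto_derive; [lra|]. destruct n as [|n].
      * simpl. field. lra.
      * replace (Init.Nat.pred (S n)) with n by reflexivity. simpl pow. field. lra.
Qed.

Lemma open_all {V : UniformSpace} : open (fun _ : V => True).
Proof. apply open_true. Qed.

Lemma flat_Ck k n : Ck (V := RN) k (fun _ => True) (flat n).
Proof.
  revert n. induction k as [|k IH]; intro n.
  - intros t _. apply (ex_derive_continuous (flat n)). eexists. apply is_derive_flat.
  - split.
    + intros t _. apply ex_derive_filterdiff. eexists. apply is_derive_flat.
    + intro v. apply (@Ck_ext RN) with
        (fun t => v * (- INR n * flat (S n) t + flat (S (S n)) t)).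
      * apply open_all.
      * intros t _. rewrite dirD_R; [|eexists; apply is_derive_flat].
        now rewrite (is_derive_unique _ _ _ (is_derive_flat n t)).
      * pose proof (@open_all RN) as HO.
        apply (@Ck_mult RN); auto; [now apply (@Ck_const RN)|].
        apply (@Ck_plus RN); auto.
        apply (@Ck_mult RN); auto. now apply (@Ck_const RN).
Qed.

Definition bump (t0 d t : R) : R := flat 0 (t - (t0 - d)) * flat 0 (t0 + d - t).

Lemma bump_Ck k t0 d : Ck (V := RN) k (fun _ => True) (bump t0 d).
Proof.
  pose proof (@open_all RN) as HO.
  assert (Hid : Ck (V := RN) k (fun _ => True) (fun t => t)).
  { apply (@Ck_lin RN); auto. apply (@is_linear_id R_AbsRing RN). }
  apply (@Ck_mult RN); auto.
  - apply (@Ck_comp1 RN) with (P := fun _ => True) (f := fun t => t - (t0 - d)); auto using flat_Ck.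
    apply (@Ck_minus RN); auto. now apply (@Ck_const RN).
  - apply (@Ck_comp1 RN) with (P := fun _ => True) (f := fun t => t0 + d - t); auto using flat_Ck.
    apply (@Ck_minus RN); auto. now apply (@Ck_const RN).
Qed.

Lemma bump_pos t0 d t : t0 - d < t < t0 + d -> 0 < bump t0 d t.
Proof. intro H. apply Rmult_lt_0_compat; apply flat_pos; lra. Qed.

(** The derivative is included because the bent lift depends on the base velocity as well as on the
    base point, and both must be unchanged outside the bump. *)
Lemma bump_outside t0 d t : ~ (t0 - d < t < t0 + d) ->
  bump t0 d t = 0 /\ Derive (bump t0 d) t = 0.
Proof.
  intro H.
  assert (D : is_derive (bump t0 d) t (flat 2 (t - (t0 - d)) * flat 0 (t0 + d - t)
    - flat 0 (t - (t0 - d)) * flat 2 (t0 + d - t))).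
  { pose proof (is_derive_flat 0 (t - (t0 - d))) as D1.
    pose proof (is_derive_flat 0 (t0 + d - t)) as D2. simpl INR in D1, D2.
    unfold bump. auto_derive.
    - split; [eexists; exact D1|]. split; auto. eexists; exact D2.
    - replace (t + - (t0 + - d)) with (t - (t0 - d)) by ring.
      replace (t0 + d + - t) with (t0 + d - t) by ring.
      apply is_derive_unique in D1, D2.
      assert (E1 : Derive (fun x : R => flat 0 x) (t + - (t0 - d)) = - 0 * flat 1 (t - (t0 - d)) + flat 2 (t - (t0 - d)))
        by exact D1.
      assert (E2 : Derive (fun x : R => flat 0 x) (t0 + d - t) = - 0 * flat 1 (t0 + d - t) + flat 2 (t0 + d - t))
        by exact D2.
      rewrite E1, E2. change (t + - (t0 - d)) with (t - (t0 - d)). ring. }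
  rewrite (is_derive_unique _ _ _ D). unfold bump.
  destruct (Rle_dec t (t0 - d)).
  - rewrite !(flat_neg _ (t := t - (t0 - d))) by lra. split; ring.
  - rewrite !(flat_neg _ (t := t0 + d - t)) by lra. split; ring.
Qed.

(** * Implicit functions and the inverse Legendre transform *)

Lemma continuous_lt {T : UniformSpace} (f : T -> R) (x : T) (c : R) :
  continuous f x -> f x < c -> locally x (fun y => f y < c).
Proof. intros Hf H. exact (Hf _ (open_lt c _ H)). Qed.

Lemma continuous_gt {T : UniformSpace} (f : T -> R) (x : T) (c : R) :
  continuous f x -> c < f x -> locally x (fun y => c < f y).
Proof. intros Hf H. exact (Hf _ (open_gt c _ H)). Qed.

Section Implicit.
Context {W : NormedModule R_AbsRing}.
Definition WR : NormedModule R_AbsRing := prod_NormedModule R_AbsRing W RN.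

Lemma norm_WR (h : W) (k : R) : norm ((h, k) : WR) <= 2 * (norm h + Rabs k).
Proof.
  pose proof (norm_prod (U := W) (V := RN) h k) as [_ H].
  change (norm (k : RN)) with (Rabs k) in H.
  eapply Rle_trans; [exact H|].
  assert (S : 0 <= sqrt 2 <= 2).
  { split; [apply sqrt_pos|]. rewrite <- (sqrt_square 2) at 2 by lra. apply sqrt_le_1; lra. }
  assert (Q : 0 <= Rmax (norm h) (Rabs k) <= norm h + Rabs k).
  { pose proof (norm_ge_0 h). pose proof (Rabs_pos k).
    split; [apply Rle_trans with (norm h); auto; apply Rmax_l|]. apply Rmax_lub; lra. }
  apply Rmult_le_compat; lra.
Qed.

Lemma lin_inl : is_linear (fun h : W => (h, 0) : WR).
Proof.
  split.
  - intros x y. apply (f_equal2 pair); [reflexivity|]. change (0 = 0 + 0). ring.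
  - intros k x. apply (f_equal2 pair); [reflexivity|]. change (0 = k * 0). ring.
  - exists 2. split; [lra|]. intro x. eapply Rle_trans; [apply norm_WR|].
    rewrite Rabs_R0. lra.
Qed.

Lemma split_WR (h : W) (k : R) : ((h, k) : WR) = plus ((h, 0) : WR) (scal k ((zero, 1) : WR)).
Proof.
  apply (f_equal2 pair).
  - symmetry. etransitivity; [|apply plus_zero_r]. f_equal. exact (scal_zero_r (V := W) k).
  - change (k = 0 + k * 1). ring.
Qed.

(** Continuity of [g] brings the graph into the range of the linear approximation of [H]. A coarse
    use of that approximation gives a Lipschitz bound for [g] at [p]; a fine use then makes the
    remainder small relative to the increment of [p] alone. *)
Lemma implicit_filterdiff (H : WR -> R) (p : W) (g : W -> R) :
  diff H (p, g p) -> 0 < dirD H (p, g p) ((zero, 1) : WR) ->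
  locally p (fun p' => H (p', g p') = 0) -> continuous g p ->
  filterdiff g (locally p)
    (fun h => (- / dirD H (p, g p) ((zero, 1) : WR)) * dirD H (p, g p) ((h, 0) : WR)).
Proof.
  intros HD Ha HZ Hg. set (a := dirD H (p, g p) ((zero, 1) : WR)) in *.
  set (L := dirD H (p, g p)) in *.
  assert (Hlin : is_linear (fun h : W => L ((h, 0) : WR))).
  { exact (lin_comp lin_inl (diff_linear HD)). }
  split.
  - apply (lin_comp (g := fun r : RN => scal (- / a) r) Hlin).
    exact (@is_linear_scal_r R_AbsRing RN (- / a) Rmult_comm).
  - intros x Hx. apply is_filter_lim_locally_unique in Hx. subst x.
    destruct (linear_norm _ Hlin) as (B & HB & HLB).
    pose proof (diff_dirD HD) as [_ HF]. fold L in HF.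
    specialize (HF (p, g p) (fun P HP => HP)).
    assert (Hc : continuous (fun p' : W => (p', g p') : WR) p).
    { apply (continuous_pairs (V := W) (V' := RN)); [apply continuous_id|exact Hg]. }
    (* Both values of [H] on the graph are 0, so the approximation error of [H] is |a k + L(h,
       0)|. *)
    assert (Key : forall eps : posreal, locally p (fun p' =>
      a * Rabs (g p' - g p) <= B * norm (minus p' p)
         + eps * (2 * (norm (minus p' p) + Rabs (g p' - g p))) /\
      Rabs (a * (g p' - g p) + L ((minus p' p, 0) : WR))
         <= eps * (2 * (norm (minus p' p) + Rabs (g p' - g p))))).
    { intro eps. specialize (HF eps). apply Hc in HF. unfold filtermap in HF.
      pose proof (locally_singleton _ _ HZ) as Z0.
      refine (filter_imp _ _ _ (filter_and _ _ HF HZ)). intros p' [Q Z].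
      set (k := g p' - g p) in *. set (h := minus p' p) in *.
      change (Rabs ((H (p', g p') + - H (p, g p)) + - L ((h, k) : WR)) <= eps * norm ((h, k) : WR)) in Q.
      change (H (p, g p) = 0) in Z0. change (H (p', g p') = 0) in Z. rewrite Z, Z0 in Q.
      assert (EL : L ((h, k) : WR) = L ((h, 0) : WR) + k * a).
      { rewrite split_WR. unfold L. rewrite dirD_plus_r, dirD_scal_r; auto. }
      rewrite EL in Q. replace (0 + - 0 + - (L (h, 0) + k * a)) with (- (a * k + L (h, 0))) in Q by ring.
      rewrite Rabs_Ropp in Q.
      pose proof (norm_WR h k) as Nk. pose proof (cond_pos eps) as Pe.
      assert (Q' : Rabs (a * k + L (h, 0)) <= eps * (2 * (norm h + Rabs k))).
      { eapply Rle_trans; [exact Q|]. apply Rmult_le_compat_l; [lra|exact Nk]. }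
      split; [|exact Q'].
      specialize (HLB h). change (Rabs (L (h, 0)) <= B * norm h) in HLB.
      replace (a * Rabs k) with (Rabs (a * k)) by (rewrite Rabs_mult, (Rabs_right a); lra).
      replace (a * k) with ((a * k + L (h, 0)) - L (h, 0)) by ring.
      eapply Rle_trans; [apply Rabs_triang|]. rewrite Rabs_Ropp. lra. }
    intro eps. pose proof (cond_pos eps) as Pe.
    (* With precision a / 4 the first estimate reads (a / 2) |k| <= (B + a / 2) |h|, which is |k| <=
       Cc |h|. *)
    set (Cc := 2 * B / a + 1).
    assert (HCc : 0 < Cc).
    { unfold Cc. assert (0 < 2 * B / a) by (apply Rdiv_lt_0_compat; lra). lra. }
    assert (P1 : 0 < a / 4) by lra.
    (* With |k| <= Cc |h|, this precision bounds the remainder by eps a |h|; division by [a] gives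
       the required eps |h|. *)
    assert (P2 : 0 < eps * a / (2 * (1 + Cc))).
    { apply Rdiv_lt_0_compat; [apply Rmult_lt_0_compat|]; lra. }
    refine (filter_imp _ _ _ (filter_and _ _ (Key (mkposreal _ P1)) (Key (mkposreal _ P2)))).
    intros p' [[Q1 _] [_ Q2]]. simpl in Q1, Q2.
    set (k := g p' - g p) in *. set (h := minus p' p) in *.
    pose proof (norm_ge_0 h) as Nh. pose proof (Rabs_pos k) as Nk.
    assert (R1 : Rabs k <= Cc * norm h).
    { assert (T : a / 2 * Rabs k <= (B + a / 2) * norm h) by lra.
      unfold Cc. apply Rmult_le_reg_l with (a / 2); [lra|].
      replace (a / 2 * ((2 * B / a + 1) * norm h)) with ((B + a / 2) * norm h) by (field; lra).
      exact T. }
    change (Rabs ((g p' + - g p) + - ((- / a) * L ((h, 0) : WR))) <= eps * norm h).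
    replace ((g p' + - g p) + - ((- / a) * L ((h, 0) : WR))) with (/ a * (a * k + L (h, 0)))
      by (unfold k; field; lra).
    rewrite Rabs_mult, (Rabs_right (/ a)); [|apply Rle_ge, Rlt_le; now apply Rinv_0_lt_compat].
    apply Rmult_le_reg_l with a; auto. rewrite <- Rmult_assoc, Rinv_r, Rmult_1_l by lra.
    eapply Rle_trans; [exact Q2|].
    apply Rle_trans with (eps * a / (2 * (1 + Cc)) * (2 * ((1 + Cc) * norm h))).
    + apply Rmult_le_compat_l; [lra|]. lra.
    + right. field. lra.
Qed.

Lemma is_derive_fibre (H : WR -> R) (p : W) (t : R) : diff H (p, t) ->
  is_derive (fun r => H (p, r)) t (dirD H (p, t) ((zero, 1) : WR)).
Proof.
  intro HD. pose proof (diff_line (zero, 1) HD) as D.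
  apply is_derive_ext with (fun r => (fun h => H (plus ((p, t) : WR) (scal h ((zero, 1) : WR)))) (r - t)).
  - intro r. f_equal. apply (f_equal2 pair).
    + etransitivity; [|apply plus_zero_r]. f_equal. exact (scal_zero_r (V := W) (r - t)).
    + change (t + (r - t) * 1 = r). ring.
  - replace (dirD H (p, t) (zero, 1)) with (scal 1 (dirD H (p, t) (zero, 1))) by (unfold scal; simpl; unfold mult; simpl; ring).
    apply (is_derive_comp (fun h => H (plus ((p, t) : WR) (scal h ((zero, 1) : WR)))) (fun r => r - t)).
    + replace (t - t) with 0 by ring. exact D.
    + auto_derive; auto. 
Qed.

(** [H] is strictly increasing in its last variable on a box: a sign change gives existence by the
    intermediate value theorem, monotonicity gives uniqueness, and trapping the root between nearby
    values gives continuity. *)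
Lemma implicit_function (U : WR -> Prop) (H : WR -> R) (p0 : W) (t0 : R) :
  open U -> Ck 1 U H -> U (p0, t0) -> H (p0, t0) = 0 ->
  0 < dirD H (p0, t0) ((zero, 1) : WR) ->
  exists (O : W -> Prop) (r : R) (g : W -> R), open O /\ O p0 /\ 0 < r /\
   (forall p t, O p -> Rabs (t - t0) < r -> U (p, t) /\ 0 < dirD H (p, t) ((zero, 1) : WR)) /\
   (forall p, O p -> Rabs (g p - t0) < r /\ H (p, g p) = 0) /\
   (forall p t, O p -> Rabs (t - t0) < r -> H (p, t) = 0 -> t = g p) /\
   (forall p, O p -> continuous g p).
Proof.
  intros HU HH U0 Z0 D0.
  pose proof (Ck_dirD ((zero, 1) : WR) HH) as HD.
  set (D := fun e : WR => dirD H e ((zero, 1) : WR)) in *.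
  assert (L : locally ((p0, t0) : WR) (fun e => U e /\ 0 < D e)).
  { apply filter_and; [now apply HU|].
    exact (continuous_gt (Ck_continuous HD U0) D0). }
  destruct L as [rho Hrho].
  (* Half the radius keeps the closed interval, endpoints included, inside the neighbourhood. *)
  set (r := rho / 2). assert (Hr : 0 < r) by (unfold r; pose proof (cond_pos rho); lra).
  assert (Hbox : forall p t, ball p0 rho p -> Rabs (t - t0) <= r -> U (p, t) /\ 0 < D (p, t)).
  { intros p t Hp Ht. apply Hrho. split; [exact Hp|].
    change (Rabs (t - t0) < rho). unfold r in Ht. pose proof (cond_pos rho). lra. }
  assert (Hder : forall p t, ball p0 rho p -> Rabs (t - t0) <= r ->
    is_derive (fun x => H (p, x)) t (D (p, t))).
  { intros p t Hp Ht. apply is_derive_fibre. exact (Ck_diff HH (proj1 (Hbox p t Hp Ht))). }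
  assert (Hmono : forall p t t', ball p0 rho p -> Rabs (t - t0) <= r -> Rabs (t' - t0) <= r ->
    t < t' -> H (p, t) < H (p, t')).
  { intros p t t' Hp Ht Ht' Htt.
    destruct (MVT_gen (fun x => H (p, x)) t t' (fun x => D (p, x))) as (c & Hc & E).
    - intros x Hx. rewrite Rmin_left, Rmax_right in Hx by lra. apply Hder; auto.
      apply Rabs_le. apply Rabs_le_between in Ht, Ht'. lra.
    - intros x Hx. rewrite Rmin_left, Rmax_right in Hx by lra.
      apply continuity_pt_filterlim. apply (ex_derive_continuous (fun x => H (p, x))).
      eexists. apply Hder; auto. apply Rabs_le. apply Rabs_le_between in Ht, Ht'. lra.
    - rewrite Rmin_left, Rmax_right in Hc by lra.
      assert (0 < D (p, c)).
      { apply Hbox; auto. apply Rabs_le. apply Rabs_le_between in Ht, Ht'. lra. }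
      assert (0 < D (p, c) * (t' - t)) by (apply Rmult_lt_0_compat; lra). lra. }
  assert (Rr : Rabs (t0 - r - t0) <= r /\ Rabs (t0 + r - t0) <= r /\ Rabs (t0 - t0) <= r).
  { repeat split; apply Rabs_le; lra. }
  destruct Rr as (Rm & Rp & R0).
  assert (Hcont : forall p t, ball p0 rho p -> Rabs (t - t0) <= r ->
    continuous (fun p' => H (p', t)) p).
  { intros p t Hp Ht.
    apply (continuous_comp (fun p' : W => (p', t) : WR) H).
    - apply (continuous_pairs (V := W) (V' := RN)); [apply continuous_id|apply continuous_const].
    - exact (Ck_continuous HH (proj1 (Hbox p t Hp Ht))). }
  assert (B0 : ball p0 rho p0) by apply ball_center.
  set (P := fun p => ball p0 rho p /\ H (p, t0 - r) < 0 /\ 0 < H (p, t0 + r)).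
  (* Passing to the interior gives openness at once; [p0] lies in it by continuity of [H] at the two
     ends of the interval. *)
  set (O := fun p => locally p P).
  assert (OP : forall p, O p -> P p) by (intros p; apply locally_singleton).
  assert (Hex : forall p, O p -> exists t, Rabs (t - t0) < r /\ H (p, t) = 0).
  { intros p Hp. destruct (OP p Hp) as (Hb & Hm & Hpl).
    assert (Hlt : t0 - r < t0 + r) by lra.
    destruct (Ranalysis5.IVT_interv (fun x => H (p, x)) (t0 - r) (t0 + r)) as (t & Ht & E); auto.
    - intros x Hx. apply continuity_pt_filterlim. apply (ex_derive_continuous (fun x => H (p, x))).
      eexists. apply Hder; auto. apply Rabs_le. lra.
    - exists t. split; auto.
      assert (t <> t0 - r) by (intros ->; lra). assert (t <> t0 + r) by (intros ->; lra).
      apply Rabs_def1; lra. }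
  set (g := fun p => epsilon (inhabits 0) (fun t => Rabs (t - t0) < r /\ H (p, t) = 0)).
  assert (Hg : forall p, O p -> Rabs (g p - t0) < r /\ H (p, g p) = 0).
  { intros p Hp. unfold g. apply epsilon_spec. now apply Hex. }
  assert (Huniq : forall p t, O p -> Rabs (t - t0) < r -> H (p, t) = 0 -> t = g p).
  { intros p t Hp Ht E. destruct (Hg p Hp) as [G1 G2]. destruct (OP p Hp) as [Hb _].
    destruct (Rtotal_order t (g p)) as [Q|[Q|Q]]; auto.
    - assert (H (p, t) < H (p, g p)) by (apply Hmono; auto; lra). lra.
    - assert (H (p, g p) < H (p, t)) by (apply Hmono; auto; lra). lra. }
  exists O, r, g. split; [|split; [|split; [|split; [|split; [|split]]]]]; auto.
  - intros p Hp. apply locally_locally in Hp. exact Hp.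
  - unfold O, P. apply filter_and; [now exists rho|]. apply filter_and.
    + apply (continuous_lt (Hcont p0 (t0 - r) B0 Rm)). rewrite <- Z0. apply Hmono; auto; lra.
    + apply (continuous_gt (Hcont p0 (t0 + r) B0 Rp)). rewrite <- Z0. apply Hmono; auto; lra.
  - intros p t Hp Ht. apply Hbox; [apply (OP p Hp)|lra].
  - intros p Hp. destruct (Hg p Hp) as [G1 G2]. destruct (OP p Hp) as [Hb _].
    intros Q [eps HQ]. pose proof (cond_pos eps) as Pe.
    (* Small enough for the target precision and for [g p - m] and [g p + m] to stay where [H] is
       increasing. *)
    set (m := Rmin eps (r - Rabs (g p - t0)) / 2).
    assert (Hm : 0 < m /\ m < eps /\ m < r - Rabs (g p - t0)).
    { assert (0 < r - Rabs (g p - t0)) by lra. unfold m.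
      pose proof (Rmin_l eps (r - Rabs (g p - t0))). pose proof (Rmin_r eps (r - Rabs (g p - t0))).
      assert (0 < Rmin eps (r - Rabs (g p - t0))) by (apply Rmin_pos; lra). lra. }
    destruct Hm as (M1 & M2 & M3).
    assert (A1 : Rabs (g p - m - t0) <= r).
    { replace (g p - m - t0) with ((g p - t0) - m) by ring.
      eapply Rle_trans; [apply Rabs_triang|]. rewrite Rabs_Ropp, (Rabs_right m); lra. }
    assert (A2 : Rabs (g p + m - t0) <= r).
    { replace (g p + m - t0) with ((g p - t0) + m) by ring.
      eapply Rle_trans; [apply Rabs_triang|]. rewrite (Rabs_right m); lra. }
    assert (L1 : locally p (fun p' => H (p', g p - m) < 0)).
    { apply (continuous_lt (Hcont p (g p - m) Hb A1)). rewrite <- G2. apply Hmono; auto; lra. }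
    assert (L2 : locally p (fun p' => 0 < H (p', g p + m))).
    { apply (continuous_gt (Hcont p (g p + m) Hb A2)). rewrite <- G2. apply Hmono; auto; lra. }
    assert (L3 : locally p (fun p' => O p')) by (apply locally_locally in Hp; exact Hp).
    refine (filter_imp _ _ _ (filter_and _ _ L3 (filter_and _ _ L1 L2))).
    intros p' (K1 & K2 & K3). apply HQ. change (Rabs (g p' - g p) < eps).
    destruct (Hg p' K1) as [G3 G4]. destruct (OP p' K1) as [Hb' _].
    assert (g p - m < g p').
    { destruct (Rlt_le_dec (g p - m) (g p')) as [|[Q1|Q1]]; auto.
      - assert (H (p', g p') < H (p', g p - m)) by (apply Hmono; auto; lra). lra.
      - rewrite Q1 in G4. lra. }
    assert (g p' < g p + m).
    { destruct (Rlt_le_dec (g p') (g p + m)) as [|[Q1|Q1]]; auto.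
      - assert (H (p', g p + m) < H (p', g p')) by (apply Hmono; auto; lra). lra.
      - rewrite <- Q1 in G4. lra. }
    apply Rabs_def1; lra.
Qed.
End Implicit.

Notation R5 := (@WR R4).

Definition coords5 (g : R4 -> R) : list ((R4 -> R) * R5) :=
  (fun p => cmp i1 (fst p), ((basis i1, zero : R2), 0) : R5) ::
  (fun p => cmp i2 (fst p), ((basis i2, zero : R2), 0) : R5) ::
  (fun p => cmp i1 (snd p), ((zero : R2, basis i1), 0) : R5) ::
  (fun p => cmp i2 (snd p), ((zero : R2, basis i2), 0) : R5) ::
  (g, (((zero : R2), (zero : R2)), 1) : R5) :: nil.

Lemma R5_eq (a b c d e a' b' c' d' e' : R) : a = a' -> b = b' -> c = c' -> d = d' -> e = e' ->
  ((((a, b), (c, d)), e) : R5) = (((a', b'), (c', d')), e').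
Proof. now intros -> -> -> -> ->. Qed.

Lemma coords5E g (p : R4) : lincomb (coords5 g) p = ((p, g p) : R5).
Proof.
  destruct p as [[a b] [c d]]. unfold coords5, lincomb.
  assert (E : forall a b c d e : R,
    plus (scal a (((basis i1, zero : R2), 0) : R5)) (plus (scal b (((basis i2, zero : R2), 0) : R5))
     (plus (scal c (((zero : R2, basis i1), 0) : R5)) (plus (scal d (((zero : R2, basis i2), 0) : R5))
      (plus (scal e ((((zero : R2), (zero : R2)), 1) : R5)) zero)))) = ((((a, b), (c, d)), e) : R5)).
  { clear. intros a b c d e.
    change ((((a * 1 + (b * 0 + (c * 0 + (d * 0 + (e * 0 + 0)))), a * 0 + (b * 1 + (c * 0 + (d * 0 + (e * 0 + 0))))),
      (a * 0 + (b * 0 + (c * 1 + (d * 0 + (e * 0 + 0)))), a * 0 + (b * 0 + (c * 0 + (d * 1 + (e * 0 + 0)))))),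
      a * 0 + (b * 0 + (c * 0 + (d * 0 + (e * 1 + 0))))) = (((a, b), (c, d)), e)).
    apply R5_eq; ring. }
  exact (E a b c d (g (a, b, (c, d)))).
Qed.

Lemma Ck_graph k (O : R4 -> Prop) (U : R5 -> Prop) (f : R5 -> R) (g : R4 -> R) : open O ->
  Ck k U f -> Ck k O g -> (forall p, O p -> U (p, g p)) -> Ck k O (fun p => f (p, g p)).
Proof.
  intros HO Hf Hg E.
  apply Ck_ext with (fun p => f (lincomb (coords5 g) p)); auto.
  - intros p _. now rewrite coords5E.
  - apply Ck_lincomb with U; auto.
    + repeat constructor; auto; apply Ck_lin; auto.
      * exact (lin_base i1).
      * exact (lin_base i2).
      * exact (lin_fibre i1).
      * exact (lin_fibre i2).
    + intros p Hp. rewrite coords5E. auto.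
Qed.

(** Bootstrap: the derivative of [g] is expressed through derivatives of [H] along the graph of [g],
    so order [k] for [g] yields order [k + 1]. *)
Lemma implicit_Ck (O : R4 -> Prop) (U : R5 -> Prop) (H : R5 -> R) (g : R4 -> R) : open O ->
  (forall k, Ck k U H) ->
  (forall p, O p -> U (p, g p) /\ 0 < dirD H (p, g p) ((zero, 1) : R5) /\ H (p, g p) = 0 /\ continuous g p) ->
  forall k, Ck k O g.
Proof.
  intros HO HH E.
  assert (D : forall p, O p -> filterdiff g (locally p)
    (fun h => (- / dirD H (p, g p) ((zero, 1) : R5)) * dirD H (p, g p) ((h, 0) : R5))).
  { intros p Hp. destruct (E p Hp) as (E1 & E2 & E3 & E4).
    apply implicit_filterdiff; auto.
    - exact (Ck_diff (HH 1%nat) E1).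
    - apply open_ext_locally with O; auto. intros y Hy. apply (E y Hy). }
  induction k as [|k IH].
  - intros p Hp. apply (E p Hp).
  - split.
    + intros p Hp. eexists. now apply D.
    + intro v. apply Ck_ext with (fun p =>
        (- / dirD H (p, g p) ((zero, 1) : R5)) * dirD H (p, g p) ((v, 0) : R5)); auto.
      * intros p Hp. symmetry. exact (filterdiff_dirD v (D p Hp)).
      * assert (EU : forall p, O p -> U (p, g p)) by (intros p Hp; apply (E p Hp)).
        apply Ck_mult; auto.
        -- apply Ck_opp; auto. apply Ck_inv; auto.
           ++ exact (Ck_graph HO (Ck_dirD ((zero, 1) : R5) (HH (S k))) IH EU).
           ++ intros p Hp. apply Rgt_not_eq. apply (E p Hp).
        -- exact (Ck_graph HO (Ck_dirD ((v, 0) : R5) (HH (S k))) IH EU).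
Qed.

Lemma open_true_R5 : open (fun _ : R5 => True).
Proof. apply open_true. Qed.

Lemma lin5_base i : is_linear (fun e : R5 => cmp i (fst (fst e))).
Proof. exact (lin_comp lin_fst (lin_base i)). Qed.

Lemma lin5_fibre i : is_linear (fun e : R5 => cmp i (snd (fst e))).
Proof. exact (lin_comp lin_fst (lin_fibre i)). Qed.

Lemma lin5_param : is_linear (fun e : R5 => (snd e : R)).
Proof. exact lin_snd. Qed.

(** * The unit normal as a smooth function of the base point and the velocity *)

Section Legendre.
Variables (M : oriented_surface) (F : finsler M) (a : index M) (z0 : R4) (v0 : R2).
Notation ell z v := (lower F a i1 z * fst v + lower F a i2 z * snd v).

(** Degree 0 homogeneity: whether a fibre vector is normal to [v] depends on its direction only, so
    its length can be adjusted afterwards. *)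
Lemma lower_scal j z (l : R) : 0 < l -> slit a z ->
  lower F a j (fst z, scal l (snd z)) = lower F a j z.
Proof.
  intros Hl Hz. pose proof (slit_scal Hl Hz) as Hz'.
  pose proof (dy_norm2_scal F j Hl Hz) as E.
  rewrite (dy_norm2E F j Hz), (dy_norm2E F j Hz'), norm_scal in E; auto; [|apply Hz].
  pose proof (norm_pos F Hz) as P.
  apply Rmult_eq_reg_l with (2 * (l * in_chart a F z)).
  - rewrite E. ring.
  - apply Rgt_not_eq. assert (0 < l * in_chart a F z) by now apply Rmult_lt_0_compat. lra.
Qed.

(** Obtained by differentiating half of F^2 twice; it expresses the Hessian of F through the convex
    form. *)
Lemma fibre_hessian i j z : slit a z ->
  in_chart a F z * dy i (lower F a j) z = gij F a i j z - lower F a i z * lower F a j z.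
Proof.
  intro Hz.
  assert (E : dy i (dy j (fun w => in_chart a F w ^ 2)) z =
    dirD (fun w => 2 * (in_chart a F w * lower F a j w)) z ((zero : R2), basis i)).
  { apply dirD_ext_loc. apply open_ext_locally with (slit a); auto using slit_open.
    intros w Hw. rewrite dy_norm2E; auto. ring. }
  pose proof (norm_diff F Hz) as D1. pose proof (lower_diff F j Hz) as D2.
  rewrite dirD_mult, dirD_const, dirD_mult in E; auto using diff_const, diff_mult.
  unfold gij. rewrite E. unfold lower, dy. field.
Qed.

(** For [e = ((x, v), t)], the fibre vectors y0 + t v0 at [x] run along a line through the known
    normal y0. Every direction near y0 meets this line once v0 is transverse to y0, so the unknown
    normal becomes a single real [t]. *)
Definition leg_map (e : R5) : R4 := (fst (fst e), plus (snd z0) (scal (snd e : R) v0)).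

Lemma leg_map_Ck4 k : Ck4 k (fun _ => True) leg_map.
Proof.
  pose proof open_true_R5 as HO.
  assert (K : forall y v : R, Ck k (fun _ : R5 => True) (fun e : R5 => y + (snd e : R) * v)).
  { intros y v. apply Ck_plus; auto; [now apply Ck_const|].
    apply (Ck_mult (f := fun e : R5 => (snd e : R))); auto; [|now apply Ck_const].
    apply Ck_lin; auto. exact lin5_param. }
  split; split.
  - apply Ck_lin; auto. exact (lin5_base i1).
  - apply Ck_lin; auto. exact (lin5_base i2).
  - exact (K (fst (snd z0)) (fst v0)).
  - exact (K (snd (snd z0)) (snd v0)).
Qed.

Lemma leg_map_diff e : diff4 leg_map e.
Proof. exact (Ck4_diff4 (leg_map_Ck4 1) (w := e) Logic.I). Qed.

Lemma leg_map_dirD e : dirD4 leg_map e ((zero, 1) : R5) = ((zero : R2), v0).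
Proof.
  assert (K : forall y v : R, dirD (fun e : R5 => y + (snd e : R) * v) e ((zero, 1) : R5) = v).
  { intros y v.
    assert (D : diff (fun e : R5 => (snd e : R)) e) by exact (diff_lin e lin5_param).
    rewrite dirD_plus; auto using diff_const, diff_mult.
    rewrite dirD_const, (dirD_mult (f := fun e : R5 => (snd e : R))); auto using diff_const.
    rewrite dirD_const.
    replace (dirD (fun e : R5 => (snd e : R)) e (zero, 1)) with 1; [ring|].
    symmetry. exact (dirD_lin e _ lin5_param). }
  rewrite (surjective_pairing v0).
  apply (f_equal2 pair); apply (f_equal2 pair).
  - exact (dirD_lin e _ (lin5_base i1)).
  - exact (dirD_lin e _ (lin5_base i2)).
  - exact (K (fst (snd z0)) (fst v0)).
  - exact (K (snd (snd z0)) (snd v0)).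
Qed.

Definition leg_dom (e : R5) := slit a (leg_map e).
Definition leg_eq (e : R5) := ell (leg_map e) (snd (fst e)).

Lemma leg_dom_open : open leg_dom.
Proof.
  apply (open_comp leg_map (slit a)).
  - intros e _. apply diff4_continuous. apply leg_map_diff.
  - apply slit_open.
Qed.

Lemma leg_lower_Ck j k : Ck k leg_dom (fun e => lower F a j (leg_map e)).
Proof.
  apply (Ck_comp4 (G := leg_map) leg_dom_open (lower_Ck F a k j)); auto.
  destruct (leg_map_Ck4 k) as [[A1 A2] [A3 A4]].
  repeat split; apply (Ck_sub (U' := fun _ => True)); auto.
Qed.

Lemma leg_eq_Ck k : Ck k leg_dom leg_eq.
Proof.
  pose proof leg_dom_open as HO.
  apply Ck_plus; auto; apply Ck_mult; auto using leg_lower_Ck; apply Ck_lin; auto.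
  - exact (lin5_fibre i1).
  - exact (lin5_fibre i2).
Qed.

Lemma leg_eq_dirD e : leg_dom e -> dirD leg_eq e ((zero, 1) : R5)
  = dirD (lower F a i1) (leg_map e) ((zero : R2), v0) * fst (snd (fst e))
   + dirD (lower F a i2) (leg_map e) ((zero : R2), v0) * snd (snd (fst e)).
Proof.
  intro He.
  assert (D : forall j, diff (fun e => lower F a j (leg_map e)) e).
  { intro j. exact (Ck_diff (leg_lower_Ck j 1) He). }
  assert (E : forall j, dirD (fun e => lower F a j (leg_map e)) e ((zero, 1) : R5)
    = dirD (lower F a j) (leg_map e) ((zero : R2), v0)).
  { intro j. rewrite dirD_comp4.
    - now rewrite leg_map_dirD.
    - apply leg_map_diff.
    - apply lower_diff. exact He. }
  assert (E' : forall j, dirD (fun e => lower F a j (leg_map e) * cmp j (snd (fst e))) e ((zero, 1) : R5)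
    = dirD (lower F a j) (leg_map e) ((zero : R2), v0) * cmp j (snd (fst e))).
  { intro j. rewrite dirD_mult; auto.
    - rewrite (dirD_lin e ((zero, 1) : R5) (lin5_fibre j)), E.
      replace (cmp j (snd (fst ((zero, 1) : R5)))) with 0 by (destruct j; reflexivity). ring.
    - exact (diff_lin e (lin5_fibre j)). }
  etransitivity; [apply (dirD_plus (f := fun e => lower F a i1 (leg_map e) * cmp i1 (snd (fst e)))
    (g := fun e => lower F a i2 (leg_map e) * cmp i2 (snd (fst e))))|].
  - apply diff_mult; auto. exact (diff_lin e (lin5_fibre i1)).
  - apply diff_mult; auto. exact (diff_lin e (lin5_fibre i2)).
  - now rewrite !E'.
Qed.

Hypothesis Hz0 : sphere_in F a z0.
Hypothesis Hv0 : v0 <> zero.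
Hypothesis Hell : ell z0 v0 = 0.

Lemma leg_map0 : leg_map (((fst z0, v0) : R4), 0) = z0.
Proof.
  unfold leg_map. simpl fst. simpl snd. destruct z0 as [x y]. simpl. f_equal.
  exact (plus_scal0 y v0).
Qed.

(** The derivative in [t] is the Hessian of F on (v0, v0), that is g(v0, v0) minus the square of
    [ell] on v0. The latter vanishes, and strong convexity gives the sign. *)
Lemma leg_eq_pos : 0 < dirD leg_eq (((fst z0, v0) : R4), 0) ((zero, 1) : R5).
Proof.
  destruct Hz0 as [Hs H1].
  rewrite leg_eq_dirD; [|unfold leg_dom; now rewrite leg_map0].
  rewrite leg_map0, !dirD_fibre; try now apply lower_diff.
  pose proof (@norm_strongly_convex M F a z0 Hs v0 Hv0) as P.
  pose proof (fibre_hessian i1 i1 Hs) as K11. pose proof (fibre_hessian i1 i2 Hs) as K12.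
  pose proof (fibre_hessian i2 i1 Hs) as K21. pose proof (fibre_hessian i2 i2 Hs) as K22.
  rewrite H1, Rmult_1_l in K11, K12, K21, K22. rewrite K11, K12, K21, K22.
  unfold gdot, sum2, cmp in P. simpl fst. simpl snd.
  assert (K : forall p q g11 g12 g21 g22 l1 l2 : R, l1 * p + l2 * q = 0 ->
    0 < g11 * p * p + g12 * p * q + (g21 * q * p + g22 * q * q) ->
    0 < (p * (g11 - l1 * l1) + q * (g21 - l2 * l1)) * p + (p * (g12 - l1 * l2) + q * (g22 - l2 * l2)) * q).
  { intros p q g11 g12 g21 g22 l1 l2 H0 H.
    replace ((p * (g11 - l1 * l1) + q * (g21 - l2 * l1)) * p + (p * (g12 - l1 * l2) + q * (g22 - l2 * l2)) * q)
      with (g11 * p * p + g12 * p * q + (g21 * q * p + g22 * q * q) - (l1 * p + l2 * q) * (l1 * p + l2 * q)) by ring.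
    rewrite H0. lra. }
  exact (K _ _ _ _ _ _ _ _ Hell P).
Qed.

(* Inverse of the Legendre transform near [v0], up to scaling: [L (x, v)] is
   the unit vector at [x] normal to [v] that is close to [snd z0]. *)
Lemma legendre_inverse : exists (O : R4 -> Prop) (r : R) (L : R4 -> R2),
  open O /\ O (fst z0, v0) /\ 0 < r /\ (forall k, Ck2 k O L) /\
  (forall x v, O (x, v) -> sphere_in F a (x, L (x, v)) /\ ell (x, L (x, v)) v = 0 /\ v <> zero) /\
  (forall x v (al t : R), O (x, v) -> 0 < al -> Rabs t < r ->
     sphere_in F a (x, scal al (plus (snd z0) (scal t v0))) ->
     ell (x, scal al (plus (snd z0) (scal t v0))) v = 0 ->
     scal al (plus (snd z0) (scal t v0)) = L (x, v)).
Proof.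
  destruct (implicit_function leg_dom_open (leg_eq_Ck 1) (p0 := (fst z0, v0)) (t0 := 0))
    as (O1 & r & g & HO1 & O10 & Hr & Hbox & Hg & Huniq & Hcont).
  - exact (eq_ind_r (slit a) (proj1 Hz0) leg_map0).
  - exact (eq_ind_r (fun z => ell z v0 = 0) Hell leg_map0).
  - exact leg_eq_pos.
  (* Nonzero velocity is built into the domain; it is what keeps [omega1] nonzero on the bent
     curves. *)
  - set (O := fun p : R4 => O1 p /\ snd p <> (zero : R2)).
    assert (HO : open O).
    { apply open_and; auto. apply (open_comp (snd : R4 -> R2) (fun y => y <> zero)).
      - intros z _. apply continuous_snd.
      - exact open_neq_zero. }
    assert (gCk : forall k, Ck k O g).
    { apply (implicit_Ck (U := leg_dom) (H := leg_eq)); auto using leg_eq_Ck.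
      intros p [Hp _]. destruct (Hg p Hp) as [G1 G2]. destruct (Hbox p (g p) Hp G1) as [B1 B2].
      repeat split; auto; try apply B1. }
    set (Q := fun p : R4 => leg_map (p, g p)).
    assert (HQ : forall p, O p -> slit a (Q p)).
    { intros p [Hp _]. apply (Hbox p (g p) Hp). apply (Hg p Hp). }
    assert (fCk : forall k, Ck k O (fun p => in_chart a F (Q p))).
    { intro k. apply (Ck_graph (U := leg_dom) (f := fun e => in_chart a F (leg_map e))); auto.
      apply (Ck_comp4 (G := leg_map) leg_dom_open (norm_Ck F a k)); auto.
      destruct (leg_map_Ck4 k) as [[A1 A2] [A3 A4]].
      repeat split; apply (Ck_sub (U' := fun _ => True)); auto. }
    assert (fpos : forall p, O p -> 0 < / in_chart a F (Q p)).
    { intros p Hp. apply Rinv_0_lt_compat. apply norm_pos. now apply HQ. }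
    set (L := fun p : R4 => scal (/ in_chart a F (Q p)) (snd (Q p))).
    assert (fL : forall x v, O (x, v) -> in_chart a F (x, L (x, v)) = 1).
    { intros x v Hp. pose proof (norm_scal F (z := Q (x, v)) (fpos _ Hp) (proj1 (HQ _ Hp))) as E.
      change (in_chart a F (x, L (x, v)) = / in_chart a F (Q (x, v)) * in_chart a F (Q (x, v))) in E.
      rewrite E. pose proof (norm_pos F (HQ _ Hp)). field. lra. }
    exists O, r, L. split; [exact HO|]. split; [now split|]. split; [exact Hr|]. split; [|split].
    + intro k.
      assert (K : forall y v : R, Ck k O (fun p => / in_chart a F (Q p) * (y + g p * v))).
      { intros y v. apply Ck_mult; auto.
        - apply Ck_inv; auto. intros p Hp. apply Rgt_not_eq. now apply norm_pos, HQ.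
        - apply Ck_plus; auto; [now apply Ck_const|]. apply Ck_mult; auto. now apply Ck_const. }
      split; [exact (K (fst (snd z0)) (fst v0))|exact (K (snd (snd z0)) (snd v0))].
    + intros x v Hp. split; [split|split].
      * exact (slit_scal (fpos _ Hp) (HQ _ Hp)).
      * now apply fL.
      * pose proof (lower_scal i1 (fpos _ Hp) (HQ _ Hp)) as E1.
        pose proof (lower_scal i2 (fpos _ Hp) (HQ _ Hp)) as E2.
        change (lower F a i1 (x, L (x, v)) = lower F a i1 (Q (x, v))) in E1.
        change (lower F a i2 (x, L (x, v)) = lower F a i2 (Q (x, v))) in E2.
        refine (eq_trans (f_equal2 (fun s t => s * fst v + t * snd v) E1 E2) _).
        exact (proj2 (Hg _ (proj1 Hp))).
      * apply Hp.
    + intros x v al t Hp Hal Ht [Hs Hf] He.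
      set (y := plus (snd z0) (scal t v0)) in *.
      destruct (Hbox (x, v) t (proj1 Hp)) as [B1 _]; [now rewrite Rminus_0_r|].
      assert (Hsl : slit a (x, y)) by exact B1.
      (* Scaling does not affect normality, so [t] solves the scalar equation; [F = 1] then forces
         the factor [al]. *)
      assert (Et : t = g (x, v)).
      { apply Huniq; [apply Hp|now rewrite Rminus_0_r|].
        pose proof (lower_scal i1 Hal Hsl) as E1. pose proof (lower_scal i2 Hal Hsl) as E2.
        simpl fst in E1, E2. simpl snd in E1, E2. rewrite E1, E2 in He. exact He. }
      assert (EQ : Q (x, v) = (x, y)) by (unfold Q; rewrite <- Et; reflexivity).
      unfold L. rewrite EQ. change (scal al y = scal (/ in_chart a F (x, y)) y). f_equal.
      pose proof (norm_scal F (z := (x, y)) Hal (proj1 Hsl)) as E. simpl fst in E. simpl snd in E.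
      rewrite Hf in E. pose proof (norm_pos F Hsl) as P.
      apply Rmult_eq_reg_r with (in_chart a F (x, y)); [|lra]. rewrite Rinv_l; lra.
Qed.
End Legendre.

(** * Bending a normal lift *)

Section SmoothInto.
Variable M : oriented_surface.

Lemma smooth_into_intro {W : NormedModule R_AbsRing} (U : W -> Prop) (C : W -> TM M) :
  (forall a, open (inside U C a) /\ forall k, Ck4 k (inside U C a) (fun w => coord a (C w))) ->
  smooth_into U C.
Proof.
  intros H a. destruct (H a) as [HO Hk]. repeat split; auto; intro k; apply (Hk k).
Qed.

Lemma Ck4_local {W : NormedModule R_AbsRing} k (U : W -> Prop) (G : W -> R4) :
  (forall w, U w -> exists O G', open O /\ O w /\ (forall y, O y -> G' y = G y) /\ Ck4 k O G') ->
  Ck4 k U G.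
Proof.
  intro H.
  assert (K : forall f : R4 -> R, (forall (O : W -> Prop) G', Ck4 k O G' -> Ck k O (fun w => f (G' w))) ->
    Ck k U (fun w : W => f (G w))).
  { intros f Hf. apply Ck_local. intros w Hw. destruct (H w Hw) as (O & G' & H1 & H2 & H3 & H4).
    exists O. repeat split; auto. apply Ck_ext with (fun w => f (G' w)); auto.
    intros y Hy. now rewrite H3. }
  split; split.
  - apply (K (fun z => fst (fst z))). intros O G' H'. apply H'.
  - apply (K (fun z => snd (fst z))). intros O G' H'. apply H'.
  - apply (K (fun z => fst (snd z))). intros O G' H'. apply H'.
  - apply (K (fun z => snd (snd z))). intros O G' H'. apply H'.
Qed.

Lemma smooth_into_local {W : NormedModule R_AbsRing} (U : W -> Prop) (C : W -> TM M) :
  (forall w, U w -> exists O C', O w /\ (forall y, O y -> U y /\ C' y = C y) /\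
     smooth_into O C') -> smooth_into U C.
Proof.
  intro H. apply smooth_into_intro. intro a.
  assert (K : forall w, inside U C a w -> exists O C', open (inside O C' a) /\ inside O C' a w /\
    (forall y, inside O C' a y -> inside U C a y /\ C' y = C y) /\ smooth_into O C').
  { intros w [Hw Ha]. destruct (H w Hw) as (O & C' & H1 & H2 & H3).
    exists O, C'. split; [exact (inside_open H3 a)|]. split; [|split; auto].
    - split; auto. now rewrite (proj2 (H2 w H1)).
    - intros y [Hy Hy']. destruct (H2 y Hy) as [Hu E]. split; auto. split; auto. now rewrite <- E. }
  split.
  - intros w Hw. destruct (K w Hw) as (O & C' & H1 & H2 & H3 & _).
    refine (filter_imp _ _ _ (H1 w H2)). intros y Hy. apply (H3 y Hy).
  - intro k. apply Ck4_local. intros w Hw. destruct (K w Hw) as (O & C' & H1 & H2 & H3 & H4).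
    exists (inside O C' a), (fun w => coord a (C' w)). repeat split; auto; try apply H2.
    + intros y Hy. now rewrite (proj2 (H3 y Hy)).
    + apply (coord_Ck4 H4 a k).
    + apply (coord_Ck4 H4 a k).
    + apply (coord_Ck4 H4 a k).
    + apply (coord_Ck4 H4 a k).
Qed.

(** Preservation of [Ck] by [h] is taken as a hypothesis, so that the lemma serves both for the
    projection to the time variable and for the inclusion of a time slice. *)
Lemma smooth_into_comp {W W' : NormedModule R_AbsRing} (U : W -> Prop) (U' : W' -> Prop)
  (h : W' -> W) (C : W -> TM M) : smooth_into U C -> open U' ->
  (forall w, U' w -> U (h w)) -> (forall w, U' w -> continuous h w) ->
  (forall k (O : W -> Prop) (O' : W' -> Prop) f, open O' -> (forall w, O' w -> O (h w)) ->
     Ck k O f -> Ck k O' (fun w => f (h w))) ->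
  smooth_into U' (fun w => C (h w)).
Proof.
  intros HC HU' E Hc Hk. apply smooth_into_intro. intro a.
  assert (HO : open (inside U' (fun w => C (h w)) a)).
  { intros w [Hw Ha]. refine (filter_imp _ _ _ (filter_and _ _ (HU' w Hw)
      (Hc w Hw _ (inside_open HC a (h w) (conj (E w Hw) Ha))))).
    intros y [Hy Hy']. split; auto. apply Hy'. }
  split; auto. intro k. destruct (coord_Ck4 HC a k) as [[H1 H2] [H3 H4]].
  assert (Es : forall w, inside U' (fun w => C (h w)) a w -> inside U C a (h w)).
  { intros w [Hw Ha]. split; auto. }
  repeat split.
  - exact (Hk k _ _ _ HO Es H1).
  - exact (Hk k _ _ _ HO Es H2).
  - exact (Hk k _ _ _ HO Es H3).
  - exact (Hk k _ _ _ HO Es H4).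
Qed.

Lemma smooth_into_of_coord {W : NormedModule R_AbsRing} (U : W -> Prop) (G : W -> R4) (a : index M) :
  open U -> (forall k, Ck4 k U G) -> (forall w, U w -> slit a (G w)) ->
  smooth_into U (fun w => of_coord a (G w)).
Proof.
  intros HU HG Hs. apply smooth_into_intro. intro b.
  set (U' := fun w => U w /\ over a b (G w)).
  assert (E : forall w, U' w <-> inside U (fun w => of_coord a (G w)) b w).
  { intro w. split; intros [Hw Hb]; split; auto.
    - apply (overlap_inv Hb).
    - destruct (Hs w Hw) as [Ha _]. destruct (overlap_inv Ha) as (Ha1 & _ & Ea).
      unfold over. rewrite <- Ea. now apply overlap_chart. }
  assert (HO' : open U').
  { apply open_preimage; auto using over_open. intros w Hw.
    apply diff4_continuous. exact (Ck4_diff4 (HG 1%nat) Hw). }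
  assert (HO : open (inside U (fun w => of_coord a (G w)) b)).
  { intros w Hw. apply E in Hw. refine (filter_imp _ _ _ (HO' w Hw)). intros y. apply E. }
  split; auto. intro k. apply Ck4_local. intros w Hw.
  exists U', (fun w => trans4 a b (G w)). split; [exact HO'|]. split; [now apply E|]. split.
  - intros y Hy. destruct (Hs y (proj1 Hy)) as [Ha _]. destruct (overlap_inv (proj2 Hy)) as (Ha' & Hb & _).
    rewrite (coord_trans (a := a) (b := b)); auto. now rewrite coordK.
  - destruct (trans4_Ck4 a b k) as [[T1 T2] [T3 T4]].
    assert (HG' : Ck4 k U' G).
    { destruct (HG k) as [[G1 G2] [G3 G4]].
      repeat split; apply (Ck_sub (U' := U)); auto; intros y Hy; apply Hy. }
    repeat split.
    + apply (Ck_comp4 HO' T1 HG'). intros y Hy. apply Hy.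
    + apply (Ck_comp4 HO' T2 HG'). intros y Hy. apply Hy.
    + apply (Ck_comp4 HO' T3 HG'). intros y Hy. apply Hy.
    + apply (Ck_comp4 HO' T4 HG'). intros y Hy. apply Hy.
Qed.
End SmoothInto.

Lemma Ck_snd k (O : R -> Prop) (O' : R2 -> Prop) (f : R -> R) : open O' ->
  (forall w, O' w -> O (snd w)) -> Ck (V := RN) k O f -> Ck k O' (fun w => f (snd w)).
Proof.
  intros HO' E Hf. apply (Ck_comp1 (P := O) (f := fun w : R2 => snd w)); auto.
  apply Ck_lin; auto. exact (lin_cmp i2).
Qed.

Lemma Ck_slice k (s : R) (O : R2 -> Prop) (O' : R -> Prop) (f : R2 -> R) : open O' ->
  (forall t, O' t -> O (s, t)) -> Ck k O f -> Ck (V := RN) k O' (fun t => f (s, t)).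
Proof.
  intros HO' E Hf.
  apply (Ck_comp2 (W := RN) (g := fun t : R => (s, t)) HO' Hf); auto.
  split.
  - exact (@Ck_const RN k O' s HO').
  - exact (@Ck_lin RN k O' (fun t => t) HO' (@is_linear_id R_AbsRing RN)).
Qed.

Lemma linear_R4 (f : R4 -> R) (u : R4) : is_linear f ->
  f u = fst (fst u) * f (basis i1, zero : R2) + snd (fst u) * f (basis i2, zero : R2)
   + (fst (snd u) * f (zero : R2, basis i1) + snd (snd u) * f (zero : R2, basis i2)).
Proof.
  intro H. pose proof (dirD_R4 u (diff_lin zero H)) as E.
  rewrite (dirD_lin _ _ H) in E. rewrite E. unfold dx, dy. rewrite !(dirD_lin _ _ H). ring.
Qed.

Lemma continuous_det (f g : R -> R) (p q d t : R) : continuous f t -> continuous g t ->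
  continuous (fun t => (p * f t - q * g t) / d) t.
Proof.
  intros Hf Hg.
  apply (continuous_mult (fun t => p * f t - q * g t) (fun _ => / d)); [|apply continuous_const].
  apply (continuous_minus (V := RN) (fun t => p * f t) (fun t => q * g t)).
  - apply (continuous_mult (fun _ => p) f); auto. apply continuous_const.
  - apply (continuous_mult (fun _ => q) g); auto. apply continuous_const.
Qed.

(** * The lift near one time, expressed through the inverse Legendre transform *)

Section Converse.
Variables (M : oriented_surface) (F : finsler M) (lo hi : Rbar) (gamma : R -> M) (N : R -> R2).
Hypothesis HN : normal_lift F lo hi gamma N.
Variables (omega3 : form M) (I J K I1 I2 I3 : TM M -> R).
Hypothesis Hstr : structure_equations F omega3 I J K.
Hypothesis HdI : frame_derivatives F omega3 I I1 I2 I3.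
Variables (t0 : R) (a : index M).
Notation c := (lift M gamma N).
Notation In := (inside (W := RN) (itv lo hi) c a).
Notation z t := (coord a (c t)).
Notation X := (vel1 c a).
Notation ell z v := (lower F a i1 z * fst v + lower F a i2 z * snd v).
Hypothesis Ht0 : In t0.

Definition el_lift (t : R) := I1 (c t) * omega1 F a (z t) (X t)
  + (I3 (c t) + 1) * omega3 a (z t) (X t).

Lemma In_open : open In.
Proof. exact (inside_open (lift_smooth HN) a). Qed.

Lemma z_Ck4 k : Ck4 (W := RN) k In (fun t => z t).
Proof. exact (coord_Ck4 (lift_smooth HN) a k). Qed.

Lemma X_Ck4 k : Ck4 (W := RN) k In X.
Proof.
  destruct (z_Ck4 (S k)) as [[Z1 Z2] [Z3 Z4]].
  split; split.
  - exact (Ck_dirD (V := RN) 1 Z1).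
  - exact (Ck_dirD (V := RN) 1 Z2).
  - exact (Ck_dirD (V := RN) 1 Z3).
  - exact (Ck_dirD (V := RN) 1 Z4).
Qed.

Lemma In_slit t : In t -> slit a (z t).
Proof. intro H. exact (proj1 (lift_sphere_in HN H)). Qed.

Lemma In_omega2 t : In t -> omega2 F a (z t) (X t) = 0.
Proof.
  intro H.
  rewrite <- (pull_chart (lift_smooth HN) (@omega2_free M F) (normal_neq0 HN (proj1 H)) H).
  exact (adm_omega2 (lift_admissible HN) (proj1 H)).
Qed.

Lemma In_omega1 t : In t -> omega1 F a (z t) (X t) <> 0.
Proof.
  intro H.
  rewrite <- (pull_chart (lift_smooth HN) (@omega1_free M F) (normal_neq0 HN (proj1 H)) H).
  exact (adm_omega1 (lift_admissible HN) (proj1 H)).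
Qed.

Lemma along_z k (f : R4 -> R) : Ck k (slit a) f -> Ck (V := RN) k In (fun t => f (z t)).
Proof.
  intro Hf. exact (Ck_comp4 (W := RN) (G := fun t => z t) In_open Hf (z_Ck4 k) In_slit).
Qed.

(** The expression equals dI(T) + omega3(T), because omega2(T) = 0. Its regularity thus comes from
    the smoothness of [I] and of the coefficients of [omega3]. *)
Lemma el_lift_continuous : continuous el_lift t0.
Proof.
  pose proof In_open as HO. destruct (X_Ck4 0) as [[X1 X2] [X3 X4]].
  assert (Ck (V := RN) 0 In el_lift) as H; [|exact (H t0 Ht0)].
  apply (@Ck_ext RN) with (fun t =>
    dirD (V := RN) (fun r => I (c r)) t 1 +
    (fst (fst (X t)) * omega3 a (z t) (basis i1, zero : R2) + snd (fst (X t)) * omega3 a (z t) (basis i2, zero : R2)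
     + (fst (snd (X t)) * omega3 a (z t) (zero : R2, basis i1) + snd (snd (X t)) * omega3 a (z t) (zero : R2, basis i2)))).
  - exact HO.
  - intros t Ht. pose proof (lift_sphere_in HN Ht) as Hs.
    rewrite <- (linear_R4 (X t) (form_linear (omega3_form Hstr) (proj1 Hs))).
    assert (E : dirD (V := RN) (fun r => I (c r)) t 1 =
      I1 (c t) * omega1 F a (z t) (X t) + I3 (c t) * omega3 a (z t) (X t)).
    { etransitivity; [exact (in_chart_C (lift_smooth HN) (1 : RN) Ht
        (Ck_diff (I_smooth Hstr a 1%nat) (proj1 Hs)))|].
      etransitivity; [exact (HdI Hs (lift_tangent HN Ht))|].
      change (vel4 (W := RN) c a 1 t) with (X t).
      rewrite (In_omega2 Ht), !in_chart_coord; try apply Ht. ring. }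
    rewrite E. unfold el_lift. ring.
  - assert (W3 : forall u, Ck (V := RN) 0 In (fun t => omega3 a (z t) u)).
    { intro u. apply (along_z (f := fun w => omega3 a w u)). apply (form_smooth (omega3_form Hstr)). }
    repeat first [apply (@Ck_plus RN); [exact HO| |] | apply (@Ck_mult RN); [exact HO| |]]; auto.
    apply (@Ck_dirD RN).
    apply (Ck_in_chart (lift_smooth HN) a 1 (I_smooth Hstr)).
    intros t Ht. exact (normal_neq0 HN Ht).
Qed.

(** Near [t0] the fibre coordinate of the lift is al (y0 + (be / al) v0) with al close to 1 and be
    close to 0, so the local uniqueness of [legendre_inverse] identifies it with [L]. *)
Lemma legendre_along : exists (O : R4 -> Prop) (L : R4 -> R2),
  open O /\ O (fst (z t0), fst (X t0)) /\ (forall k, Ck2 k O L) /\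
  (forall x v, O (x, v) -> sphere_in F a (x, L (x, v)) /\ ell (x, L (x, v)) v = 0 /\ v <> zero) /\
  locally t0 (fun t => snd (z t) = L (fst (z t), fst (X t))).
Proof.
  pose proof (lift_sphere_in HN Ht0) as Hs.
  pose proof (In_omega2 Ht0) as H2. pose proof (In_omega1 Ht0) as H1.
  assert (Hv : fst (X t0) <> zero).
  { intro E. apply H1. rewrite omega1E, E.
    change (area F a (z t0) * (snd (snd (z t0)) * 0 - fst (snd (z t0)) * 0) = 0). ring. }
  destruct (legendre_inverse Hs Hv H2) as (O & r & L & HO & O0 & Hr & HL & HOL & Huniq).
  exists O, L. split; [exact HO|]. split; [exact O0|]. split; [exact HL|]. split; [exact HOL|].
  destruct (Ck4_diff4 (X_Ck4 1) Ht0) as [DX _]. destruct (Ck4_diff4 (z_Ck4 1) Ht0) as [Dz1 Dz2].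
  assert (C1 : locally t0 (fun t => O (fst (z t), fst (X t)))).
  { assert (Hc : continuous (fun t : R => (fst (z t), fst (X t)) : R4) t0).
    { apply (continuous_pairs (W := RN) (V := R2) (V' := R2)
        (f := fun t => fst (z t)) (h := fun t => fst (X t))).
      - exact (diff2_continuous Dz1).
      - exact (diff2_continuous DX). }
    exact (Hc O (HO _ O0)). }
  set (y1 := (fst (snd (z t0)) : R)). set (y2 := (snd (snd (z t0)) : R)).
  set (v1 := (fst (fst (X t0)) : R)). set (v2 := (snd (fst (X t0)) : R)).
  (* Up to sign and the factor [area] this is omega1(T), so y0 and v0 form a basis of the plane. *)
  set (d := y1 * v2 - y2 * v1).
  assert (Hd : d <> 0).
  { intro E. apply H1. rewrite omega1E.
    change (area F a (z t0) * (y2 * v1 - y1 * v2) = 0).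
    replace (y2 * v1 - y1 * v2) with (- d) by (unfold d; ring). rewrite E. ring. }
  (* Cramer's rule for the coordinates of the fibre vector in the basis (y0, v0). *)
  set (al := fun t : R => (v2 * (fst (snd (z t)) : R) - v1 * (snd (snd (z t)) : R)) / d).
  set (be := fun t : R => (y1 * (snd (snd (z t)) : R) - y2 * (fst (snd (z t)) : R)) / d).
  destruct Dz2 as [D1 D2].
  assert (Ca : continuous al t0).
  { exact (@continuous_det _ _ v2 v1 d _ (diff_continuous D1) (diff_continuous D2)). }
  assert (Cb : continuous be t0).
  { exact (@continuous_det _ _ y1 y2 d _ (diff_continuous D2) (diff_continuous D1)). }
  assert (A0 : al t0 = 1).
  { unfold al. fold y1 y2. change ((v2 * y1 - v1 * y2) / d = 1). replace (v2 * y1 - v1 * y2) with d by (unfold d; ring). field. exact Hd. }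
  assert (B0 : be t0 = 0).
  { unfold be. change ((y1 * y2 - y2 * y1) / d = 0). field. exact Hd. }
  (* al > 1/2 and |be| < r/2 together give |be / al| < r. *)
  assert (C2 : locally t0 (fun t => / 2 < al t)) by (apply (continuous_gt Ca); lra).
  assert (C3 : locally t0 (fun t => be t < r / 2)) by (apply (continuous_lt Cb); lra).
  assert (C4 : locally t0 (fun t => - (r / 2) < be t)) by (apply (continuous_gt Cb); lra).
  refine (filter_imp _ _ _ (filter_and _ _ (In_open Ht0) (filter_and _ _ C1 (filter_and _ _ C2 (filter_and _ _ C3 C4))))).
  intros t (K1 & K2 & K3 & K4 & K5).
  assert (Ey : scal (al t) (plus (snd (z t0)) (scal (be t / al t) (fst (X t0)))) = snd (z t)).
  { rewrite (surjective_pairing (snd (z t))). apply (f_equal2 pair).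
    - change (al t * (y1 + be t / al t * v1) = fst (snd (z t))).
      replace (al t * (y1 + be t / al t * v1)) with (al t * y1 + be t * v1) by (field; lra).
      unfold al, be. set (p := (fst (snd (z t)) : R)). set (q := (snd (snd (z t)) : R)).
      change ((v2 * p - v1 * q) / d * y1 + (y1 * q - y2 * p) / d * v1 = p).
      transitivity (p * (y1 * v2 - y2 * v1) / d); [field; exact Hd|]. fold d. field. exact Hd.
    - change (al t * (y2 + be t / al t * v2) = snd (snd (z t))).
      replace (al t * (y2 + be t / al t * v2)) with (al t * y2 + be t * v2) by (field; lra).
      unfold al, be. set (p := (fst (snd (z t)) : R)). set (q := (snd (snd (z t)) : R)).
      change ((v2 * p - v1 * q) / d * y2 + (y1 * q - y2 * p) / d * v2 = q).
      transitivity (q * (y1 * v2 - y2 * v1) / d); [field; exact Hd|]. fold d. field. exact Hd. }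
  assert (Ez : (fst (z t), scal (al t) (plus (snd (z t0)) (scal (be t / al t) (fst (X t0))))) = z t).
  { rewrite (surjective_pairing (z t)) at 2. f_equal. exact Ey. }
  rewrite <- Ey. apply Huniq; try rewrite Ez.
  - exact K2.
  - lra.
  - unfold Rdiv. rewrite Rabs_mult, Rabs_inv, (Rabs_right (al t)) by lra.
    assert (Q : Rabs (be t) < r / 2) by (apply Rabs_def1; lra).
    apply Rmult_lt_reg_r with (al t); [lra|]. rewrite Rmult_assoc, Rinv_l, Rmult_1_r by lra. nra.
  - exact (lift_sphere_in HN K1).
  - exact (In_omega2 K1).
Qed.
End Converse.

Lemma open_near (t0 d : R) : open (fun t : R => Rabs (t - t0) < d).
Proof.
  apply (open_comp (fun t => Rabs (t - t0)) (fun y => y < d)); [|apply open_lt].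
  intros t _. apply (continuous_comp (fun t => t - t0) Rabs).
  - apply (continuous_minus (V := RN) (fun t : R => t) (fun _ => t0)); [apply continuous_id|apply continuous_const].
  - apply continuous_Rabs.
Qed.

Lemma open_snd (U : R -> Prop) : open U -> open (fun w : R2 => U (snd w)).
Proof.
  intro HU. apply (open_comp (snd : R2 -> R) U); auto. intros w _.
  exact (diff_continuous (diff_lin w (lin_cmp i2))).
Qed.

Lemma open_fst (U : R -> Prop) : open U -> open (fun w : R2 => U (fst w)).
Proof.
  intro HU. apply (open_comp (fst : R2 -> R) U); auto. intros w _.
  exact (diff_continuous (diff_lin w (lin_cmp i1))).
Qed.

(** * The family of bent lifts and its admissibility *)

Section Construction.
Variables (M : oriented_surface) (F : finsler M) (lo hi : Rbar) (gamma : R -> M) (N : R -> R2).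
Hypothesis HN : normal_lift F lo hi gamma N.
Variables (t0 : R) (a : index M).
Notation c := (lift M gamma N).
Notation In := (inside (W := RN) (itv lo hi) c a).
Notation z t := (coord a (c t)).
Notation X := (vel1 c a).
Notation ell z v := (lower F a i1 z * fst v + lower F a i2 z * snd v).

Variables (O : R4 -> Prop) (L : R4 -> R2) (e d1 d2 : R) (n : R2).

Hypothesis HL : forall k, Ck2 k O L.
Hypothesis HOL : forall x v, O (x, v) ->
  sphere_in F a (x, L (x, v)) /\ ell (x, L (x, v)) v = 0 /\ v <> zero.
Hypothesis He : 0 < e.
Hypothesis Hd : 0 < d2 < d1.
Hypothesis Hd1 : forall t, Rabs (t - t0) < d1 ->
  In t /\ snd (z t) = L (fst (z t), fst (X t)).

Notation phi := (bump t0 d2).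
Definition bump' (t : R) : R := dirD (V := RN) phi t 1.
(* The base curve is moved by [s * bump * n], and its lift is recovered from
   the base velocity by the inverse Legendre transform [L]. *)
Definition bend_base (w : R2) : R2 := plus (fst (z (snd w))) (scal (fst w * phi (snd w)) n).
Definition bend_vel (w : R2) : R2 := plus (fst (X (snd w))) (scal (fst w * bump' (snd w)) n).
Definition bend_coord (w : R2) : R4 := (bend_base w, L (bend_base w, bend_vel w)).
(** The two branches agree between distance [d2] and distance [d1] from [t0], where the bump and its
    derivative vanish, so the gluing is smooth. *)
Definition bend (s t : R) : TM M :=
  if Rlt_dec (Rabs (t - t0)) d1 then of_coord a (bend_coord (s, t)) else c t.
Hypothesis Hbox : forall s t, - e < s < e -> Rabs (t - t0) < d1 ->
  O (bend_base (s, t), bend_vel (s, t)).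

Lemma bend_near s t : Rabs (t - t0) < d1 -> bend s t = of_coord a (bend_coord (s, t)).
Proof. intro H. unfold bend. destruct (Rlt_dec (Rabs (t - t0)) d1); [reflexivity|contradiction]. Qed.

Lemma bend_coord_lift s t : Rabs (t - t0) < d1 -> s * phi t = 0 -> s * bump' t = 0 -> bend_coord (s, t) = z t.
Proof.
  intros Ht H1 H2. destruct (Hd1 Ht) as [_ E].
  assert (Ex : bend_base (s, t) = fst (z t)).
  { unfold bend_base. simpl fst. simpl snd. rewrite H1. exact (plus_scal0 (fst (z t)) n). }
  assert (Ev : bend_vel (s, t) = fst (X t)).
  { unfold bend_vel. simpl fst. simpl snd. rewrite H2. exact (plus_scal0 (fst (X t)) n). }
  unfold bend_coord. rewrite Ex, Ev, <- E. symmetry. apply surjective_pairing.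
Qed.

Lemma bend_eq_lift s t : s * phi t = 0 -> s * bump' t = 0 -> bend s t = c t.
Proof.
  intros H1 H2. unfold bend. destruct (Rlt_dec (Rabs (t - t0)) d1) as [Ht|]; [|reflexivity].
  rewrite (bend_coord_lift Ht H1 H2). apply of_coordK. apply (Hd1 Ht).
Qed.

Lemma bend_outside s t : ~ (t0 - d2 < t < t0 + d2) -> bend s t = c t.
Proof.
  intro Ht. destruct (bump_outside Ht) as [E1 E2].
  apply bend_eq_lift; [rewrite E1; ring|].
  assert (D : ex_derive phi t) by (apply diff_R; exact (Ck_diff (V := RN) (bump_Ck 1 t0 d2) (x := t) Logic.I)).
  unfold bump'. rewrite (dirD_R 1 D), E2. ring.
Qed.

Lemma bend_0 t : bend 0 t = c t.
Proof. apply bend_eq_lift; ring. Qed.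

Definition strip (w : R2) := (- e < fst w < e) /\ Rabs (snd w - t0) < d1.

Lemma strip_open : open strip.
Proof.
  apply open_and.
  - apply (open_fst (U := fun s => - e < s < e)). apply open_and; [apply open_gt|apply open_lt].
  - apply (open_snd (U := fun t => Rabs (t - t0) < d1)). apply open_near.
Qed.

Lemma shifted_Ck k (x psi : R -> R) (n1 : R) : Ck (V := RN) k In x ->
  Ck (V := RN) k (fun _ => True) psi ->
  Ck k strip (fun w : R2 => x (snd w) + fst w * psi (snd w) * n1).
Proof.
  intros Hx Hp. pose proof strip_open as H1.
  apply Ck_plus; auto.
  - apply (Ck_snd H1 (O := In)); auto. intros w [_ Hw]. apply (Hd1 Hw).
  - apply Ck_mult; auto; [|now apply Ck_const]. apply Ck_mult; auto.
    + apply Ck_lin; auto. exact (lin_cmp i1).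
    + apply (Ck_snd H1 (O := fun _ => True)); auto.
Qed.

Lemma bump'_Ck k : Ck (V := RN) k (fun _ => True) bump'.
Proof. exact (Ck_dirD (V := RN) 1 (bump_Ck (S k) t0 d2)). Qed.

Lemma bend_base_Ck2 k : Ck2 k strip bend_base.
Proof.
  destruct (z_Ck4 HN a k) as [[Z1 Z2] _]. split.
  - exact (shifted_Ck (fst n) Z1 (bump_Ck k t0 d2)).
  - exact (shifted_Ck (snd n) Z2 (bump_Ck k t0 d2)).
Qed.

Lemma bend_vel_Ck2 k : Ck2 k strip bend_vel.
Proof.
  destruct (X_Ck4 HN a k) as [[Z1 Z2] _]. split.
  - exact (shifted_Ck (fst n) Z1 (bump'_Ck k)).
  - exact (shifted_Ck (snd n) Z2 (bump'_Ck k)).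
Qed.

Lemma strip_box w : strip w -> O (bend_base w, bend_vel w).
Proof. destruct w as [s t]. intros [H1 H2]. now apply Hbox. Qed.

Lemma bend_coord_Ck4 k : Ck4 k strip bend_coord.
Proof.
  assert (HH : Ck4 k strip (fun w => (bend_base w, bend_vel w) : R4)).
  { split; [exact (bend_base_Ck2 k)|exact (bend_vel_Ck2 k)]. }
  destruct (HL k) as [L1 L2].
  split; [exact (bend_base_Ck2 k)|]. split.
  - exact (Ck_comp4 (G := fun w => (bend_base w, bend_vel w) : R4) strip_open L1 HH strip_box).
  - exact (Ck_comp4 (G := fun w => (bend_base w, bend_vel w) : R4) strip_open L2 HH strip_box).
Qed.

Lemma bend_coord_sphere w : strip w -> sphere_in F a (bend_coord w).
Proof. intro H. apply (HOL (strip_box H)). Qed.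

Lemma coord_bend s t : strip (s, t) -> coord a (bend s t) = bend_coord (s, t).
Proof.
  intro H. rewrite bend_near; [|apply H]. apply coordK. apply (bend_coord_sphere H).
Qed.

Lemma dom_bend s t : strip (s, t) -> dom a (fst (bend s t)).
Proof.
  intro H. rewrite bend_near; [|apply H]. destruct (bend_coord_sphere H) as [[Ho _] _].
  apply (overlap_inv Ho).
Qed.

(** Because [d2 < d1], the strip and the open set of times farther than [d2] from [t0] cover the
    interval, and regularity can be checked on each. *)
Lemma far_dichotomy (t : R) : ~ Rabs (t - t0) < d1 -> t < t0 - d2 \/ t0 + d2 < t.
Proof.
  intro H. destruct (Rlt_le_dec t (t0 - d2)); auto. destruct (Rlt_le_dec (t0 + d2) t); auto.
  exfalso. apply H. apply Rabs_def1; lra.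
Qed.

Lemma far_out (t : R) : t < t0 - d2 \/ t0 + d2 < t -> ~ (t0 - d2 < t < t0 + d2).
Proof. lra. Qed.

Notation Dom := (fun w : R2 => - e < fst w < e /\ itv lo hi (snd w)).

Lemma bend_smooth : smooth_into Dom (fun w => bend (fst w) (snd w)).
Proof.
  apply smooth_into_local. intros w [Hw1 Hw2].
  destruct (Rlt_dec (Rabs (snd w - t0)) d1) as [Ht|Ht].
  - exists strip, (fun w => of_coord a (bend_coord w)). split; [now split|]. split.
    + intros [s t] [Hs Hy]. split.
      * split; auto. apply (Hd1 Hy).
      * symmetry. now apply bend_near.
    + apply smooth_into_of_coord; [exact strip_open|exact bend_coord_Ck4|].
      intros y Hy. apply (bend_coord_sphere Hy).
  - set (Q := fun t : R => itv lo hi t /\ (t < t0 - d2 \/ t0 + d2 < t)).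
    assert (HQ : open Q).
    { apply open_and; [apply itv_open|]. apply open_or; [apply open_lt|apply open_gt]. }
    exists (fun w : R2 => (- e < fst w < e) /\ Q (snd w)), (fun w => c (snd w)). split; [|split].
    + split; auto. split; auto. now apply far_dichotomy.
    + intros y [Hy1 [Hy2 Hy3]]. split; [now split|]. symmetry. now apply bend_outside, far_out.
    + apply (smooth_into_comp (U := itv lo hi) (h := fun w : R2 => snd w) (lift_smooth HN)).
      * apply open_and; [|now apply open_snd].
        apply (open_fst (U := fun s => - e < s < e)). apply open_and; [apply open_gt|apply open_lt].
      * intros y Hy. apply Hy.
      * intros y _. exact (diff_continuous (diff_lin y (lin_cmp i2))).
      * intros k P P' f HP E Hf. exact (Ck_snd HP E Hf).
Qed.

Lemma bend_slice s : - e < s < e -> smooth_into (W := RN) (itv lo hi) (bend s).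
Proof.
  intro Hs. apply (smooth_into_comp (W' := RN) (h := fun t : R => (s, t) : R2) bend_smooth).
  - apply itv_open.
  - intros t Ht. now split.
  - intros t _. exact (diff2_continuous (W := RN) (proj1 (diff2_line2 s t))).
  - intros k P P' f HP E Hf. exact (Ck_slice HP E Hf).
Qed.

Lemma shifted_dirD (x psi : R -> R) (s n1 t : R) : diff (V := RN) x t ->
  diff (V := RN) psi t ->
  dirD (V := RN) (fun r => x r + s * psi r * n1) t 1 =
  dirD (V := RN) x t 1 + s * dirD (V := RN) psi t 1 * n1.
Proof.
  intros Hx Hp. pose proof (@diff_const RN s t). pose proof (@diff_const RN n1 t).
  pose proof (@diff_mult RN _ _ _ H Hp) as H1.
  rewrite (@dirD_plus RN x (fun r => s * psi r * n1)); auto.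
  - rewrite (@dirD_mult RN (fun r => s * psi r)); auto.
    rewrite (@dirD_mult RN (fun _ => s)); auto.
    rewrite !(@dirD_const RN). ring.
  - now apply (@diff_mult RN).
Qed.

(** [bend_vel] was entered by hand into the inverse Legendre transform; that it is the true velocity
    of the bent base curve is what makes the new lift normal. *)
Lemma vel1_bend s t : strip (s, t) -> fst (vel1 (bend s) a t) = bend_vel (s, t).
Proof.
  intro H. destruct (Hd1 (proj2 H)) as [Hi _].
  destruct (Ck4_diff4 (z_Ck4 HN a 1) Hi) as [[Z1 Z2] _].
  assert (Dp : diff (V := RN) phi t) by exact (Ck_diff (V := RN) (bump_Ck 1 t0 d2) (x := t) Logic.I).
  transitivity (dirD2 (V := RN) (fun r => bend_base (s, r)) t 1).
  - apply (dirD2_ext_loc (W := RN) (g := fun r => fst (coord a (bend s r)))).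
    apply (open_ext_locally (V := RN) (U := fun r => Rabs (r - t0) < d1)).
    + apply open_near.
    + apply H.
    + intros r Hr. rewrite coord_bend; [reflexivity|]. split; [apply H|exact Hr].
  - apply (f_equal2 pair).
    + exact (shifted_dirD s (fst n) Z1 Dp).
    + exact (shifted_dirD s (snd n) Z2 Dp).
Qed.

(** On the strip, [omega2] vanishes by the choice of [L]. If [omega1] vanished too, the base
    velocity would be zero, which the domain [O] excludes. Elsewhere the curve coincides locally
    with the given lift. *)
Lemma bend_admissible s : - e < s < e -> admissible F lo hi (bend s).
Proof.
  intro Hs. pose proof (bend_slice Hs) as HV. pose proof (lift_admissible HN) as HA.
  assert (Far : forall t, itv lo hi t -> ~ Rabs (t - t0) < d1 -> bend s t = c t /\
    forall a, vel1 (bend s) a t = vel1 c a t).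
  { intros t Ht Hf.
    assert (Q : locally t (fun r => r < t0 - d2 \/ t0 + d2 < r)).
    { destruct (far_dichotomy Hf) as [Q|Q].
      - refine (filter_imp _ _ _ (open_lt (t0 - d2) t Q)). auto.
      - refine (filter_imp _ _ _ (open_gt (t0 + d2) t Q)). auto. }
    assert (Q' : locally t (fun r => bend s r = c r)).
    { refine (filter_imp _ _ _ Q). intros r Hr. apply bend_outside. lra. }
    split; [exact (locally_singleton _ _ Q')|]. intro b. now apply vel1_ext. }
  assert (Pull : forall om t, itv lo hi t -> ~ Rabs (t - t0) < d1 -> pull om (bend s) t = pull om c t).
  { intros om t Ht Hf. destruct (Far t Ht Hf) as [E1 E2].
    rewrite (pullE HV), (pullE (lift_smooth HN)); auto. now rewrite E2, E1. }
  assert (Sph : forall t, itv lo hi t -> sphere F (bend s t)).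
  { intros t Ht. destruct (Rlt_dec (Rabs (t - t0)) d1) as [Hn|Hn].
    - assert (H1 : strip (s, t)) by now split.
      destruct (bend_coord_sphere H1) as [[Ho Hy] Hf]. rewrite bend_near; auto. split.
      + apply dtransition_neq0; auto. destruct (overlap_inv Ho) as (Ha & _ & E).
        rewrite <- E at 2. now apply overlap_at.
      + exact Hf.
    - destruct (Far t Ht Hn) as [-> _]. now apply (adm_sphere HA). }
  assert (Near : forall om t, itv lo hi t -> Rabs (t - t0) < d1 -> chart_free om ->
    pull om (bend s) t = om a (bend_coord (s, t)) (vel1 (bend s) a t)).
  { intros om t Ht Hn Hom. assert (H1 : strip (s, t)) by now split.
    refine (eq_trans (pull_chart HV Hom (proj1 (Sph t Ht)) (conj Ht (dom_bend H1))) _).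
    exact (f_equal (fun q => om a q (vel1 (bend s) a t)) (coord_bend H1)). }
  assert (O2 : forall t, itv lo hi t -> pull (omega2 F) (bend s) t = 0).
  { intros t Ht. destruct (Rlt_dec (Rabs (t - t0)) d1) as [Hn|Hn].
    - assert (H1 : strip (s, t)) by now split.
      rewrite (Near _ t Ht Hn (@omega2_free M F)), omega2E, (vel1_bend H1).
      apply (HOL (strip_box H1)).
    - rewrite Pull; auto. now apply (adm_omega2 HA). }
  split; auto.
  intros t Ht. destruct (Rlt_dec (Rabs (t - t0)) d1) as [Hn|Hn].
  - assert (H1 : strip (s, t)) by now split.
    intro E. pose proof (O2 t Ht) as E2.
    rewrite (Near _ t Ht Hn (@omega1_free M F)) in E.
    rewrite (Near _ t Ht Hn (@omega2_free M F)) in E2.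
    pose proof (omega12_zero (proj1 (bend_coord_sphere H1)) E E2) as E3.
    rewrite (vel1_bend H1) in E3. exact (proj2 (proj2 (HOL (strip_box H1))) E3).
  - rewrite Pull; auto. now apply (adm_omega1 HA).
Qed.

Lemma bend_variation : itv lo hi (t0 - d2) -> itv lo hi (t0 + d2) ->
  variation F lo hi c e (t0 - d2) (t0 + d2) bend.
Proof.
  intros Hp Hq. split.
  - exact He.
  - repeat split; auto; try apply Hp; try apply Hq; lra.
  - exact bend_smooth.
  - exact bend_admissible.
  - intros t _. apply bend_0.
  - intros s t _ _ Ht. now apply bend_outside.
Qed.

(** This is u = omega2(S) at s = 0: the base part of S is the bump times [n]. *)
Lemma bend_omega2 t : Rabs (t - t0) < d1 ->
  pulled (fun w : R2 => bend (fst w) (snd w)) (omega2 F) a (1, 0) (0, t) = phi t * ell (z t) n.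
Proof.
  intro Ht. assert (H : strip (0, t)) by (split; simpl; [lra|exact Ht]).
  assert (E : fst (vel4 (fun w : R2 => bend (fst w) (snd w)) a (1, 0) (0, t)) = scal (phi t) n).
  { transitivity (dirD2 bend_base (0, t) ((1, 0) : R2)).
    - apply (dirD2_ext_loc (g := fun w : R2 => fst (coord a (bend (fst w) (snd w)))) (g' := bend_base)).
      apply open_ext_locally with strip; [exact strip_open|exact H|].
      intros [s r] Hy. exact (f_equal fst (coord_bend Hy)).
    - destruct (Ck2_diff2 (bend_base_Ck2 1) H) as [D1 D2].
      assert (K : forall (x m : R), is_derive (fun s : R => x + s * phi t * m) 0 (phi t * m)).
      { intros x m. generalize (phi t). intro y. auto_derive; auto. ring. }
      apply (f_equal2 pair).
      + refine (eq_trans (eq_sym (is_derive_unique _ _ _ (is_derive_fst D1))) _).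
        apply is_derive_unique. exact (K (fst (fst (z t))) (fst n)).
      + refine (eq_trans (eq_sym (is_derive_unique _ _ _ (is_derive_fst D2))) _).
        apply is_derive_unique. exact (K (snd (fst (z t))) (snd n)). }
  unfold pulled. rewrite omega2E, E. simpl fst at 1 3. simpl snd at 1 3.
  change (lower F a i1 (coord a (bend 0 t)) * (phi t * fst n) + lower F a i2 (coord a (bend 0 t)) * (phi t * snd n) = phi t * ell (z t) n).
  rewrite bend_0. ring.
Qed.
End Construction.

(** * The Euler-Lagrange equation *)

(** Half of [rho] is spent on following the original curve; the bound on [s] keeps the added shift
    within the other half. *)
Lemma small_shift (s B Nn rho y m x x0 : R) : 0 < B -> 0 < Nn -> 0 < rho ->
  - (rho / 2 / (B * Nn)) < s < rho / 2 / (B * Nn) -> Rabs y <= B -> Rabs m <= Nn ->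
  Rabs (x - x0) < rho / 2 -> Rabs (x + s * y * m - x0) < rho.
Proof.
  intros HB HN Hr Hs Hy Hm Hx.
  assert (HBN : 0 < B * Nn) by now apply Rmult_lt_0_compat.
  assert (Hs' : Rabs s < rho / 2 / (B * Nn)) by now apply Rabs_def1.
  assert (P : Rabs (s * y * m) < rho / 2).
  { rewrite !Rabs_mult, Rmult_assoc.
    apply Rle_lt_trans with (Rabs s * (B * Nn)).
    - apply Rmult_le_compat_l; [apply Rabs_pos|]. apply Rmult_le_compat; auto; apply Rabs_pos.
    - replace (rho / 2) with (rho / 2 / (B * Nn) * (B * Nn)) by (field; lra).
      now apply Rmult_lt_compat_r. }
  replace (x + s * y * m - x0) with ((x - x0) + s * y * m) by ring.
  eapply Rle_lt_trans; [apply Rabs_triang|]. lra.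
Qed.

Section Extremal.
Variables (M : oriented_surface) (F : finsler M) (lo hi : Rbar) (gamma : R -> M) (N : R -> R2).
Hypothesis HN : normal_lift F lo hi gamma N.
Variables (omega3 : form M) (I J K I1 I2 I3 : TM M -> R).
Hypothesis Hstr : structure_equations F omega3 I J K.
Hypothesis HdI : frame_derivatives F omega3 I I1 I2 I3.
Notation c := (lift M gamma N).

Section AtChart.
Variable a : index M.
Notation z t := (coord a (c t)).
Notation X := (vel1 c a).
Notation el := (el_lift F gamma N omega3 I1 I3 a).
Notation ell z v := (lower F a i1 z * fst v + lower F a i2 z * snd v).

Lemma extremal_el_lift t0 : N_extremal F lo hi c ->
  inside (W := RN) (itv lo hi) c a t0 ->
  el t0 = 0.
Proof.
  intros Hext Ht0.
  destruct (Req_dec (el t0) 0) as [|Hne]; [assumption|exfalso].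
  destruct (legendre_along HN Ht0) as (O & L & HO & O0 & HL & HOL & Hleg).
  (* omega2 is positive on the fibre coordinate, which is thus a good direction
     for bending the curve. *)
  set (n := snd (z t0)) in *.
  destruct (HO _ O0) as [rho Hrho]. pose proof (cond_pos rho) as Prho.
  pose proof (el_lift_continuous HN Hstr HdI Ht0) as Cel.
  destruct (Ck4_diff4 (X_Ck4 HN a 1) Ht0) as [DX _].
  destruct (Ck4_diff4 (z_Ck4 HN a 1) Ht0) as [Dz _].
  assert (L3 : locally t0 (fun t => ball ((fst (z t0), fst (X t0)) : R4) (rho / 2)
    ((fst (z t), fst (X t)) : R4))).
  { assert (Hc : continuous (fun t : R => (fst (z t), fst (X t)) : R4) t0).
    { apply (continuous_pairs (W := RN) (V := R2) (V' := R2)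
        (f := fun t => fst (z t)) (h := fun t => fst (X t))).
      - exact (diff2_continuous Dz).
      - exact (diff2_continuous DX). }
    assert (P2 : 0 < rho / 2) by lra.
    apply (Hc (fun y => ball ((fst (z t0), fst (X t0)) : R4) (rho / 2) y)).
    exists (mkposreal _ P2). intros y Hy. exact Hy. }
  (* Multiplying by [el t0] handles both signs of a nonzero value at once. *)
  assert (L4 : locally t0 (fun t => 0 < el t0 * el t)).
  { apply (continuous_gt (f := fun t => el t0 * el t)).
    - apply (continuous_mult (fun _ => el t0)); auto. apply continuous_const.
    - apply Rsqr_pos_lt. exact Hne. }
  assert (L5 : locally t0 (fun t => 0 < ell (z t) n)).
  { pose proof (In_slit HN Ht0) as Hs.
    assert (Hlow : forall j, continuous (fun t : R => lower F a j (z t)) t0).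
    { intro j. pose proof (along_z HN (lower_Ck F a 0 j)) as C0. exact (C0 t0 Ht0). }
    apply (continuous_gt (f := fun t : R => ell (z t) n)).
    - apply (continuous_plus (fun t : R => lower F a i1 (z t) * fst n) (fun t : R => lower F a i2 (z t) * snd n)).
      + apply (continuous_mult (fun t : R => lower F a i1 (z t)) (fun _ => (fst n : R))); auto. apply continuous_const.
      + apply (continuous_mult (fun t : R => lower F a i2 (z t)) (fun _ => (snd n : R))); auto. apply continuous_const.
    - pose proof (norm_euler F Hs) as E. pose proof (norm_pos F Hs) as P. fold n in E.
      replace (ell (z t0) n)
        with (in_chart a F (z t0)); [exact P|]. rewrite <- E. ring. }
  destruct (filter_and _ _ (In_open HN Ht0) (filter_and _ _ Hleg (filter_and _ _ L3 (filter_and _ _ L4 L5))))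
    as [d Hd]. pose proof (cond_pos d) as Pd.
  set (d2 := d / 2). assert (Hd2 : 0 < d2 < d) by (unfold d2; lra).
  assert (Hb : forall t, Rabs (t - t0) < d -> ball t0 d t) by (intros t Ht; exact Ht).
  assert (Hd1 : forall t, Rabs (t - t0) < d -> inside (W := RN) (itv lo hi) c a t /\
    snd (z t) = L (fst (z t), fst (X t))).
  { intros t Ht. destruct (Hd t (Hb t Ht)) as (H1 & H2 & _). now split. }
  destruct (bounded_continuity (V := RN) (bump t0 d2) (t0 - d) (t0 + d)) as [B1 HB1].
  { intros t _. exact (bump_Ck 0 t0 d2 t Logic.I). }
  destruct (bounded_continuity (V := RN) (bump' t0 d2) (t0 - d) (t0 + d)) as [B2 HB2].
  { intros t _. exact (bump'_Ck t0 d2 0 t Logic.I). }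
  set (B := Rabs B1 + Rabs B2 + 1). set (Nn := Rabs (fst n) + Rabs (snd n) + 1).
  assert (HB : 0 < B) by (unfold B; pose proof (Rabs_pos B1); pose proof (Rabs_pos B2); lra).
  assert (HNn : 0 < Nn) by (unfold Nn; pose proof (Rabs_pos (fst n)); pose proof (Rabs_pos (snd n)); lra).
  assert (Bphi : forall t, Rabs (t - t0) < d -> Rabs (bump t0 d2 t) <= B /\ Rabs (bump' t0 d2 t) <= B).
  { intros t Ht. apply Rabs_def2 in Ht.
    assert (Ht' : t0 - d <= t <= t0 + d) by lra.
    pose proof (HB1 t Ht') as Q1. pose proof (HB2 t Ht') as Q2.
    change (Rabs (bump t0 d2 t) < B1) in Q1. change (Rabs (bump' t0 d2 t) < B2) in Q2.
    unfold B. pose proof (Rle_abs B1). pose proof (Rle_abs B2).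
    pose proof (Rabs_pos B1). pose proof (Rabs_pos B2). lra. }
  (* [B] bounds the bump and its derivative and [Nn] the components of [n], so parameters below [e]
     move base point and velocity by less than rho / 2. *)
  set (e := rho / 2 / (B * Nn)).
  assert (He : 0 < e).
  { unfold e. apply Rdiv_lt_0_compat; [lra|]. now apply Rmult_lt_0_compat. }
  assert (N1 : Rabs (fst n) <= Nn) by (unfold Nn; pose proof (Rabs_pos (snd n)); lra).
  assert (N2 : Rabs (snd n) <= Nn) by (unfold Nn; pose proof (Rabs_pos (fst n)); lra).
  assert (Hbox : forall s t, - e < s < e -> Rabs (t - t0) < d ->
    O (bend_base gamma N t0 a d2 n (s, t), bend_vel gamma N t0 a d2 n (s, t))).
  { intros s t Hs Ht. apply Hrho.
    destruct (Hd t (Hb t Ht)) as (_ & _ & [[Q1 Q2] [Q3 Q4]] & _).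
    destruct (Bphi t Ht) as [P1 P2].
    split; split.
    - exact (small_shift HB HNn Prho Hs P1 N1 Q1).
    - exact (small_shift HB HNn Prho Hs P1 N2 Q2).
    - exact (small_shift HB HNn Prho Hs P2 N1 Q3).
    - exact (small_shift HB HNn Prho Hs P2 N2 Q4). }
  assert (Hin : forall t, t0 - d2 <= t <= t0 + d2 -> Rabs (t - t0) < d).
  { intros t Ht. apply Rabs_def1; lra. }
  assert (Hp : itv lo hi (t0 - d2)) by (apply (proj1 (Hd1 _ (Hin (t0 - d2) ltac:(lra))))).
  assert (Hq : itv lo hi (t0 + d2)) by (apply (proj1 (Hd1 _ (Hin (t0 + d2) ltac:(lra))))).
  pose proof (bend_variation HN HL HOL He Hd2 Hd1 Hbox Hp Hq) as HV.
  destruct (first_variation Hstr HdI HV) as (h & Ch & Dh & Eh).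
  pose proof (proj2 Hext _ _ _ _ HV) as D0.
  assert (Z : RInt h (t0 - d2) (t0 + d2) = 0).
  { rewrite <- (is_derive_unique _ _ _ Dh). exact (is_derive_unique _ _ _ D0). }
  assert (Eh' : forall t, t0 - d2 <= t <= t0 + d2 -> h t = el t *
    (bump t0 d2 t * (ell (z t) n))).
  { intros t Ht. destruct (Hd1 t (Hin t Ht)) as [Hi _].
    destruct (variation_density omega3 I1 I3 HV (proj1 Hi) Hi) as [Hi' Ed].
    refine (eq_trans (Eh a t Ht Hi') _).
    refine (f_equal2 Rmult Ed _).
    exact (bend_omega2 HN HOL He Hd1 Hbox (Hin t Ht)). }
  set (k := el t0) in *.
  (* The product el(t0) el(t), the bump and [ell] on [n] are all positive inside the interval,
     whereas extremality makes the integral of [h] vanish. *)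
  assert (G : 0 < RInt (fun t => k * h t) (t0 - d2) (t0 + d2)).
  { apply RInt_gt_0.
    - lra.
    - intros t Ht. rewrite Eh' by lra.
      destruct (Hd t (Hb t (Hin t ltac:(lra)))) as (_ & _ & _ & Q4 & Q5).
      rewrite <- Rmult_assoc. apply Rmult_lt_0_compat; [exact Q4|].
      apply Rmult_lt_0_compat; [|exact Q5]. now apply bump_pos.
    - intros t Ht. apply (continuous_mult (fun _ => k) h); auto. apply continuous_const. }
  assert (E : RInt (fun t => k * h t) (t0 - d2) (t0 + d2) = k * RInt h (t0 - d2) (t0 + d2)).
  { apply (RInt_scal (V := R_CompleteNormedModule) h).
    apply (ex_RInt_continuous (V := R_CompleteNormedModule)). intros t Ht.
    rewrite Rmin_left, Rmax_right in Ht by lra. auto. }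
  rewrite E, Z, Rmult_0_r in G. lra.
Qed.
End AtChart.

(** With omega3(T) = - k / sigma the factor of u is (I1 sigma^2 - (I3 + 1) k) / sigma, and [sigma]
    never vanishes. *)
Lemma extremal_iff_euler_lagrange (G : connection M) (k : R -> R) : chern_connection F G ->
  parallel_curvature F lo hi G gamma N k ->
  N_extremal F lo hi c <-> (forall t, itv lo hi t ->
    (I3 (c t) + 1) * k t = I1 (c t) * sigma_of F gamma N t ^ 2).
Proof.
  intros HG Hk.
  assert (E : forall t, itv lo hi t -> I1 (c t) * sigma_of F gamma N t
    + (I3 (c t) + 1) * omega3 (chart_at (gamma t)) (coord (chart_at (gamma t)) (c t)) (vel1 c (chart_at (gamma t)) t)
    = (I1 (c t) * sigma_of F gamma N t ^ 2 - (I3 (c t) + 1) * k t) / sigma_of F gamma N t).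
  { intros t Ht. rewrite (omega3_curvature HN Hstr HG Ht (Hk t Ht)).
    pose proof (sigma_neq0 HN Ht). field. assumption. }
  split.
  - intros Hext t Ht. pose proof (extremal_el_lift Hext (lift_inside gamma N Ht)) as Z.
    unfold el_lift in Z. rewrite <- (sigmaE HN Ht), E in Z; auto.
    pose proof (sigma_neq0 HN Ht) as Hs.
    apply Rmult_integral in Z. destruct Z as [Z|Z]; [lra|].
    exfalso. now apply (Rinv_neq_0_compat _ Hs).
  - intros H. apply (euler_lagrange_extremal HN Hstr HdI).
    intros t Ht. rewrite E, (H t Ht); auto. unfold Rdiv. ring.
Qed.
End Extremal.

Theorem theorem5p4 (M : oriented_surface) (F : finsler M)
    (omega3 : form M) (I J K : TM M -> R)
    (Hstr : structure_equations F omega3 I J K)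
    (I1 I2 I3 : TM M -> R)
    (HdI : frame_derivatives F omega3 I I1 I2 I3)
    (G : connection M) (HG : chern_connection F G) :
  (forall (lo hi : Rbar) (gamma : R -> M) (N : R -> R2) (k : R -> R),
    Rbar_lt lo hi ->
    normal_lift F lo hi gamma N ->
    parallel_curvature F lo hi G gamma N k ->
    let euler_lagrange :=
      forall t, itv lo hi t ->
        (I3 (lift M gamma N t) + 1) * k t
        = I1 (lift M gamma N t) * sigma_of F gamma N t ^ 2 in
    (N_extremal F lo hi (lift M gamma N) <-> euler_lagrange)
    /\
    ((forall t, itv lo hi t -> I1 (lift M gamma N t) = 0) ->
     (forall t, itv lo hi t -> I3 (lift M gamma N t) + 1 <> 0) ->
     (euler_lagrange -> forall t, itv lo hi t -> k t = 0) /\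
     (N_extremal F lo hi (lift M gamma N) <-> N_parallel lo hi G gamma N))
    /\
    ((forall t, itv lo hi t -> I1 (lift M gamma N t) <> 0) ->
     (forall t, itv lo hi t -> I3 (lift M gamma N t) + 1 <> 0) ->
     let curvature_formula :=
       forall t, itv lo hi t ->
         k t = I1 (lift M gamma N t) / (I3 (lift M gamma N t) + 1)
               * sigma_of F gamma N t ^ 2 in
     (euler_lagrange -> curvature_formula) /\
     (N_extremal F lo hi (lift M gamma N) <-> curvature_formula)))
  /\
  ((forall (lo hi : Rbar) (gamma : R -> M) (N : R -> R2),
      Rbar_lt lo hi -> normal_lift F lo hi gamma N ->
      N_parallel lo hi G gamma N ->
      N_extremal F lo hi (lift M gamma N)) ->
   forall (lo hi : Rbar) (gamma : R -> M) (N : R -> R2),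
     Rbar_lt lo hi -> normal_lift F lo hi gamma N ->
     N_parallel lo hi G gamma N ->
     forall t, itv lo hi t -> I1 (lift M gamma N t) = 0).
Proof.
  split.
  - intros lo hi gamma N k _ HN Hk euler_lagrange.
    assert (EL : N_extremal F lo hi (lift M gamma N) <-> euler_lagrange)
      by exact (extremal_iff_euler_lagrange HN Hstr HdI HG Hk).
    split; [exact EL|]. split.
    + intros H1 H3.
      assert (K0 : euler_lagrange -> forall t, itv lo hi t -> k t = 0).
      { intros H t Ht. specialize (H t Ht). rewrite (H1 t Ht), Rmult_0_l in H.
        apply Rmult_integral in H. destruct H as [H|H]; [now destruct (H3 t Ht)|exact H]. }
      split; [exact K0|]. rewrite EL. split.
      * intros H t Ht. rewrite (Hk t Ht), (K0 H t Ht). unfold Rdiv.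
        rewrite Rmult_0_l, Ropp_0. apply scal0.
      * intros H t Ht. rewrite (H1 t Ht), Rmult_0_l.
        pose proof (sigma_neq0 HN Ht) as Hs. pose proof (tangent_neq0 HN Ht) as HT.
        pose proof (Hk t Ht) as E. rewrite (H t Ht) in E.
        (* Otherwise a nonzero multiple of the tangent would vanish, contrary to unit speed. *)
        destruct (Req_dec (k t) 0) as [->|Hne]; [ring|exfalso].
        apply HT. set (r := - (k t / sigma_of F gamma N t ^ 2)) in E.
        assert (Hr : r <> 0).
        { unfold r. apply Ropp_neq_0_compat. apply Rmult_integral_contrapositive.
          split; auto. apply Rinv_neq_0_compat. now apply pow_nonzero. }
        transitivity (scal (/ r) (scal r (tangent M gamma t))).
        -- rewrite scal_assoc.
           transitivity (scal (1 : R) (tangent M gamma t)); [symmetry; exact (scal_one (tangent M gamma t))|].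
           f_equal. unfold mult; simpl. field. exact Hr.
        -- rewrite <- E. exact (scal_zero_r (V := R2) (/ r)).
    + intros _ H3 curvature_formula.
      assert (EC : euler_lagrange <-> curvature_formula).
      { split; intros H t Ht; specialize (H t Ht); pose proof (H3 t Ht) as Q.
        - apply Rmult_eq_reg_l with (I3 (lift M gamma N t) + 1); auto.
          rewrite H. field. exact Q.
        - rewrite H. field. exact Q. }
      split; [apply EC|]. rewrite EL. exact EC.
  - intros Hall lo hi gamma N Hlt HN HP t Ht.
    (* An N-parallel has parallel curvature 0, so the Euler-Lagrange equation along it reads 0 = I1
       sigma^2. *)
    assert (Hk : parallel_curvature F lo hi G gamma N (fun _ => 0)).
    { intros r Hr. rewrite (HP r Hr). symmetry. unfold Rdiv. rewrite Rmult_0_l, Ropp_0. apply scal0. }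
    pose proof (proj1 (extremal_iff_euler_lagrange HN Hstr HdI HG Hk) (Hall lo hi gamma N Hlt HN HP) t Ht) as E.
    rewrite Rmult_0_r in E. symmetry in E. apply Rmult_integral in E.
    destruct E as [E|E]; [exact E|].
    exfalso. apply (pow_nonzero _ 2 (sigma_neq0 HN Ht)). exact E.
Qed.
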